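(* Let $(d_n)_{n\in\mathbb{N}}$ be a sequence of natural numbers with $d_n\to\infty$. Let $Z_i$, $i\in\mathbb{N}$, be i.i.d. random variables on $(\Omega,\mathcal{A},\mathbb{P})$ with values in $l^2$ such that $\mathbb{E}[Z_1]=0$ and $\mathbb{E}[\|Z_1\|^2]<\infty$, and let $\Gamma=\mathrm{Cov}[Z_1]$. Let $\lambda_i$, $i\in\mathbb{N}$, be the eigenvalues of $\Gamma$, let $N_i$, $i\in\mathbb{N}$, be i.i.d. standard normal random variables, and let $F_\infty$ be the distribution function of $V_\infty=\sum_{i=1}^\infty\lambda_iN_i^2$. Then the bootstrap statistics $W_n^*(\omega)$ built from the observations $X_{ni}=(Z_i^{(1)},\ldots,Z_i^{(d_n)})$, $1\le i\le n$, satisfy $$\sup_{x\in\mathbb{R}}|\mathbb{P}^*(W_n^*(\omega)\le x)-F_\infty(x)|\to0,\quad n\to\infty,\quad\text{for }\mathbb{P}\text{-almost all }\omega\in\Omega.$$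
   Context: $l^2$ is the Hilbert space of square-summable real sequences $x=(x^{(i)})_{i\in\mathbb{N}}$ with norm $\|\cdot\|$; $\|\cdot\|_d$ is the Euclidean norm on $\mathbb{R}^d$. $\mathrm{Cov}[Z_1]$ is the covariance operator of $Z_1$ on $l^2$, identified with the infinite matrix $\Gamma(k,l)=\mathbb{E}[Z_1^{(k)}Z_1^{(l)}]$; its eigenvalues are listed with multiplicity (padded by zeros if only finitely many are nonzero). Bootstrap construction: for every $n\in\mathbb{N}$ let $i_{n1},\ldots,i_{nn}$ be random variables on some probability space $(\Omega^*,\mathcal{A}^*,\mathbb{P}^* )$ that are $\mathbb{P}^*$-independent and each uniformly distributed on $\{1,\ldots,n\}$. For $\omega\in\Omega$ and $1\le k\le n$ define $\xi_{nk}(\omega):\Omega^*\to\mathbb{R}^{d_n}$ by $\xi_{nk}(\omega)(\omega^* ):=X_{n\,i_{nk}(\omega^* )}(\omega)$. Put $\overline{X}_n(\omega):=n^{-1}\sum_{i=1}^nX_{ni}(\omega)$, $\overline{\xi}_n(\omega):=n^{-1}\sum_{k=1}^n(\xi_{nk}(\omega)-\overline{X}_n(\omega))$ and $W_n^*(\omega):=n\|\overline{\xi}_n(\omega)\|_{d_n}^2$; for each fixed $\omega$, $W_n^*(\omega)$ is a random variable on $(\Omega^*,\mathcal{A}^*,\mathbb{P}^* )$. *)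

(* Defs.v *)
From HB Require Import structures.
From mathcomp Require Import all_boot all_order all_algebra finmap.
From mathcomp Require Import all_classical all_reals all_analysis.
From mathcomp Require Import ring lra.

(* All indices (coordinates, observations, eigenvalues) start at 0 rather
   than 1. *)

Set Implicit Arguments.
Unset Strict Implicit.
Unset Printing Implicit Defensive.

Import Order.TTheory GRing.Theory Num.Theory.
Import numFieldNormedType.Exports.

Local Open Scope classical_set_scope.
Local Open Scope ring_scope.

Section square_summable.
Context {R : realType}.

Definition square_summable : {pred (nat -> R)} :=
  [pred x : nat -> R | `[< cvgn (series (fun i => x i ^+ 2)) >]].

Lemma square_summable_mul (x y : nat -> R) :
  x \in square_summable -> y \in square_summable ->
  cvgn (series (fun i => x i * y i)).
Proof.
move=> /asboolP cx /asboolP cy; apply: normed_cvg.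
have cxy : cvgn (series ((fun i => x i ^+ 2) + (fun i => y i ^+ 2))).
  exact: is_cvg_seriesD.
apply: series_le_cvg cxy => n /=; rewrite ?normr_ge0//.
  by rewrite addr_ge0// sqr_ge0.
rewrite /GRing.add/= normrM -(real_normK (num_real (x n))).
rewrite -(real_normK (num_real (y n))).
have := sqr_ge0 (`|x n| - `|y n|); rewrite sqrrB.
have := mulr_ge0 (normr_ge0 (x n)) (normr_ge0 (y n)).
by move: (`|x n|) (`|y n|) => a b; lra.
Qed.

Lemma square_summable_submod : submod_closed square_summable.
Proof.
split=> [|a x y xS yS]; apply/asboolP.
  rewrite (_ : series _ = fun=> 0); first exact: is_cvg_cst.
  apply/funext => n; rewrite /series/= big1// => i _.
  by rewrite expr0n.
have cxy := square_summable_mul xS yS.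
move: (xS) (yS) => /asboolP cx /asboolP cy.
rewrite (_ : (fun i => _) = a ^+ 2 *: (fun i => x i ^+ 2)
  + ((a *+ 2) *: (fun i => x i * y i) + (fun i => y i ^+ 2))); last first.
  apply/funext => i; rewrite /GRing.scale/GRing.add/= /GRing.scale/=.
  by ring.
apply: is_cvg_seriesD; first exact: is_cvg_seriesZ.
by apply: is_cvg_seriesD => //; exact: is_cvg_seriesZ.
Qed.

HB.instance Definition _ :=
  GRing.isSubmodClosed.Build R (nat -> R) square_summable
    square_summable_submod.

End square_summable.

Record l2 (R : realType) := L2 {
  l2_seq :> nat -> R ;
  l2_seqP : l2_seq \in square_summable }.

HB.instance Definition _ (R : realType) := [isSub for @l2_seq R].
HB.instance Definition _ (R : realType) := [Choice of l2 R by <:].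
HB.instance Definition _ (R : realType) :=
  [SubChoice_isSubLmodule of l2 R by <:].

Section l2_hilbert.
Context {R : realType}.
Implicit Types x y z : l2 R.

Definition l2_dot x y : R := limn (series (fun i => x i * y i)).

Definition l2_norm x : R := Num.sqrt (limn (series (fun i => x i ^+ 2))).

Lemma l2_normE x : l2_norm x = Num.sqrt (l2_dot x x).
Proof. by []. Qed.

Lemma l2_dotC x y : l2_dot x y = l2_dot y x.
Proof.
by rewrite /l2_dot; congr (limn (series _)); apply/funext => i; rewrite mulrC.
Qed.

Lemma l2_dotP a x y z : l2_dot (a *: x + y) z = a * l2_dot x z + l2_dot y z.
Proof.
have cxz := square_summable_mul (l2_seqP x) (l2_seqP z).
have cyz := square_summable_mul (l2_seqP y) (l2_seqP z).
rewrite /l2_dot (_ : (fun i => _) = a *: (fun i => x i * z i)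
  + (fun i => y i * z i)); last first.
  apply/funext => i; rewrite -[LHS]/((a * x i + y i) * z i).
  by rewrite mulrDl -mulrA.
rewrite lim_seriesD//; last exact: is_cvg_seriesZ.
by rewrite lim_seriesZ.
Qed.

Lemma l2_dotDl x y z : l2_dot (x + y) z = l2_dot x z + l2_dot y z.
Proof. by rewrite -[x]scale1r l2_dotP mul1r scale1r. Qed.

Lemma l2_dot0l z : l2_dot 0 z = 0.
Proof. by have := l2_dotDl 0 0 z; rewrite addr0; lra. Qed.

Lemma l2_dotZl a x z : l2_dot (a *: x) z = a * l2_dot x z.
Proof. by rewrite -[a *: x]addr0 l2_dotP l2_dot0l addr0. Qed.

Lemma l2_sqr_le_dot x i : x i ^+ 2 <= l2_dot x x.
Proof.
have cx := square_summable_mul (l2_seqP x) (l2_seqP x).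
have xx_ge0 j : 0 <= x j * x j by rewrite -expr2 sqr_ge0.
apply: le_trans (nondecreasing_cvgn_le _ cx i.+1).
  by rewrite /series/= big_nat_recr//= -expr2 lerDr sumr_ge0.
by apply/nondecreasing_seqP => n; rewrite /series/= big_nat_recr//= lerDl.
Qed.

Lemma l2_dot_ge0 x : 0 <= l2_dot x x.
Proof. exact: le_trans (sqr_ge0 (x 0%N)) (l2_sqr_le_dot x 0). Qed.

Lemma l2_cauchy_schwarz x y : l2_dot x y <= l2_norm x * l2_norm y.
Proof.
rewrite !l2_normE -sqrtrM ?l2_dot_ge0//.
apply: le_trans (ler_norm _) _; rewrite -sqrtr_sqr ler_sqrt; last first.
  by rewrite mulr_ge0// l2_dot_ge0.
have h t : 0 <= t ^+ 2 * l2_dot x x + (t *+ 2) * l2_dot x y + l2_dot y y.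
  have := l2_dot_ge0 (t *: x + y).
  rewrite l2_dotP !(l2_dotC _ (t *: x + y)) !l2_dotP (l2_dotC y x).
  by rewrite mulrDr expr2; lra.
have := l2_dot_ge0 x; rewrite le_eqVlt => /predU1P[x0|x0]; last first.
  have := h (- l2_dot x y / l2_dot x x); move: x0.
  move: (l2_dot x x) (l2_dot x y) (l2_dot y y) => a b c a0 H.
  rewrite -subr_ge0 -(pmulr_rge0 _ a0).
  have := mulr_ge0 (sqr_ge0 a) H.
  by congr (0 <= _); field; rewrite gt_eqF.
rewrite -x0 mul0r exprn_even_le0//=; apply/eqP.
move: h; rewrite -x0; move: (l2_dot x y) (l2_dot y y) => b c h.
apply/eqP; apply: contraT => b0.
have := h (- (c + 1) / (b *+ 2)).
rewrite (_ : _ + _ = -1); first by rewrite lerNr oppr0 ler10.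
by field.
Qed.

Lemma ler_l2_normD x y : l2_norm (x + y) <= l2_norm x + l2_norm y.
Proof.
rewrite -(@ler_pXn2r _ 2) ?nnegrE ?addr_ge0 ?sqrtr_ge0// sqrrD.
have := l2_cauchy_schwarz x y.
rewrite !l2_normE !sqr_sqrtr ?l2_dot_ge0//.
rewrite l2_dotDl !(l2_dotC _ (x + y)) !l2_dotDl (l2_dotC y x).
by lra.
Qed.

Lemma l2_normZ a x : l2_norm (a *: x) = `|a| * l2_norm x.
Proof.
rewrite !l2_normE l2_dotZl l2_dotC l2_dotZl mulrA -expr2.
by rewrite sqrtrM ?sqr_ge0// sqrtr_sqr.
Qed.

Lemma l2_norm0_eq0 x : l2_norm x = 0 -> x = 0.
Proof.
rewrite l2_normE => /eqP; rewrite sqrtr_eq0 => x0.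
apply/val_inj/funext => i; apply/eqP; rewrite -sqrf_eq0 eq_le sqr_ge0 andbT.
exact: le_trans (l2_sqr_le_dot x i) x0.
Qed.

HB.instance Definition _ := Lmodule_isNormed.Build R (l2 R)
  ler_l2_normD l2_normZ l2_norm0_eq0.

(* l^2 carries the Borel sigma-algebra of its norm topology. *)
HB.instance Definition _ := @isMeasurable.Build (sigma_display (@open (l2 R)))
  (l2 R) <<s (@open (l2 R)) >>
  (@sigma_algebra0 _ setT _) (@sigma_algebraC _ _)
  (@sigma_algebra_bigcup _ setT _).

End l2_hilbert.

Definition mutually_independent d d' (T : measurableType d)
    (T' : measurableType d') (R : realType) (P : probability T R)
    (I : choiceType) (X : I -> {RV P >-> T'}) : Prop :=
  forall (J : {fset I}) (B : I -> set T'), (forall i, measurable (B i)) ->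
    P (\bigcap_(i in [set` J]) (X i @^-1` B i)) =
    (\prod_(i <- J) P (X i @^-1` B i))%E.

Definition identically_distributed d d' (T : measurableType d)
    (T' : measurableType d') (R : realType) (P : probability T R)
    (I : choiceType) (X : I -> {RV P >-> T'}) : Prop :=
  forall i j (B : set T'), measurable B ->
    distribution P (X i) B = distribution P (X j) B.

Definition iid d d' (T : measurableType d)
    (T' : measurableType d') (R : realType) (P : probability T R)
    (I : choiceType) (X : I -> {RV P >-> T'}) : Prop :=
  mutually_independent X /\ identically_distributed X.

Definition standard_normal d (T : measurableType d) (R : realType)
    (P : probability T R) (X : {RV P >-> R}) : Prop :=
  forall B : set R, measurable B -> distribution P X B = normal_prob 0 1 B.

(* Expectation of an l^2-valued random variable as a weak (Pettis) integral:
   the vector [m] with E<u, X> = <u, m> for every u.  It coincides with the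
   Bochner expectation whenever E||X|| is finite. *)
Definition l2_mean d (T : measurableType d) (R : realType)
    (P : probability T R) (X : {RV P >-> l2 R}) (m : l2 R) : Prop :=
  forall u : l2 R, 'E_P[fun w => l2_dot u (X w)]%E = (l2_dot u m)%:E.

(* Matrix of the covariance operator of a centred l^2-valued variable. *)
Definition l2_cov d (T : measurableType d) (R : realType)
    (P : probability T R) (X : {RV P >-> l2 R}) (k l : nat) : R :=
  fine 'E_P[fun w => (X w k * X w l)%R]%E.

Definition l2_eigenspace (R : realType) (G : nat -> nat -> R) (mu : R)
    : set (l2 R) :=
  [set v : l2 R | forall k,
     series (fun l => G k l * v l) @ \oo --> mu * v k].

Definition has_dim (R : realType) (V : lmodType R) (E : set V) (m : nat)
    : Prop :=
  exists b : 'I_m -> V,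
    (forall c : 'I_m -> R, \sum_i c i *: b i = 0 -> forall i, c i = 0) /\
    E = range (fun c : 'I_m -> R => \sum_i c i *: b i).

(* [lam] lists the eigenvalues of [G] with multiplicity: every nonzero [mu]
   occurs in [lam] exactly dim(ker(G - mu)) times (so not at all when [mu] is
   not an eigenvalue).  The number of zero entries is left free: zeros are
   either padding or the eigenvalue 0. *)
Definition eigenvalue_list (R : realType) (G : nat -> nat -> R)
    (lam : nat -> R) : Prop :=
  forall mu : R, mu != 0 ->
    forall m : nat,
      has_dim (l2_eigenspace G mu) m <-> ([set i | lam i = mu] #= `I_m)%card.

(* Summed in [\bar R], so that no convergence is presupposed. *)
Definition weighted_chi2 d (T : measurableType d) (R : realType)
    (P : probability T R) (lam : nat -> R) (N : nat -> {RV P >-> R}) (w : T)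
    : \bar R :=
  (\sum_(0 <= i <oo) (lam i * N i w ^+ 2)%:E)%E.

(* The library norm on ['rV_d] is the sup norm. *)
Definition eucl_norm (R : realType) (d : nat) (v : 'rV[R]_d) : R :=
  Num.sqrt (\sum_(j < d) v ord0 j ^+ 2).

Definition truncate (R : realType) (d : nat) (x : l2 R) : 'rV[R]_d :=
  \row_(j < d) x j.

Definition uniform_on_initial d (T : measurableType d) (R : realType)
    (P : probability T R) (n : nat) (X : {RV P >-> nat}) : Prop :=
  (forall w, (X w < n)%N) /\
  (forall j, (j < n)%N -> distribution P X [set j] = (n%:R^-1)%:E).

Definition bootstrap_indices d (T : measurableType d) (R : realType)
    (P : probability T R) (idx : forall n, 'I_n -> {RV P >-> nat}) : Prop :=
  forall n, mutually_independent (idx n) /\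
    forall k, uniform_on_initial n (idx n k).

Definition sample_mean (R : realType) (d n : nat) (X : nat -> 'rV[R]_d)
    : 'rV[R]_d :=
  n%:R^-1 *: \sum_(i < n) X i.

(* [X 0], ..., [X n.-1] are the observations and [ix] the resampled indices:
   [X (ix k)] is the bootstrap variable xi_{nk}. *)
Definition bootstrap_stat (R : realType) (d n : nat) (X : nat -> 'rV[R]_d)
    (ix : 'I_n -> nat) : R :=
  n%:R * eucl_norm
    (n%:R^-1 *: \sum_(k < n) (X (ix k) - sample_mean n X)) ^+ 2.

(* Main.v *)
(** For a fixed sample, let S be the normalized bootstrap sum in l^2 and (e_j)
    orthonormal eigenvectors of Gamma attached to the nonzero lambda_j.  The
    Laplace transform of sum_(j < m) <S, e_j>^2 is computed by iterating the
    averaging operator h |-> n^-1 sum_i h(. + b_i): on Gaussian functions each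
    step is, up to o(1/n), a step of length 1/n of the heat flow, so that n steps
    give prod_(j < m) (1 + 2 t lambda_j)^(-1/2) in the limit.  Both the statistic W and
    sum_(j < m) <S, e_j>^2 are |S|^2 minus a nonnegative remainder whose bootstrap
    mean is bounded by a sample average; by the strong law of large numbers these
    averages converge to tails of the trace identity
    E|Z|^2 = sum_k Gamma_kk = sum_j lambda_j.  Hence the moments of exp(-W)
    converge almost surely to those of exp(-V_infty).  Moments determine
    distribution functions on [0, 1], and F_infty is uniformly continuous because
    a single Gaussian square with a positive weight has a Hoelder-1/2 distribution
    function; pointwise convergence is then uniform.  If all lambda_j vanish, both
    laws are the point mass at 0. *)

Require Import Defs.
From HB Require Import structures.
From mathcomp Require Import all_boot all_order all_algebra finmap.
From mathcomp Require Import all_classical all_reals all_analysis.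
From mathcomp Require Import measurable_realfun.
From mathcomp Require Import ring lra.

Set Implicit Arguments.
Unset Strict Implicit.
Unset Printing Implicit Defensive.

Import Order.TTheory GRing.Theory Num.Theory.
Import numFieldNormedType.Exports.

Local Open Scope classical_set_scope.
Local Open Scope ring_scope.


(** * Resampling and the heat kernel *)

(** Given the sample, the bootstrap expectation of a function of the resampled sum is a finite
    average over all maps from ['I_n] to ['I_n], hence the n-th iterate of an averaging operator.
    This is why the limit theorem is proved by operator iteration: averaging contracts the sup norm,
    so n one-step errors of size o(1/n) simply add up. Gaussian test functions stay Gaussian under
    the heat flow, so its solution is explicit and decays fast enough to absorb every power of the
    unbounded variable s. The exponential exp(-W) serves twice: its k-th moment is the Laplace
    transform at k, and it keeps the possibly infinite sum V within [0, 1]. Two obstacles shape the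
    rest. The dimensions may grow at any rate; the comparison goes through a fixed dimension D,
    because residuals decrease with the dimension. And the eigenvalues are given only through
    dimensions of eigenspaces, so eigenvectors must be constructed and shown to exhaust the trace.
    The null set of samples is fixed by countably many strong laws; outside it the sample is treated
    as a deterministic sequence. *)

Section exp_bounds.
Context {R : realType}.
Implicit Types x a c w : R.

Lemma expR_sub1_le x : expR x - 1 <= x * expR x.
Proof.
have h := expR_ge1Dx (- x); have e0 := expR_gt0 x.
have : expR x * (1 - x) <= expR x * expR (- x) by rewrite ler_pM2l.
by rewrite -expRD subrr expR0; lra.
Qed.

Lemma expR_sub1D_ge0 x : 0 <= expR x - 1 - x.
Proof. by have := expR_ge1Dx x; lra. Qed.

Lemma expR_sub1D_le x : expR x - 1 - x <= x ^+ 2 * expR `|x|.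
Proof.
have h1 : expR x - 1 - x <= x * (expR x - 1) by have := expR_sub1_le x; lra.
apply: le_trans h1 _; have [x0|x0] := leP 0 x.
  by rewrite ger0_norm// expr2 -mulrA ler_wpM2l// expR_sub1_le.
rewrite ltr0_norm//.
have h2 : 1 - expR x <= - x by have := expR_ge1Dx x; lra.
have e1 : 1 <= expR (- x) by rewrite -expR0 ler_expR; lra.
apply: (@le_trans _ _ (x ^+ 2)); last by rewrite ler_peMr// sqr_ge0.
by rewrite expr2; nra.
Qed.

(** Mean value theorem: the derivative of this remainder is the first-order remainder, which is
    bounded uniformly between 0 and x. *)
Lemma expR_taylor2_le x :
  `|expR x - 1 - x - x ^+ 2 / 2| <= `|x| ^+ 3 * expR `|x|.
Proof.
pose g (y : R) := expR y - 1 - y - y ^+ 2 / 2.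
have dg (y : R) : is_derive y 1 g (expR y - 1 - y).
  rewrite /g; apply: is_derive_eq.
  by rewrite /GRing.scale/=; lra.
have bd c : `|c| <= `|x| -> `|expR c - 1 - c| <= x ^+ 2 * expR `|x|.
  move=> cx; rewrite ger0_norm ?expR_sub1D_ge0//.
  apply: le_trans (expR_sub1D_le c) _; apply: ler_pM.
  - exact: sqr_ge0.
  - exact: expR_ge0.
  - by rewrite -[c ^+ 2]real_normK ?num_real// -[x ^+ 2]real_normK ?num_real//
      lerXn2r ?nnegrE.
  - by rewrite ler_expR.
have cg (A : set R) : {within A, continuous g}.
  by apply: continuous_subspaceT => y; apply/differentiable_continuous/derivable1_diffP.
have g0 : g 0 = 0 by rewrite /g expR0; ring.
rewrite -/(g x).
have [x0|x0|x0] := ltgtP 0 x.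
- have [c cx] := @MVT _ g (fun y => expR y - 1 - y) 0 x x0 (fun y _ => dg y)
    (cg _).
  rewrite g0 !subr0 => ->; rewrite normrM.
  move: cx; rewrite in_itv/= => /andP[c0 cx].
  have : `|c| <= `|x| by rewrite !gtr0_norm ?ltW//.
  move=> /bd H; rewrite exprS mulrAC mulrC -mulrA ler_wpM2l//.
  by rewrite real_normK ?num_real// mulrC in H *.
- have [c cx] := @MVT _ g (fun y => expR y - 1 - y) x 0 x0 (fun y _ => dg y)
    (cg _).
  rewrite g0 !sub0r => /(congr1 (fun z => `|z|)); rewrite normrN => ->; rewrite normrM normrN.
  move: cx; rewrite in_itv/= => /andP[c0 cx].
  have : `|c| <= `|x| by rewrite !ltr0_norm// lerN2 ltW.
  move=> /bd H; rewrite exprS mulrAC mulrC -mulrA ler_wpM2l//.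
  by rewrite real_normK ?num_real// mulrC in H *.
- by rewrite -x0 g0 normr0 mulr_ge0// ?expR_ge0// exprn_ge0.
Qed.

Lemma expR_ge_expr n x : 0 <= x -> (x / n.+1%:R) ^+ n.+1 <= expR x.
Proof.
move=> x0.
have -> : expR x = expR (x / n.+1%:R) ^+ n.+1.
  by rewrite -expRM_natl mulrC -mulr_natr divfK// pnatr_eq0.
rewrite lerXn2r ?nnegrE ?expR_ge0 ?divr_ge0//.
by apply: le_trans (expR_ge1Dx _); rewrite lerDr.
Qed.

(* [2u - (u-1)^2/4 <= 6] with [u = 2a + 1] and [u ^ 3 <= 27 exp u]. *)
Lemma cubic_expR_le a : 0 <= a ->
  (2 * a + 1) ^+ 3 * expR (2 * a + 1 - a ^+ 2) <= 27 * expR 6.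
Proof.
move=> a0; set u := 2 * a + 1.
have u3 : u ^+ 3 <= 27 * expR u.
  have := @expR_ge_expr 2 u; rewrite exprMn exprVn -natrX.
  move=> /(_ _); rewrite ler_pdivrMr// mulrC; apply.
  by rewrite /u; lra.
apply: (@le_trans _ _ (27 * expR u * expR (u - a ^+ 2))).
  by rewrite ler_wpM2r ?expR_ge0.
rewrite -mulrA -expRD ler_wpM2l// ler_expR /u.
by have := sqr_ge0 (a - 2); rewrite sqrrB; lra.
Qed.

(** Second-order expansion of exp(-|s + b|^2) with a = |s|, c = |b| and B = <s, b> for a weighted
    inner product. The point is that the cubic error is uniform in a: the factor exp(-a^2) absorbs
    the powers of a. *)
Lemma quad_expR_taylor a B c : 0 <= a -> 0 <= c <= 1 -> `|B| <= a * c ->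
  `|expR (- (a ^+ 2 + 2 * B + c ^+ 2))
    - expR (- a ^+ 2) * (1 - 2 * B - c ^+ 2 + 2 * B ^+ 2)|
  <= 54 * expR 6 * c ^+ 3.
Proof.
move=> a0 /andP[c0 c1] Bac.
set x : R := - (2 * B + c ^+ 2).
have xu : `|x| <= (2 * a + 1) * c.
  rewrite /x normrN (le_trans (ler_normD _ _))// normrM.
  rewrite (ger0_norm (sqr_ge0 c)) ger0_norm//.
  rewrite [leRHS]mulrDl mul1r lerD//; first by rewrite -mulrA ler_wpM2l.
  by rewrite expr2 ler_piMr.
have xu1 : `|x| <= 2 * a + 1.
  by apply: le_trans xu _; rewrite ler_piMr//; lra.
have -> : expR (- (a ^+ 2 + 2 * B + c ^+ 2)) = expR (- a ^+ 2) * expR x.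
  by rewrite -expRD; congr expR; rewrite /x; ring.
rewrite -mulrBr.
(* Of x^2 / 2 only 2 B^2 is kept; the other two terms are already of third order in c. *)
have -> : expR x - (1 - 2 * B - c ^+ 2 + 2 * B ^+ 2)
   = (expR x - 1 - x - x ^+ 2 / 2) + (2 * B * c ^+ 2 + c ^+ 4 / 2).
  by rewrite /x; field.
have E1 : expR (- a ^+ 2) * expR `|x| <= expR (2 * a + 1 - a ^+ 2).
  by rewrite -expRD ler_expR; lra.
have E0 := expR_ge0 (- a ^+ 2 : R).
have cub := cubic_expR_le a0.
rewrite normrM (ger0_norm E0).
apply: (@le_trans _ _ (expR (- a ^+ 2) * (`|x| ^+ 3 * expR `|x|
    + (2 * a + 1) * c ^+ 3))).
  rewrite ler_wpM2l// (le_trans (ler_normD _ _))// lerD ?expR_taylor2_le//.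
  rewrite (le_trans (ler_normD _ _))// [leRHS]mulrDl mul1r lerD//.
    rewrite normrM (ger0_norm (sqr_ge0 c)) normrM (@ger0_norm _ 2)//.
    have -> : 2 * a * c ^+ 3 = 2 * (a * c) * c ^+ 2 by ring.
    by rewrite ler_wpM2r ?sqr_ge0// ler_wpM2l.
  rewrite ger0_norm ?divr_ge0 ?exprn_ge0// exprS.
  have : 0 <= c ^+ 3 by rewrite exprn_ge0.
  by move: (c ^+ 3) => z z0; nra.
rewrite mulrDr.
(* One half of the constant pays for the Taylor remainder, the other for the dropped third-order
   terms; both are bounded by [cubic_expR_le]. *)
have -> : 54 * expR 6 * c ^+ 3 = 27 * expR 6 * c ^+ 3 + 27 * expR 6 * c ^+ 3.
  by ring.
have c30 : 0 <= c ^+ 3 by rewrite exprn_ge0.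
apply: lerD.
  rewrite mulrCA.
  apply: (@le_trans _ _ (((2 * a + 1) * c) ^+ 3 * expR (2 * a + 1 - a ^+ 2))).
    apply: ler_pM => //.
    by rewrite lerXn2r ?nnegrE ?mulr_ge0//; lra.
  by rewrite exprMn mulrAC ler_wpM2r.
rewrite mulrA ler_wpM2r//; apply: le_trans cub; rewrite mulrC.
apply: ler_pM; [by lra|exact: E0| |by rewrite ler_expR; lra].
by rewrite -[leLHS]expr1 ler_weXn2l//; lra.
Qed.

End exp_bounds.

(** * The averaging operator of one bootstrap draw *)

Section resample.
Context {R : realType} {V : zmodType}.

(** The expectation of h after one uniformly drawn increment b i is added to s. *)
Definition resample n (b : 'I_n -> V) (h : V -> R) (s : V) : R :=
  n%:R^-1 * \sum_i h (s + b i).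

Definition fcons n (T : Type) (x : T) (g : {ffun 'I_n -> T}) :
  {ffun 'I_n.+1 -> T} := [ffun k => oapp g x (unlift ord0 k)].

Lemma fcons0 n (T : Type) (x : T) (g : {ffun 'I_n -> T}) : fcons x g ord0 = x.
Proof. by rewrite ffunE unlift_none. Qed.

Lemma fconsS n (T : Type) (x : T) (g : {ffun 'I_n -> T}) k :
  fcons x g (lift ord0 k) = g k.
Proof. by rewrite ffunE liftK. Qed.

Lemma sum_ffun_ordS n (T : finType) (F : {ffun 'I_n.+1 -> T} -> R) :
  \sum_g F g = \sum_x \sum_(g : {ffun 'I_n -> T}) F (fcons x g).
Proof.
rewrite pair_big/=.
rewrite (reindex (fun p : T * {ffun 'I_n -> T} => fcons p.1 p.2))//=.
exists (fun g => (g ord0, [ffun k => g (lift ord0 k)])) => [[x g] _|g _] /=.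
  by rewrite fcons0; congr pair; apply/ffunP => k; rewrite ffunE fconsS.
apply/ffunP => k; rewrite ffunE; case: (unliftP ord0 k) => [j ->|->] //=.
by rewrite ffunE.
Qed.

(** Each iteration prepends one independent draw. For K = n the right-hand side is exactly the
    bootstrap expectation. *)
Lemma iter_resample n K (b : 'I_n -> V) h s :
  iter K (resample b) h s =
  n%:R^-1 ^+ K * \sum_(g : {ffun 'I_K -> 'I_n}) h (s + \sum_k b (g k)).
Proof.
elim: K s => [|K IH] s /=.
  rewrite expr0 mul1r (eq_bigr (fun=> h s)).
    by rewrite sumr_const card_ffun !card_ord expn0.
  by move=> g _; rewrite big_ord0 addr0.
rewrite /resample exprS -mulrA; congr *%R.
rewrite sum_ffun_ordS mulr_sumr; apply: eq_bigr => i _; rewrite IH; congr *%R.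
apply: eq_bigr => g _; rewrite big_ord_recl fcons0 addrA; congr (h (_ + _)).
by apply: eq_bigr => k _; rewrite fconsS.
Qed.

(** An average is a contraction for the sup norm, so approximation errors are never amplified by
    later steps. *)
Lemma resample_contract n (b : 'I_n -> V) (h h' : V -> R) e :
  0 <= e -> (forall s, `|h s - h' s| <= e) ->
  forall s, `|resample b h s - resample b h' s| <= e.
Proof.
move=> e0 hh' s; rewrite /resample -mulrBr -sumrB normrM normfV normr_nat.
case: n b => [|n] b; first by rewrite big_ord0 normr0 mulr0.
rewrite ler_pdivrMl ?ltr0n//; apply: le_trans (ler_norm_sum _ _ _) _.
apply: (@le_trans _ _ (\sum_(i < n.+1) e)); first exact: ler_sum.
by rewrite sumr_const card_ord mulr_natl.
Qed.

End resample.

Section cauchy_schwarz.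
Context {R : realType}.

Lemma sum_cauchy_schwarz (I : finType) (w x y : I -> R) :
  (forall i, 0 <= w i) ->
  (\sum_i w i * x i * y i) ^+ 2
  <= (\sum_i w i * x i ^+ 2) * (\sum_i w i * y i ^+ 2).
Proof.
move=> w0; set A := \sum_i _; set B := \sum_i w i * x i ^+ 2.
set C := \sum_i w i * y i ^+ 2.
have h u v : 0 <= u ^+ 2 * B + 2 * (u * v * A) + v ^+ 2 * C.
  have : 0 <= \sum_i w i * (u * x i + v * y i) ^+ 2.
    by apply: sumr_ge0 => i _; rewrite mulr_ge0// sqr_ge0.
  rewrite /A /B /C !mulr_sumr -!big_split/=.
  by congr (0 <= _); apply: eq_bigr => i _; ring.
have B0 : 0 <= B by apply: sumr_ge0 => i _; rewrite mulr_ge0// sqr_ge0.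
move: B0; rewrite le_eqVlt => /predU1P[B0|B0].
  have C0 : 0 <= C by apply: sumr_ge0 => i _; rewrite mulr_ge0// sqr_ge0.
  have [A0|A0] := eqVneq A 0; first by rewrite A0 expr0n/= -B0 mul0r.
  (* With B = 0 the form is linear in u; this u gives it the value -1, contradicting its
     nonnegativity. *)
  have := h (- (C + 1) / (2 * A)) 1.
  have -> : 2 * (- (C + 1) / (2 * A) * 1 * A) = - (C + 1) by field.
  by rewrite -B0; lra.
have := h (- A) B; rewrite -(pmulr_rge0 _ B0).
have -> : (- A) ^+ 2 * B + 2 * (- A * B * A) + B ^+ 2 * C = B * (B * C - A ^+ 2) by ring.
by rewrite !pmulr_rge0// subr_ge0.
Qed.

End cauchy_schwarz.

(** * Explicit Gaussian solutions of the heat equation *)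

Section heat_kernel.
Context {R : realType} (m : nat) (t : R) (lam : 'I_m -> R).
Hypothesis t0 : 0 < t.
Hypothesis lam0 : forall j, 0 <= lam j.
Implicit Types (tau h L : R) (s : 'I_m -> R).

(* [heat_kernel tau s] is E exp(-t |s + G|^2) for G Gaussian with independent
   centred coordinates of variances [tau * lam j]. *)
Definition heat_rate tau j : R := t / (1 + 2 * t * lam j * tau).

Definition heat_kernel tau s : R :=
  expR (- \sum_j (ln (1 + 2 * t * lam j * tau) / 2 + heat_rate tau j * s j ^+ 2)).

Local Notation al := heat_rate.

Let sum1m : m%:R = \sum_(j < m) 1 :> R.
Proof. by rewrite sumr_const card_ord. Qed.

Let den_ge1 tau j : 0 <= tau -> 1 <= 1 + 2 * t * lam j * tau.
Proof. by move=> h; rewrite lerDl !mulr_ge0// ltW. Qed.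

Let den_gt0 tau j : 0 <= tau -> 0 < 1 + 2 * t * lam j * tau.
Proof. by move=> /(den_ge1 j); lra. Qed.

Lemma heat_rate_ge0 tau j : 0 <= tau -> 0 <= al tau j.
Proof. by move=> h; rewrite divr_ge0// ltW// den_gt0. Qed.

Lemma heat_rate_le tau j : 0 <= tau -> al tau j <= t.
Proof.
move=> h; rewrite ler_pdivrMr ?den_gt0// ler_peMr// ?den_ge1//; exact: ltW.
Qed.

Let lnpart_ge0 tau : 0 <= tau -> 0 <= \sum_j ln (1 + 2 * t * lam j * tau) / 2.
Proof.
by move=> h; apply: sumr_ge0 => j _; rewrite divr_ge0// ln_ge0// den_ge1.
Qed.

(** The lower bound rests on (1 + e)(1 - e + e^2) = 1 + e^3 >= 1, so that 1 / (1 + e) <= 1 - (e -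
    e^2) <= exp(-(e - e^2)). *)
Lemma ln1D_bounds (e : R) : 0 <= e -> e - e ^+ 2 <= ln (1 + e) <= e.
Proof.
move=> e0; have p : 0 < 1 + e by lra.
apply/andP; split; last first.
  by rewrite -ler_expR lnK ?posrE// expR_ge1Dx.
have -> : ln (1 + e) = - ln (1 + e)^-1 by rewrite lnV ?posrE// opprK.
rewrite lerNr -ler_expR lnK ?posrE ?invr_gt0//.
apply: le_trans (expR_ge1Dx _); rewrite -div1r ler_pdivrMr//.
by have := exprn_ge0 3 e0; rewrite !exprS expr0; lra.
Qed.

Let poly_expR_le (M A : R) : 0 <= M -> 0 <= A ->
  (M + A) ^+ 2 * expR ((M - A) / 2) <= 16 * expR M.
Proof.
move=> M0 A0; have MA : 0 <= M + A by lra.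
have h : (M + A) ^+ 2 <= 16 * expR ((M + A) / 2).
  have := @expR_ge_expr R 1 ((M + A) / 2).
  have -> : ((M + A) / 2 / 2) ^+ 2 = (M + A) ^+ 2 / 16 by field.
  by rewrite ler_pdivrMr// (mulrC 16); apply; rewrite divr_ge0.
apply: (@le_trans _ _ (16 * expR ((M + A) / 2) * expR ((M - A) / 2))).
  by rewrite ler_wpM2r// expR_ge0.
by rewrite -mulrA -expRD ler_wpM2l// ler_expR; lra.
Qed.

(** The kernel solves dv/dtau = (1/2) sum_j lam_j d^2 v/ds_j^2, and the bracket is the first-order
    Euler step of this equation. The error is quadratic in h, uniformly in s. *)
Lemma heat_kernel_step tau h L s : 0 <= tau -> 0 <= h -> 0 <= L ->
  (forall j, lam j <= L) -> 2 * L * t * h <= 1 / 4 ->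
  `|heat_kernel (tau + h) s - heat_kernel tau s *
     (1 - h * (\sum_j al tau j * lam j
       - 2 * \sum_j al tau j ^+ 2 * lam j * s j ^+ 2))|
  <= 65 * expR m%:R * (2 * L * t * h) ^+ 2.
Proof.
move=> tau0 h0 L0 lamL; set E := 2 * L * t * h => E4.
pose r j := 1 + 2 * t * lam j * tau.
pose e j := 2 * al tau j * lam j * h.
pose A := \sum_j al tau j * s j ^+ 2.
have r0 j : 0 < r j by exact: den_gt0.
have al0 j : 0 <= al tau j by exact: heat_rate_ge0.
have e0 j : 0 <= e j by do 3!apply: mulr_ge0 => //.
have eE j : e j <= E.
  have -> : e j = 2 * (lam j * al tau j) * h by rewrite /e; ring.
  have -> : E = 2 * (L * t) * h by rewrite /E; ring.
  by rewrite ler_wpM2r// ler_wpM2l// ler_pM// heat_rate_le.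
have as0 j : 0 <= al tau j * s j ^+ 2 by rewrite mulr_ge0// sqr_ge0.
have A0 : 0 <= A by exact: sumr_ge0.
have rE j : 1 + 2 * t * lam j * (tau + h) = r j * (1 + e j).
  by rewrite /r /e /heat_rate; field; rewrite gt_eqF//; exact: r0.
have alE j : al (tau + h) j = al tau j / (1 + e j).
  by rewrite {1}/heat_rate rE /heat_rate -/(r j) invfM mulrA.
(* With e j the relative growth of the denominator, D collects the terms linear in e j of the change
   of the exponent and q j what remains, of second order. *)
pose q j := (ln (1 + e j) - e j) / 2
  + al tau j * s j ^+ 2 * (e j - e j / (1 + e j)).
pose D := \sum_j e j * (1 / 2 - al tau j * s j ^+ 2).
pose rho := \sum_j q j.
have e1 j : 0 < 1 + e j by have := e0 j; lra.
have -> : heat_kernel (tau + h) s = heat_kernel tau s * expR (- (D + rho)).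
  rewrite -expRD; congr expR; rewrite /D /rho -opprD -!big_split/=; congr (- _).
  apply: eq_bigr => j _; rewrite alE rE lnM ?posrE// /q -/(r j).
  by field; rewrite gt_eqF.
have -> : h * (\sum_j al tau j * lam j
       - 2 * \sum_j al tau j ^+ 2 * lam j * s j ^+ 2) = D.
  rewrite mulr_sumr -sumrB mulr_sumr; apply: eq_bigr => j _.
  by rewrite /e; field.
have E0 : 0 <= E by rewrite /E !mulr_ge0// ltW.
have mA0 : 0 <= m%:R + A by rewrite addr_ge0.
have Dle : `|D| <= E * (m%:R + A).
  apply: le_trans (ler_norm_sum _ _ _) _.
  rewrite mulrDr sum1m !mulr_sumr.
  rewrite -big_split/=; apply: ler_sum => j _.
  rewrite normrM ger0_norm// mulr1 -[X in _ <= X + _]mulr1 -mulrDr.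
  apply: ler_pM => //; apply: le_trans (ler_normB _ _) _.
  by rewrite (ger0_norm (as0 j)) lerD// ger0_norm//; lra.
have rhole : `|rho| <= E ^+ 2 * (m%:R + A).
  apply: le_trans (ler_norm_sum _ _ _) _.
  rewrite mulrDr sum1m !mulr_sumr.
  rewrite -big_split/=; apply: ler_sum => j _.
  have eE2 : e j ^+ 2 <= E ^+ 2 by rewrite lerXn2r ?nnegrE.
  rewrite /q (le_trans (ler_normD _ _))// lerD//.
    have /andP[l1 l2] := ln1D_bounds (e0 j).
    rewrite ler0_norm; first by have := sqr_ge0 (e j); lra.
    by lra.
  have -> : e j - e j / (1 + e j) = e j ^+ 2 / (1 + e j).
    by field; rewrite gt_eqF.
  rewrite ger0_norm; last by rewrite mulr_ge0// divr_ge0 ?sqr_ge0// ltW.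
  rewrite mulrC ler_wpM2r//; apply: le_trans eE2.
  by rewrite ler_pdivrMr// ler_peMr ?sqr_ge0//; have := e0 j; lra.
set x := - (D + rho).
have xle : `|x| <= 2 * E * (m%:R + A).
  rewrite normrN (le_trans (ler_normD _ _))//.
  apply: le_trans (lerD Dle rhole) _; rewrite -mulrDl ler_wpM2r//.
  by rewrite expr2; nra.
have kle : heat_kernel tau s <= expR (- A).
  rewrite ler_expR lerN2 big_split/= lerDr; exact: lnpart_ge0.
rewrite -mulrBr normrM (ger0_norm (expR_ge0 _)).
apply: (@le_trans _ _ (expR (- A) * `|expR x - (1 - D)|)).
  by rewrite ler_wpM2r.
have -> : expR x - (1 - D) = (expR x - 1 - x) - rho by rewrite /x; ring.
(* The hypothesis E <= 1/4 gives [|x| <= (m + A) / 2], so half of the decay exp(-A) is left to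
   absorb the polynomial factor. *)
have xb : `|expR x - 1 - x| <= 4 * E ^+ 2 * ((m%:R + A) ^+ 2 * expR ((m%:R + A) / 2)).
  rewrite ger0_norm ?expR_sub1D_ge0//; apply: le_trans (expR_sub1D_le _) _.
  have -> : 4 * E ^+ 2 * ((m%:R + A) ^+ 2 * expR ((m%:R + A) / 2))
    = (2 * E * (m%:R + A)) ^+ 2 * expR ((m%:R + A) / 2) by ring.
  apply: ler_pM; [exact: sqr_ge0|exact: expR_ge0| |].
    rewrite -[leLHS]real_normK ?num_real// lerXn2r ?nnegrE//.
    by do 2!apply: mulr_ge0 => //.
  by rewrite ler_expR; apply: le_trans xle _; nra.
apply: (@le_trans _ _ (expR (- A) * (4 * E ^+ 2 * ((m%:R + A) ^+ 2
    * expR ((m%:R + A) / 2)) + E ^+ 2 * (m%:R + A)))).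
  rewrite ler_wpM2l ?expR_ge0// (le_trans (ler_normB _ _))// lerD//.
have p1 : expR (- A) * ((m%:R + A) ^+ 2 * expR ((m%:R + A) / 2)) <= 16 * expR m%:R.
  rewrite mulrCA -expRD; have -> : - A + (m%:R + A) / 2 = (m%:R - A) / 2 by lra.
  exact: poly_expR_le.
have p2 : expR (- A) * (m%:R + A) <= expR m%:R.
  apply: (@le_trans _ _ (expR (- A) * expR (m%:R + A))).
    by rewrite ler_wpM2l ?expR_ge0//; have := expR_ge1Dx (m%:R + A); lra.
  by rewrite -expRD ler_expR; lra.
have E20 := sqr_ge0 E.
(* The constant is 65 = 4 * 16 + 1. *)
apply: (@le_trans _ _ (4 * E ^+ 2 * (16 * expR m%:R) + E ^+ 2 * expR m%:R)); last lra.
rewrite mulrDr mulrCA [X in _ + X <= _]mulrCA; apply: lerD.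
  by rewrite ler_wpM2l// mulr_ge0.
by rewrite ler_wpM2l.
Qed.

(* One resampling step is one step of the heat flow, up to the third-order
   Taylor remainder. *)
Lemma resample_heat_kernel n (b : 'I_n -> 'I_m -> R) tau s (dlt eta L : R) :
  0 <= tau -> 0 <= dlt -> 0 <= eta -> 0 <= L -> (forall j, lam j <= L) ->
  (0 < n)%N ->
  (forall j, \sum_i b i j = 0) ->
  (forall j l, `|\sum_i b i j * b i l - lam j *+ (j == l)| <= eta) ->
  (forall i, t * \sum_j b i j ^+ 2 <= dlt ^+ 2) -> dlt <= 1 ->
  `|resample b (heat_kernel tau) s - heat_kernel tau s *
     (1 - n%:R^-1 * (\sum_j al tau j * lam j
       - 2 * \sum_j al tau j ^+ 2 * lam j * s j ^+ 2))|
  <= n%:R^-1 * (54 * expR 6 * dlt * (t * m%:R * (L + eta)) + 3 * t * m%:R * eta).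
Proof.
move=> tau0 dlt0 eta0 L0 lamL n0 b0 bM bd dlt1.
have al0 j : 0 <= al tau j by exact: heat_rate_ge0.
have alt j : al tau j <= t by exact: heat_rate_le.
pose A := \sum_j al tau j * s j ^+ 2.
have A0 : 0 <= A by apply: sumr_ge0 => j _; rewrite mulr_ge0// sqr_ge0.
pose a := Num.sqrt A.
have a2 : a ^+ 2 = A by rewrite sqr_sqrtr.
pose C i := \sum_j al tau j * b i j ^+ 2.
have C0 i : 0 <= C i by apply: sumr_ge0 => j _; rewrite mulr_ge0// sqr_ge0.
pose c i := Num.sqrt (C i).
have c2 i : c i ^+ 2 = C i by rewrite sqr_sqrtr.
pose B i := \sum_j al tau j * s j * b i j.
have Bac i : `|B i| <= a * c i.
  rewrite -(@ler_pXn2r _ 2) ?nnegrE ?mulr_ge0 ?sqrtr_ge0//.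
  rewrite real_normK ?num_real// exprMn a2 c2; exact: sum_cauchy_schwarz.
have cd i : c i <= dlt.
  rewrite -(@ler_pXn2r _ 2) ?nnegrE ?sqrtr_ge0// c2; apply: le_trans (bd i).
  by rewrite mulr_sumr ler_sum// => j _; rewrite ler_wpM2r// sqr_ge0.
pose w := expR (- \sum_j ln (1 + 2 * t * lam j * tau) / 2).
have w0 : 0 <= w by exact: expR_ge0.
have w1 : w <= 1 by rewrite -expR0 ler_expR oppr_le0 lnpart_ge0.
have vE s' : heat_kernel tau s' = w * expR (- \sum_j al tau j * s' j ^+ 2).
  by rewrite -expRD; congr expR; rewrite -opprD -big_split.
have vsE : heat_kernel tau s = w * expR (- a ^+ 2) by rewrite vE a2.
have vbE i : heat_kernel tau (s + b i)
    = w * expR (- (a ^+ 2 + 2 * B i + c i ^+ 2)).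
  rewrite vE a2 c2; congr (_ * expR (- _)).
  rewrite /A /B /C mulr_sumr -!big_split/=; apply: eq_bigr => j _.
  have -> : (s + b i) j = s j + b i j by [].
  by ring.
pose M j l := \sum_i b i j * b i l.
have n0' : n%:R != 0 :> R by rewrite pnatr_eq0 -lt0n.
(* Summing the second-order expansion: the linear term vanishes because the increments are centred,
   and the quadratic terms only involve the empirical covariances M j l. *)
have sumq : \sum_i (1 - 2 * B i - c i ^+ 2 + 2 * B i ^+ 2) =
    n%:R - \sum_j al tau j * M j j
    + 2 * \sum_j \sum_l al tau j * al tau l * s j * s l * M j l.
  rewrite !big_split/= sumr_const card_ord !sumrN -!mulr_sumr.
  have -> : \sum_i B i = 0.
    rewrite /B exchange_big/= big1// => j _.
    by rewrite -mulr_sumr b0 mulr0.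
  rewrite mulr0 subr0; congr (_ - _ + 2 * _).
    rewrite (eq_bigr C) => [|i _]; last exact: c2.
    rewrite /C exchange_big/=; apply: eq_bigr => j _.
    by rewrite -mulr_sumr; congr (_ * _); apply: eq_bigr => i _; rewrite expr2.
  rewrite (eq_bigr (fun i => \sum_j \sum_l
      (al tau j * s j * b i j) * (al tau l * s l * b i l))) => [|i _]; last first.
    by rewrite expr2 big_distrlr.
  rewrite exchange_big/=; apply: eq_bigr => j _.
  rewrite exchange_big/=; apply: eq_bigr => l _.
  by rewrite mulr_sumr; apply: eq_bigr => i _; ring.
pose D := \sum_j al tau j * lam j
       - 2 * \sum_j al tau j ^+ 2 * lam j * s j ^+ 2.
rewrite -/D.
have DE : D = \sum_j al tau j * lam j
    - 2 * \sum_j \sum_l al tau j * al tau l * s j * s l * (lam j *+ (j == l)).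
  congr (_ - 2 * _); apply: eq_bigr => j _.
  rewrite (bigD1 j)//= eqxx big1 ?addr0; first by rewrite mulr1n; ring.
  by move=> l; rewrite eq_sym => /negbTE ->; rewrite mulr0n mulr0.
have alS : \sum_j al tau j <= t * m%:R.
  by rewrite sum1m mulr_sumr ler_sum// => j _; rewrite mulr1.
(* Replacing the empirical covariance by the diagonal one costs eta per entry. *)
have step2 : `|\sum_i (1 - 2 * B i - c i ^+ 2 + 2 * B i ^+ 2) - (n%:R - D)|
    <= t * m%:R * eta + 2 * (t * m%:R * A * eta).
  rewrite sumq DE.
  have -> : forall (x y z x' z' : R), x - y + 2 * z - (x - (x' - 2 * z'))
    = - (y - x') + 2 * (z - z') by move=> *; ring.
  rewrite (le_trans (ler_normD _ _))// normrN normrM (@ger0_norm _ 2)//.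
  rewrite -!sumrB lerD//.
    apply: (@le_trans _ _ ((\sum_j al tau j) * eta)); last by rewrite ler_wpM2r.
    apply: le_trans (ler_norm_sum _ _ _) _; rewrite mulr_suml ler_sum// => j _.
    rewrite -mulrBr normrM ger0_norm// ler_wpM2l//.
    by have := bM j j; rewrite eqxx mulr1n.
  rewrite ler_wpM2l//.
  apply: (@le_trans _ _ ((\sum_j al tau j * `|s j|) ^+ 2 * eta)).
    rewrite expr2 big_distrlr/= mulr_suml.
    apply: le_trans (ler_norm_sum _ _ _) _; apply: ler_sum => j _.
    rewrite -sumrB mulr_suml.
    apply: le_trans (ler_norm_sum _ _ _) _; apply: ler_sum => l _.
    rewrite -mulrBr normrM; apply: ler_pM => //.
    by rewrite 3!normrM (ger0_norm (al0 j)) (ger0_norm (al0 l)) le_eqVlt; apply/orP; left; apply/eqP; ring.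
    exact: bM.
  rewrite ler_wpM2r//.
  have := sum_cauchy_schwarz (fun=> 1) (fun j => `|s j|) al0.
  under eq_bigr do rewrite mulr1.
  move/le_trans; apply.
  under [X in X * _]eq_bigr do rewrite expr1n mulr1.
  under [X in _ * X]eq_bigr do rewrite real_normK ?num_real//.
  by rewrite ler_wpM2r.
(* The cubic remainders are summable: c^3 <= dlt * c^2, and the sum of the c^2 is controlled by the
   diagonal covariances. *)
have step1 : `|\sum_i heat_kernel tau (s + b i)
    - w * expR (- a ^+ 2) * \sum_i (1 - 2 * B i - c i ^+ 2 + 2 * B i ^+ 2)|
    <= 54 * expR 6 * dlt * (t * m%:R * (L + eta)).
  apply: (@le_trans _ _ (\sum_i 54 * expR 6 * c i ^+ 3)).
    rewrite mulr_sumr -sumrB; apply: le_trans (ler_norm_sum _ _ _) _.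
    apply: ler_sum => i _; rewrite vbE -mulrA -mulrBr normrM ger0_norm//.
    apply: le_trans (ler_piMl _ w1) _ => //.
    apply: quad_expR_taylor => //; first exact: sqrtr_ge0.
    by rewrite sqrtr_ge0 (le_trans (cd i) dlt1).
  rewrite -mulr_sumr -[leRHS]mulrA.
  apply: ler_wpM2l; first by rewrite mulr_ge0 ?expR_ge0.
  apply: (@le_trans _ _ (dlt * \sum_i C i)).
    rewrite mulr_sumr ler_sum// => i _.
    by rewrite exprS c2 ler_wpM2r.
  rewrite ler_wpM2l// /C exchange_big/=.
  apply: (@le_trans _ _ (\sum_(j < m) t * (L + eta))); last first.
    by rewrite sum1m mulr_sumr mulr_suml ler_sum// => j _; rewrite mulr1.
  apply: ler_sum => j _; rewrite -mulr_sumr.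
  apply: ler_pM => //; first by apply: sumr_ge0 => i _; rewrite sqr_ge0.
  have := bM j j; rewrite eqxx mulr1n ler_norml => /andP[_].
  under eq_bigr do rewrite -expr2.
  by have := lamL j; lra.
rewrite vsE /resample.
have -> : n%:R^-1 * \sum_i heat_kernel tau (s + b i)
    - w * expR (- a ^+ 2) * (1 - n%:R^-1 * D)
  = n%:R^-1 * ((\sum_i heat_kernel tau (s + b i)
    - w * expR (- a ^+ 2) * \sum_i (1 - 2 * B i - c i ^+ 2 + 2 * B i ^+ 2))
    + w * expR (- a ^+ 2) * (\sum_i (1 - 2 * B i - c i ^+ 2 + 2 * B i ^+ 2)
      - (n%:R - D))).
  by field.
rewrite normrM ger0_norm ?invr_ge0// ler_wpM2l ?invr_ge0//.
rewrite (le_trans (ler_normD _ _))// lerD//.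
rewrite normrM ger0_norm ?mulr_ge0 ?expR_ge0//.
apply: (@le_trans _ _ (expR (- A) * (t * m%:R * eta + 2 * (t * m%:R * A * eta)))).
  rewrite a2 ler_pM ?mulr_ge0 ?expR_ge0//.
  by rewrite ler_piMl ?expR_ge0.
(* The factor 3 of the statement comes from exp(-A) (1 + 2 A) <= 1 + 2. *)
have eA : expR (- A) <= 1 by rewrite -expR0 ler_expR oppr_le0.
have eAA : expR (- A) * A <= 1.
  apply: (@le_trans _ _ (expR (- A) * expR A)).
    by rewrite ler_wpM2l ?expR_ge0//; have := expR_ge1Dx A; lra.
  by rewrite -expRD addNr expR0.
have tme : 0 <= t * m%:R * eta by rewrite !mulr_ge0// ltW.
by nra.
Qed.

End heat_kernel.

(** * A Lindeberg-type limit theorem for resampled sums *)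

Section resample_clt.
Context {R : realType} (m : nat) (t : R) (lam : 'I_m -> R).
Hypothesis t0 : 0 < t.
Hypothesis lam0 : forall j, 0 <= lam j.

(** Telescoping over the steps: by contraction the K one-step errors add up. *)
Lemma iter_resample_heat_kernel n (b : 'I_n -> 'I_m -> R) (e : R) :
  0 <= e -> (0 < n)%N ->
  (forall tau s, 0 <= tau -> `|resample b (heat_kernel t lam tau) s
     - heat_kernel t lam (tau + n%:R^-1) s| <= e) ->
  forall K s, `|iter K (resample b) (heat_kernel t lam 0) s
     - heat_kernel t lam (K%:R / n%:R) s| <= K%:R * e.
Proof.
move=> e0 n0 step; elim=> [|K IH] s; first by rewrite !mul0r subrr normr0.
rewrite [iter _ _ _]/=.
have -> : K.+1%:R / n%:R = K%:R / n%:R + n%:R^-1 :> R by rewrite -natr1 mulrDl mul1r.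
rewrite -natr1 mulrDl mul1r.
apply: le_trans (ler_distD (resample b (heat_kernel t lam (K%:R / n%:R)) s) _ _) _.
apply: lerD.
  exact: (resample_contract b (mulr_ge0 (ler0n _ K) e0) IH).
by apply: step; rewrite divr_ge0.
Qed.

(** The hypotheses are those of a triangular array: centred rows, covariances tending to a diagonal
    matrix, and uniformly negligible increments. From time 0, where the kernel is exp(-t |s|^2), n
    steps of length 1/n lead to time 1, evaluated at s = 0. *)
Lemma resample_laplace_cvg (b : forall n, 'I_n -> 'I_m -> R) :
  (forall n j, \sum_i b n i j = 0) ->
  (forall j l, (\sum_i b n i j * b n i l) @[n --> \oo]
     --> lam j *+ (j == l)) ->
  (forall e : R, 0 < e -> \forall n \near \oo, forall i, \sum_j b n i j ^+ 2 <= e) ->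
  (n%:R^-1 ^+ n * \sum_(g : {ffun 'I_n -> 'I_n})
     expR (- (t * \sum_j (\sum_k b n (g k) j) ^+ 2))) @[n --> \oo]
  --> expR (- \sum_j ln (1 + 2 * t * lam j) / 2).
Proof.
move=> b0 bM bmax; apply/cvgrPdist_le => eps eps0.
pose L := \sum_j lam j.
have L0 : 0 <= L by exact: sumr_ge0.
have lamL j : lam j <= L by rewrite /L (bigD1 j)//= lerDl sumr_ge0.
pose K1 := 54 * expR 6 * (t * m%:R * (L + 1)).
have tm0 : 0 <= t * m%:R by rewrite mulr_ge0// ltW.
have K10 : 0 <= K1.
  have p : 0 <= 54 * expR 6 :> R by rewrite mulr_ge0 ?expR_ge0.
  by apply: mulr_ge0 => //; apply: mulr_ge0 => //; lra.
(* The cubic remainder, the covariance defect and the Euler error each get eps / 3; the added 1 in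
   the denominators guards against division by zero. *)
pose dlt := Num.min 1 (eps / 3 / (K1 + 1)).
have dlt0 : 0 < dlt by rewrite lt_min ltr01/= divr_gt0 ?divr_gt0//; lra.
pose eta := Num.min 1 (eps / 3 / (3 * t * m%:R + 1)).
have eta0 : 0 < eta.
  by rewrite lt_min ltr01/= divr_gt0 ?divr_gt0// -mulrA; lra.
pose K2 := 65 * expR m%:R * (2 * L * t) ^+ 2.
have K20 : 0 <= K2 by rewrite /K2 mulr_ge0 ?sqr_ge0// mulr_ge0 ?expR_ge0.
have invn (c : R) : 0 < c -> \forall n \near \oo, n%:R^-1 <= c.
  move=> c0; near=> n; rewrite -[c]invrK lef_pV2 ?posrE ?invr_gt0//; last first.
    by rewrite ltr0n; near: n; exact: nbhs_infty_gt.
  by near: n; exact: nbhs_infty_ger.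
have Lt0 : 0 <= 2 * L * t by rewrite !mulr_ge0// ltW.
have c0 : 0 < 1 / (4 * (2 * L * t + 1)) :> R.
  by rewrite divr_gt0// mulr_gt0// ltr_wpDl.
near=> n.
have n0 : (0 < n)%N by near: n; exact: nbhs_infty_gt.
have n0' : 0 < n%:R^-1 :> R by rewrite invr_gt0 ltr0n.
have h0 s : heat_kernel t lam 0 s = expR (- (t * \sum_j s j ^+ 2)).
  rewrite /heat_kernel mulr_sumr; congr (expR (- _)); apply: eq_bigr => j _.
  by rewrite /heat_rate mulr0 addr0 ln1 mul0r add0r divr1.
have h1 : heat_kernel t lam 1 0 = expR (- \sum_j ln (1 + 2 * t * lam j) / 2).
  congr (expR (- _)); apply: eq_bigr => j _.
  by rewrite mulr1 [(0 : 'I_m -> R) j]/(0 : R) expr0n/= mulr0 addr0.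
have -> : n%:R^-1 ^+ n * \sum_(g : {ffun 'I_n -> 'I_n})
     expR (- (t * \sum_j (\sum_k b n (g k) j) ^+ 2))
   = iter n (resample (b n)) (heat_kernel t lam 0) 0.
  rewrite iter_resample; congr (_ * _); apply: eq_bigr => g _.
  rewrite h0 add0r; congr (expR (- (_ * _))); apply: eq_bigr => j _.
  by rewrite fct_sumE.
rewrite -h1 distrC.
have -> : (1 : R) = n%:R / n%:R by rewrite divff// pnatr_eq0 -lt0n.
have -> : eps = n%:R * (n%:R^-1 * eps).
  by rewrite mulrA divff ?mul1r// pnatr_eq0 -lt0n.
apply: iter_resample_heat_kernel => //; first by rewrite mulr_ge0// ltW.
move=> tau s tau0.
have bMn : forall j l, `|\sum_i b n i j * b n i l - lam j *+ (j == l)| <= eta.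
  move=> j l; move: (j) (l); near: n.
  apply: filter_forall => j'; apply: filter_forall => l'.
  have /cvgrPdist_le/(_ eta eta0) := bM j' l'.
  by apply: filterS => n; rewrite distrC.
have bdn i : t * \sum_j b n i j ^+ 2 <= dlt ^+ 2.
  rewrite mulrC -ler_pdivlMr//; move: i; near: n; apply: bmax.
  by rewrite divr_gt0 ?exprn_gt0.
have dlt1 : dlt <= 1 by rewrite ge_min lexx.
have eta1 : eta <= 1 by rewrite ge_min lexx.
have small : 2 * L * t * n%:R^-1 <= 1 / 4.
  apply: (@le_trans _ _ ((2 * L * t + 1) * (1 / (4 * (2 * L * t + 1))))).
    apply: ler_pM => //; first by rewrite lerDl.
    by near: n; exact: invn.
  by rewrite le_eqVlt; apply/orP; left; apply/eqP; field; lra.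
have st1 := resample_heat_kernel t0 lam0 s tau0 (ltW dlt0) (ltW eta0) L0 lamL n0
  (b0 n) bMn bdn dlt1.
have st2 := heat_kernel_step t0 lam0 s tau0 (ltW n0') L0 lamL small.
rewrite distrC in st2.
apply: le_trans (ler_distD _ _ _) _; apply: le_trans (lerD st1 st2) _.
have -> : 65 * expR m%:R * (2 * L * t / n%:R) ^+ 2 = n%:R^-1 * (K2 * n%:R^-1).
  by rewrite /K2; ring.
rewrite -mulrDr; apply: ler_wpM2l; first exact: ltW.
have e1 : 54 * expR 6 * dlt * (t * m%:R * (L + eta)) <= eps / 3.
  apply: (@le_trans _ _ (K1 * dlt)).
    have -> : K1 * dlt = 54 * expR 6 * dlt * (t * m%:R * (L + 1)) by rewrite /K1; ring.
    apply: ler_wpM2l; last by rewrite ler_wpM2l// lerD2l.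
    by apply: mulr_ge0; [rewrite mulr_ge0 ?expR_ge0|exact: ltW].
  apply: (@le_trans _ _ ((K1 + 1) * (eps / 3 / (K1 + 1)))).
    apply: ler_pM => //; [exact: ltW|by rewrite lerDl|].
    by rewrite ge_min lexx orbT.
  by rewrite mulrC divfK//; lra.
have e2 : 3 * t * m%:R * eta <= eps / 3.
  apply: (@le_trans _ _ ((3 * t * m%:R + 1) * (eps / 3 / (3 * t * m%:R + 1)))).
    apply: ler_pM => //; [by rewrite -mulrA mulr_ge0|exact: ltW|by rewrite lerDl|].
    by rewrite ge_min lexx orbT.
  by rewrite mulrC divfK// gt_eqF// -mulrA; lra.
have e3 : K2 * n%:R^-1 <= eps / 3.
  apply: (@le_trans _ _ ((K2 + 1) * (eps / 3 / (K2 + 1)))).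
    apply: ler_pM => //; first by rewrite lerDl.
    by near: n; apply: invn; rewrite divr_gt0 ?divr_gt0//; lra.
  by rewrite mulrC divfK//; lra.
by lra.
Unshelve. all: by end_near. Qed.

End resample_clt.

(** * Joint laws and the strong law of large numbers *)

Section joint_law.
Local Open Scope ereal_scope.
Context d d1 d2 (T : measurableType d) (T1 : measurableType d1)
  (T2 : measurableType d2) (R : realType).
Variables (mu : {finite_measure set T -> \bar R})
  (nu : {finite_measure set T2 -> \bar R}).
Variables (X : {mfun T >-> T1}) (Y : {mfun T >-> T2}).

Definition image_law := pushforward mu X.

Let image_law0 : image_law set0 = 0.
Proof. exact: measure0. Qed.

Let image_law_ge0 A : 0 <= image_law A.
Proof. exact: measure_ge0. Qed.

Let image_law_sigma_additive : semi_sigma_additive image_law.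
Proof. exact: measure_semi_sigma_additive. Qed.

HB.instance Definition _ := isMeasure.Build _ _ _ image_law
  image_law0 image_law_ge0 image_law_sigma_additive.

Let image_law_fin : fin_num_fun image_law.
Proof.
move=> A mA; rewrite /image_law /pushforward fin_num_measure//.
by rewrite -[X in measurable X]setTI; exact: measurable_funP.
Qed.

HB.instance Definition _ := Measure_isFinite.Build _ _ _ image_law image_law_fin.

Let XY (w : T) : T1 * T2 := (X w, Y w).
Let mXY : measurable_fun setT XY.
Proof. by apply/measurable_fun_pairP; split; exact: measurable_funP. Qed.

(** The factorization on rectangles identifies the joint law with a product measure, and Tonelli
    applies. The measure mu is only finite so that it can be a probability restricted to an
    event. *)
Lemma ge0_integral_joint_law (F : T1 * T2 -> \bar R) :
  (forall A B, measurable A -> measurable B ->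
     mu (X @^-1` A `&` Y @^-1` B) = mu (X @^-1` A) * nu B) ->
  measurable_fun [set: T1 * T2] F -> (forall z, 0 <= F z) ->
  \int[mu]_w F (X w, Y w) = \int[mu]_w \int[nu]_y F (X w, y).
Proof.
move=> XYind mF F0.
transitivity (\int[pushforward mu XY]_z F z).
  by rewrite ge0_integral_pushforward.
transitivity (\int[image_law \x nu]_z F z).
  apply: eq_measure_integral => A mA _.
  apply/esym; apply: product_measure_unique => // B C mB mC.
rewrite fubini_tonelli1// /fubini_F /image_law ge0_integral_pushforward//.
  exact: measurable_fun_fubini_tonelli_F.
by move=> y _; exact: integral_ge0.
Qed.

End joint_law.

Section integration_facts.
Context d (T : measurableType d) (R : realType) (P : probability T R).
Implicit Types (f g : T -> R).

Lemma bounded_integrable f (M : R) : measurable_fun setT f ->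
  (forall w, `|f w| <= M) -> P.-integrable setT (EFin \o f).
Proof.
move=> mf fM; apply: (@le_integrable _ _ _ P setT measurableT _ (cst M%:E)).
- exact/measurable_EFinP.
- by move=> w _; rewrite lee_fin; apply: le_trans (fM w) (ler_norm _).
- by apply: finite_measure_integrable_cst.
Qed.

Lemma Rintegral_sum (I : Type) (s : seq I) (f : I -> T -> R) :
  (forall i, P.-integrable setT (EFin \o f i)) ->
  \int[P]_w (\sum_(i <- s) f i w) = \sum_(i <- s) \int[P]_w f i w.
Proof.
move=> fi; elim: s => [|i s IH].
  under eq_Rintegral do rewrite big_nil.
  by rewrite big_nil Rintegral_cst// mul0r.
under eq_Rintegral do rewrite big_cons.
rewrite big_cons -IH RintegralD//.
have := @integrable_sum _ _ _ P setT measurableT _ s xpredT (fun i => EFin \o f i).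
move=> /(_ (fun i _ => fi i)); congr (_.-integrable _ _).
by apply/funext => w /=; rewrite sumEFin.
Qed.

Lemma Rintegral_setT_cst (c : R) : \int[P]_w c = c.
Proof. by have := @expectation_cst _ _ _ P c; rewrite unlock /Rintegral => ->. Qed.

Lemma EFin_Rintegral f : P.-integrable setT (EFin \o f) ->
  (\int[P]_w f w)%:E = (\int[P]_w (f w)%:E)%E.
Proof. by move=> fi; rewrite fineK//; exact: integrable_fin_num. Qed.

Lemma markov_sqr f (a : R) : measurable_fun setT f -> 0 <= a ->
  ((a ^+ 2)%:E * P [set w | (a <= `|f w|)%R] <= \int[P]_w (f w ^+ 2)%:E)%E.
Proof.
move=> mf a0.
have mA : measurable [set w | a <= `|f w|].
  rewrite -[X in measurable X]setTI.
  by apply: measurable_fun_le => //; exact: measurableT_comp.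
rewrite -integral_cst//.
apply: (@le_trans _ _ (\int[P]_(w in [set w | (a <= `|f w|)%R]) (f w ^+ 2)%:E)%E).
  apply: ge0_le_integral => //.
  - by move=> w _; rewrite lee_fin sqr_ge0.
  - apply: measurable_funTS; apply/measurable_EFinP; exact: measurable_funX.
  - by move=> w /= aw; rewrite lee_fin -[leRHS]real_normK ?num_real// lerXn2r ?nnegrE.
apply: ge0_subset_integral => //.
- apply/measurable_EFinP; exact: measurable_funX.
- by move=> w _; rewrite lee_fin sqr_ge0.
Qed.

End integration_facts.

(** * Etemadi's strong law of large numbers *)

Section truncation.
Context {R : realType}.
Implicit Types c x : R.

(** The absolute value makes the truncation nonnegative on the whole line, as Tonelli's theorem
    requires; for x >= 0 it is x on [0, c] and 0 beyond. *)
Definition trunc_at c x : R := `|x| * \1_(`[- c, c]) x.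

Lemma trunc_at_ge0 c x : 0 <= trunc_at c x.
Proof. by rewrite mulr_ge0. Qed.

Lemma trunc_at_le_norm c x : trunc_at c x <= `|x|.
Proof. by rewrite ler_piMr// indicE; case: (_ \in _). Qed.

Lemma trunc_atE c x : 0 <= x -> trunc_at c x = if x <= c then x else 0.
Proof.
move=> x0; rewrite /trunc_at ger0_norm// indicE.
have -> : (x \in `[- c, c]%classic) = (x <= c).
  rewrite mem_setE in_itv/=; case: (leP x c); rewrite ?andbF ?andbT// => xc.
  by apply: (@le_trans _ _ 0) => //; rewrite oppr_le0 (le_trans x0).
by case: ifP; rewrite (mulr1, mulr0).
Qed.

Lemma trunc_at_le c x : 0 <= c -> trunc_at c x <= c.
Proof.
move=> c0; rewrite /trunc_at indicE; case: (boolP (x \in _)); rewrite ?mulr0// mulr1.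
by rewrite mem_setE in_itv/= => ?; rewrite ler_norml.
Qed.

Lemma measurable_trunc_at c : measurable_fun setT (trunc_at c).
Proof.
apply: measurable_funM; first exact: normr_measurable.
exact: measurable_indic.
Qed.

End truncation.

Section geometric_subsequence.
Context {R : realType} (a : R).
Hypothesis a1 : 1 < a.

(* Etemadi's argument: convergence is proved along this subsequence and
   interpolated by monotonicity. *)
Definition geom_idx n := (Num.truncn (a ^+ n)).+1.

Lemma geom_idx_bounds n : a ^+ n < (geom_idx n)%:R <= 2 * a ^+ n.
Proof.
have an : 1 <= a ^+ n by rewrite exprn_ege1// ltW.
have /andP[h1 h2] := truncn_itv (le_trans ler01 an).
by rewrite h2/= /geom_idx -natr1; lra.
Qed.

(** A geometric sum is dominated by its last term. This is encoded by telescoping the capped power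
    min(a^n, a x), whose increment is (a - 1) a^n as long as a^n < x. It sums the probabilities of
    exceeding the truncation level. *)
Lemma geom_sum_below (x : R) N : 0 <= x ->
  \sum_(n < N) (geom_idx n)%:R * ((geom_idx n)%:R < x)%R%:R
  <= 2 * a / (a - 1) * x.
Proof.
move=> x0; have a0 : 0 < a - 1 by rewrite subr_gt0.
pose M n := Num.min (a ^+ n) (a * x).
apply: (@le_trans _ _ (\sum_(n < N) 2 / (a - 1) * (M n.+1 - M n))).
  apply: ler_sum => n _; have /andP[h1 h2] := geom_idx_bounds n.
  have Mn : M n <= M n.+1.
    rewrite /M le_min !ge_min lexx orbT andbT; apply/orP; left.
    by rewrite exprS ler_peMl ?exprn_ge0//; lra.
  case: ltP => hx; last by rewrite mulr0 mulr_ge0 ?divr_ge0 ?subr_ge0//; lra.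
  rewrite mulr1; have anx : a ^+ n < x by exact: lt_trans hx.
  have -> : M n.+1 = a * a ^+ n.
    by rewrite /M exprS min_l// ler_wpM2l ?ltW//; lra.
  have -> : M n = a ^+ n.
    by rewrite /M min_l//; apply: le_trans (ltW anx) _; rewrite ler_peMl//; lra.
  have -> : 2 / (a - 1) * (a * a ^+ n - a ^+ n) = 2 * a ^+ n; last by [].
  by field; rewrite gt_eqF.
rewrite -mulr_sumr -(big_mkord xpredT (fun n => M n.+1 - M n)) telescope_sumr//.
have -> : 2 * a / (a - 1) * x = 2 / (a - 1) * (a * x) by ring.
rewrite ler_wpM2l ?divr_ge0 ?(ltW a0)// lerBlDr.
rewrite /M ge_min; apply/orP; right; rewrite lerDl le_min !mulr_ge0//; lra.
Qed.

(** The same telescoping with min(a^(-n), 2 / x); the cap is inactive once x <= 2 a^n. It sums the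
    variances of the truncated variables. *)
Lemma geom_sum_above (x : R) N : 0 <= x ->
  \sum_(n < N) (geom_idx n)%:R^-1 * (x <= (geom_idx n)%:R)%R%:R * x ^+ 2
  <= 2 * a / (a - 1) * x.
Proof.
rewrite le_eqVlt => /predU1P[<-|x0].
  by rewrite mulr0 big1// => n _; rewrite expr0n mulr0.
have a0 : 0 < a - 1 by rewrite subr_gt0.
have aa : 0 < a by lra.
pose y := 2 / x; have y0 : 0 < y by rewrite divr_gt0.
pose M n := Num.min (a ^- n) y.
apply: (@le_trans _ _ (\sum_(n < N) a / (a - 1) * (M n - M n.+1) * x ^+ 2)).
  apply: ler_sum => n _; have /andP[h1 h2] := geom_idx_bounds n.
  rewrite ler_wpM2r ?sqr_ge0//.
  have an0 : 0 < a ^+ n by rewrite exprn_gt0.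
  have ann : a ^- n.+1 <= a ^- n.
    by rewrite lef_pV2 ?posrE ?exprn_gt0// exprS ler_peMl ?ltW.
  have Mn : M n.+1 <= M n.
    by rewrite /M le_min !ge_min lexx orbT andbT ann.
  case: (leP x) => hx; last by rewrite mulr0 mulr_ge0 ?divr_ge0 ?subr_ge0//; lra.
  rewrite mulr1; have anx : a ^- n <= y.
    rewrite /y -[leRHS]invrK invf_div lef_pV2 ?posrE ?divr_gt0//.
    by rewrite ler_pdivrMr// mulrC; exact: le_trans h2.
  have -> : M n = a ^- n by rewrite /M min_l.
  have -> : M n.+1 = a ^- n.+1 by rewrite /M min_l//; exact: le_trans anx.
  have -> : a / (a - 1) * (a ^- n - a ^- n.+1) = a ^- n.
    by rewrite exprS; field; rewrite !gt_eqF.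
  by rewrite lef_pV2 ?posrE ?ltW// ltr0n.
rewrite -mulr_suml -mulr_sumr -(big_mkord xpredT (fun n => M n - M n.+1)).
have -> : \sum_(0 <= n < N) (M n - M n.+1) = M 0%N - M N.
  rewrite -[RHS]opprB -(telescope_sumr M (leq0n N)) -sumrN.
  by apply: eq_bigr => n _; rewrite opprB.
have MM : M 0%N - M N <= y.
  have : M 0%N <= y by rewrite /M ge_min lexx orbT.
  have : 0 <= M N by rewrite /M le_min invr_ge0 exprn_ge0 ltW.
  lra.
apply: (@le_trans _ _ (a / (a - 1) * y * x ^+ 2)).
  by rewrite ler_wpM2r ?sqr_ge0// ler_wpM2l// divr_ge0 ?ltW.
rewrite /y le_eqVlt; apply/orP; left; apply/eqP; field.
by rewrite !gt_eqF.
Qed.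

Lemma geom_idx_gt (k : nat) : \forall n \near \oo, (k < geom_idx n)%N.
Proof.
have a0 : 0 < a - 1 by rewrite subr_gt0.
have bern n : 1 + n%:R * (a - 1) <= a ^+ n.
  elim: n => [|n IH]; first by rewrite mul0r addr0 expr0.
  rewrite exprS -natr1; apply: le_trans (ler_wpM2l _ IH); last lra.
  have : 0 <= n%:R * (a - 1) ^+ 2 by rewrite mulr_ge0 ?sqr_ge0.
  by rewrite expr2; nra.
near=> n; rewrite -(ltr_nat R); have /andP[h _] := geom_idx_bounds n.
apply: lt_trans h; apply: lt_le_trans (bern n).
rewrite ltr_pwDl// -ler_pdivrMr//; near: n; exact: nbhs_infty_ger.
Unshelve. all: by end_near. Qed.

Lemma geom_idx_le m n : (m <= n)%N -> (geom_idx m <= geom_idx n)%N.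
Proof. by move=> mn; rewrite ltnS; apply: le_truncn; rewrite ler_weXn2l ?ltW. Qed.

Lemma geom_idxS_le n : (geom_idx n.+1)%:R <= a * (geom_idx n)%:R + 1.
Proof.
have an k : 1 <= a ^+ k by rewrite exprn_ege1// ltW.
have /andP[h _] := truncn_itv (le_trans ler01 (an n.+1)).
have /andP[h2 _] := geom_idx_bounds n.
rewrite /geom_idx -natr1 lerD2r; apply: le_trans h _; rewrite exprS.
by rewrite ler_wpM2l ?ltW//; exact: lt_trans a1.
Qed.

End geometric_subsequence.

Section interpolation.
Context {R : realType}.

(** Sandwich: for k_n <= N < k_(n+1), monotonicity puts S N / N between S k_n / k_(n+1) and S
    k_(n+1) / k_n. Ratios and tolerances run over countable sets, so that the hypothesis can hold
    almost surely for all of them at once. *)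
Lemma geom_idx_cvg (S : nat -> R) (l : R) :
  (forall n, 0 <= S n) -> nondecreasing_seq S -> 0 <= l ->
  (forall p q : nat, \forall n \near \oo,
     `|(geom_idx (1 + p.+1%:R^-1 : R) n)%:R^-1 *
       S (geom_idx (1 + p.+1%:R^-1 : R) n) - l| <= q.+1%:R^-1) ->
  n%:R^-1 * S n @[n --> \oo] --> l.
Proof.
move=> S0 Snd l0 Sgeom; apply/cvgrPdist_le => eps eps0.
(* This is what (1 + 2 dlt)(l + dlt) <= l + eps requires, given dlt^2 <= dlt. *)
pose dlt := Num.min 1 (eps / (2 * l + 3)).
have l3 : 0 < 2 * l + 3 by lra.
have dlt0 : 0 < dlt by rewrite lt_min ltr01/= divr_gt0.
have dlt1 : dlt <= 1 by rewrite ge_min lexx.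
have dlte : dlt * (2 * l + 3) <= eps.
  by rewrite -ler_pdivlMr// ge_min lexx orbT.
pose p := Num.truncn dlt^-1.
have pd : p.+1%:R^-1 <= dlt.
  by rewrite -[leRHS]invrK lef_pV2 ?posrE ?invr_gt0// ltW// truncnS_gt.
pose a : R := 1 + p.+1%:R^-1.
have := Sgeom p p; rewrite -/a => Sg.
have a1 : 1 < a by rewrite /a ltrDl.
have [M _ HM] : \forall n \near \oo,
    `|(geom_idx a n)%:R^-1 * S (geom_idx a n) - l| <= dlt /\
    (p < geom_idx a n)%N.
  near=> n; split; last by near: n; exact: geom_idx_gt.
  by apply: le_trans pd; near: n; exact: Sg.
exists (geom_idx a M) => // N /= MN.
have exN : exists n, (N < geom_idx a n)%N.
  have [m _ /(_ m (leqnn m)) Hm] := geom_idx_gt a1 N.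
  by exists m.
case: (ex_minnP exN) => [[|n] Nn nmin].
  by move: Nn; rewrite ltnNge (leq_trans (geom_idx_le a1 (leq0n M)) MN).
have Mn : (M <= n)%N.
  rewrite leqNgt; apply/negP => nM.
  by move: Nn; rewrite ltnNge (leq_trans (geom_idx_le a1 nM) MN).
have nN : (geom_idx a n <= N)%N.
  by rewrite leqNgt; apply/negP => /nmin; rewrite ltnn.
have [u1 pk] := HM n Mn.
have [u2 _] := HM n.+1 (leqW Mn).
have kS := geom_idxS_le a1 n.
set k := geom_idx a n in nN u1 pk kS.
set k' := geom_idx a n.+1 in Nn u2 kS.
have k0 : 0 < k%:R :> R by rewrite ltr0n (leq_trans _ pk).
have k0' : 0 < k'%:R :> R by rewrite ltr0n.
have N0 : 0 < N%:R :> R by apply: lt_le_trans k0 _; rewrite ler_nat.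
have kr : k'%:R <= (1 + 2 * dlt) * k%:R.
  apply: le_trans kS _.
  (* Since k exceeds p, it exceeds 1 / dlt; the rounding error 1 in [geom_idxS_le] is then absorbed
     by a second dlt. *)
  have : 1 <= dlt * k%:R.
    rewrite mulrC -ler_pdivrMr// div1r; apply: le_trans (ltW (truncnS_gt _)) _.
    by rewrite ler_nat.
  have : p.+1%:R^-1 * k%:R <= dlt * k%:R by rewrite ler_wpM2r// ltW.
  have -> : a * k%:R = k%:R + p.+1%:R^-1 * k%:R by rewrite /a mulrDl mul1r.
  by move: (p.+1%:R^-1 * k%:R) => z; lra.
set u := k%:R^-1 * S k in u1.
set u' := k'%:R^-1 * S k' in u2.
have u0 : 0 <= u by rewrite mulr_ge0// invr_ge0 ltW.
have u0' : 0 <= u' by rewrite mulr_ge0// invr_ge0 ltW.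
have up : N%:R^-1 * S N <= (1 + 2 * dlt) * u'.
  apply: (@le_trans _ _ (k%:R^-1 * S k')).
    apply: ler_pM => //; last exact/Snd/ltnW.
    by rewrite lef_pV2 ?posrE// ler_nat.
  have -> : S k' = k'%:R * u' by rewrite /u' mulrA divff ?mul1r// gt_eqF.
  by rewrite mulrA ler_wpM2r// mulrC ler_pdivrMr.
have lo : u <= (1 + 2 * dlt) * (N%:R^-1 * S N).
  apply: (@le_trans _ _ (k%:R^-1 * S N)).
    by rewrite ler_wpM2l ?invr_ge0 ?(ltW k0)//; exact: Snd.
  rewrite mulrA ler_wpM2r// ler_pdivlMr// mulrC ler_pdivrMr//.
  by apply: le_trans kr; rewrite ler_nat ltnW.
move: up lo u1 u2 dlte; rewrite !ler_norml; set v := N%:R^-1 * S N.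
have v0 : 0 <= v by rewrite mulr_ge0// invr_ge0 ltW.
move=> up lo /andP[u1 _] /andP[_ u2] dlte.
have h1 : (1 + 2 * dlt) * u' <= (1 + 2 * dlt) * (l + dlt).
  by rewrite ler_wpM2l//; lra.
have d2 : dlt * dlt <= dlt by rewrite ler_piMr// ltW.
have dl : 0 <= dlt * l by rewrite mulr_ge0// ltW.
have vu : v <= l + eps by nra.
have h2 : v * (2 * dlt) <= (l + dlt) * (1 + 2 * dlt) * (2 * dlt).
  by rewrite ler_wpM2r; lra.
by apply/andP; split; nra.
Unshelve. all: by end_near. Qed.

End interpolation.

Section pairwise_iid.
Context d (T : measurableType d) (R : realType) (P : probability T R).
Variable X : nat -> {RV P >-> R}.
Hypothesis X_ge0 : forall i w, 0 <= X i w.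
Hypothesis X_indep : forall i j, i != j -> forall A B, measurable A ->
  measurable B -> P (X i @^-1` A `&` X j @^-1` B) =
    (P (X i @^-1` A) * P (X j @^-1` B))%E.
Hypothesis X_ident : forall i B, measurable B ->
  P (X i @^-1` B) = P (X 0%N @^-1` B).
Hypothesis X_int : P.-integrable setT (EFin \o X 0%N).

Lemma ge0_integral_ident i (f : R -> \bar R) : measurable_fun setT f ->
  (forall x, 0 <= f x)%E ->
  (\int[P]_w f (X i w) = \int[P]_w f (X 0%N w))%E.
Proof.
move=> mf f0; rewrite -!(@ge0_integral_distribution _ _ _ _ _ P _ f)//.
by apply: eq_measure_integral => A mA _; exact: X_ident.
Qed.

Let Y k i w := trunc_at k%:R (X i w).

Let mY k i : measurable_fun setT (Y k i).
Proof. by apply: measurableT_comp => //; exact: measurable_trunc_at. Qed.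

Let Y_bound k i w : `|Y k i w| <= k%:R.
Proof. by rewrite ger0_norm ?trunc_at_ge0// trunc_at_le. Qed.

Let mean k := \int[P]_w Y k 0%N w.

Let Y_int k i : P.-integrable setT (EFin \o Y k i).
Proof. exact: bounded_integrable (Y_bound k i). Qed.

Let mean_Y k i : \int[P]_w Y k i w = mean k.
Proof.
rewrite /mean /Rintegral; congr fine.
apply: (@ge0_integral_ident _ (EFin \o trunc_at k%:R)).
  by apply/measurable_EFinP; exact: measurable_trunc_at.
by move=> x; rewrite lee_fin trunc_at_ge0.
Qed.

Let YY_int k i j : P.-integrable setT (EFin \o (fun w => Y k i w * Y k j w)).
Proof.
apply: (@bounded_integrable _ _ _ _ _ (k%:R * k%:R)) => [|w].
  exact: measurable_funM.
by rewrite normrM ler_pM.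
Qed.

Let mean_YY k i j : i != j -> \int[P]_w (Y k i w * Y k j w) = mean k ^+ 2.
Proof.
move=> ij; apply: EFin_inj; rewrite EFin_Rintegral//.
pose F (z : R * R) : \bar R := (trunc_at k%:R z.1 * trunc_at k%:R z.2)%:E.
rewrite (@ge0_integral_joint_law _ _ _ _ _ _ _ P (distribution P (X j))
  (X i) (X j) F).
- have inner x : (\int[distribution P (X j)]_y F (x, y) =
      (trunc_at k%:R x * mean k)%:E)%E.
    rewrite ge0_integral_distribution//=; last 2 first.
    + apply/measurable_EFinP; apply: measurable_funM.
        by rewrite /=; exact: measurable_cst.
      exact: measurable_trunc_at.
    + by move=> y; rewrite lee_fin mulr_ge0// trunc_at_ge0.
    under eq_integral do rewrite /F /= EFinM.
    rewrite integralZl//; last exact: (Y_int k j).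
    by rewrite -[X in (_ * X)%E](EFin_Rintegral (Y_int k j)) mean_Y.
  under eq_integral do rewrite inner EFinM.
  rewrite integralZr//; last exact: (Y_int k i).
  by rewrite -[X in (X * _)%E](EFin_Rintegral (Y_int k i)) mean_Y expr2.
- by move=> A B mA mB; exact: X_indep.
- apply/measurable_EFinP; apply: measurable_funM.
    by apply: measurableT_comp; first exact: measurable_trunc_at.
  by apply: measurableT_comp; first exact: measurable_trunc_at.
- by move=> z; rewrite lee_fin mulr_ge0// trunc_at_ge0.
Qed.

(** Pairwise independence kills the cross terms, and a variance is at most the second moment. *)
Let var_Y k : \int[P]_w (\sum_(i < k) Y k i w - k%:R * mean k) ^+ 2
  <= k%:R * \int[P]_w Y k 0%N w ^+ 2.
Proof.
pose U i j w := (Y k i w - mean k) * (Y k j w - mean k).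
have UE i j w : U i j w = Y k i w * Y k j w + (- mean k * Y k i w)
    + (- mean k * Y k j w + mean k ^+ 2) by rewrite /U; ring.
have mi i : P.-integrable setT (EFin \o (fun w => - mean k * Y k i w)).
  exact: (integrableZl measurableT (- mean k) (Y_int k i)).
have ci : P.-integrable setT (EFin \o (fun w : T => mean k ^+ 2)).
  exact: finite_measure_integrable_cst.
have i1 i j : P.-integrable setT (EFin \o (fun w => Y k i w * Y k j w + (- mean k * Y k i w))).
  exact: (integrableD measurableT (YY_int k i j) (mi i)).
have i2 j : P.-integrable setT (EFin \o (fun w => - mean k * Y k j w + mean k ^+ 2)).
  exact: (integrableD measurableT (mi j) ci).
have iU i j : P.-integrable setT (EFin \o U i j).
  apply: eq_integrable (integrableD measurableT (i1 i j) (i2 j)) => //.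
  by move=> w _; rewrite /= UE.
have EU i j : \int[P]_w U i j w = \int[P]_w (Y k i w * Y k j w) - mean k ^+ 2.
  have e1 l : \int[P]_w (- mean k * Y k l w) = - mean k * mean k.
    by rewrite RintegralZl ?mean_Y//; exact: Y_int.
  under eq_Rintegral do rewrite UE.
  rewrite RintegralD// RintegralD// RintegralD// !e1.
  by rewrite Rintegral_setT_cst; ring.
have -> : \int[P]_w (\sum_(i < k) Y k i w - k%:R * mean k) ^+ 2
    = \sum_(i < k) \sum_(j < k) \int[P]_w U i j w.
  under eq_bigr do rewrite -Rintegral_sum//.
  rewrite -Rintegral_sum; last first.
    move=> i.
    have := @integrable_sum _ _ _ P setT measurableT _ (index_enum 'I_k) xpredT (fun j => EFin \o U i j).
    move=> /(_ (fun j _ => iU i j)); congr (_.-integrable _ _).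
    by apply/funext => w /=; rewrite sumEFin.
  apply: eq_Rintegral => w _.
  have -> : \sum_(i < k) Y k i w - k%:R * mean k = \sum_(i < k) (Y k i w - mean k).
    by rewrite sumrB sumr_const card_ord mulr_natl.
  by rewrite expr2 big_distrlr.
have -> : k%:R * \int[P]_w Y k 0%N w ^+ 2 = \sum_(i < k) \int[P]_w Y k 0%N w ^+ 2.
  by rewrite sumr_const card_ord mulr_natl.
apply: ler_sum => i _.
rewrite (bigD1 i)//= big1 ?addr0; last first.
  by move=> j ji; rewrite EU mean_YY ?subrr// eq_sym.
rewrite EU; have -> : \int[P]_w (Y k i w * Y k i w) = \int[P]_w Y k 0%N w ^+ 2.
  under eq_Rintegral do rewrite -expr2.
  rewrite /Rintegral; congr fine.
  apply: (@ge0_integral_ident _ (fun x => (trunc_at k%:R x ^+ 2)%:E)).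
    by apply/measurable_EFinP; apply: measurable_funX; exact: measurable_trunc_at.
  by move=> x; rewrite lee_fin sqr_ge0.
by rewrite lerBlDr lerDl sqr_ge0.
Qed.

(** The two ways in which the average at time k can fail: some variable exceeds the level k, or the
    truncated sum deviates from its mean. All variables up to time k are truncated at the same
    level, so the truncated ones remain identically distributed. *)
Let bad eps k : set T :=
  \big[setU/set0]_(i < k) [set w | k%:R < X i w] `|`
  [set w | eps * k%:R <= `|\sum_(i < k) Y k i w - k%:R * mean k|].

Let tail k : set R := `]k%:R, +oo[%classic.

(** The integrand whose expectation bounds P(bad): the union bound gives the first term, Chebyshev's
    inequality the second. *)
Let g eps k x := k%:R * \1_(tail k) x + (eps ^+ 2)^-1 * k%:R^-1 * trunc_at k%:R x ^+ 2.

Let mS k : measurable_fun setT (fun w => \sum_(i < k) Y k i w - k%:R * mean k).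
Proof. by apply: measurable_funB => //; apply: measurable_sum. Qed.

Let mtail k i : measurable [set w | k%:R < X i w].
Proof.
have -> : [set w | k%:R < X i w] = X i @^-1` tail k.
  by apply/seteqP; split => w; rewrite /tail /= in_itv/= andbT.
by apply: measurable_funPTI; exact: measurable_itv.
Qed.

Let tail_ident k i : P [set w | k%:R < X i w] = P [set w | k%:R < X 0%N w].
Proof.
have tE j : [set w | k%:R < X j w] = X j @^-1` tail k.
  by apply/seteqP; split => w; rewrite /tail /= in_itv/= andbT.
by rewrite !tE X_ident//; exact: measurable_itv.
Qed.

Let mbad eps k : measurable (bad eps k).
Proof.
apply: measurableU; first by apply: bigsetU_measurable => i _; exact: mtail.
rewrite -[X in measurable X]setTI.
by apply: measurable_fun_le => //; apply: measurableT_comp.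
Qed.

Let g_ge0 eps k x : 0 <= g eps k x.
Proof. by rewrite addr_ge0 ?mulr_ge0 ?invr_ge0 ?sqr_ge0// indicE. Qed.

Let mg eps k : measurable_fun setT (g eps k).
Proof.
apply: measurable_funD; apply: measurable_funM => //.
  by apply: measurable_indic; exact: measurable_itv.
apply: measurable_funX; exact: measurable_trunc_at.
Qed.

Let P_bad eps k : 0 < eps -> (0 < k)%N ->
  (P (bad eps k) <= \int[P]_w (g eps k (X 0%N w))%:E)%E.
Proof.
move=> eps0 k0; have k0' : 0 < k%:R :> R by rewrite ltr0n.
have m1 : measurable_fun setT (fun w => (\1_(tail k) (X 0%N w) : R)%:E).
  apply/measurable_EFinP; apply: measurableT_comp => //.
  by apply: measurable_indic; exact: measurable_itv.
have m1' : measurable_fun setT (fun w => (k%:R * \1_(tail k) (X 0%N w) : R)%:E).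
  by apply/measurable_EFinP; apply: measurable_funM => //; exact/measurable_EFinP.
have m2 : measurable_fun setT (fun w =>
    ((eps ^+ 2)^-1 * k%:R^-1 * trunc_at k%:R (X 0%N w) ^+ 2)%:E).
  apply/measurable_EFinP; apply: measurable_funM => //.
  by apply: measurable_funX; exact: mY.
have p1 w : setT w -> (0 <= (k%:R * \1_(tail k) (X 0%N w) : R)%:E)%E.
  by rewrite lee_fin mulr_ge0.
have p2 w : setT w -> (0 <= ((eps ^+ 2)^-1 * k%:R^-1 * trunc_at k%:R (X 0%N w) ^+ 2)%:E)%E.
  by rewrite lee_fin mulr_ge0 ?sqr_ge0// mulr_ge0 ?invr_ge0 ?sqr_ge0.
under eq_integral do rewrite EFinD.
rewrite ge0_integralD//.
apply: le_trans (measureU2 _ _ _) _ => //.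
- by apply: bigsetU_measurable => i _; exact: mtail.
- rewrite -[X in measurable X]setTI.
  by apply: measurable_fun_le => //; apply: measurableT_comp.
apply: leeD.
  apply: le_trans (Boole_inequality P (fun i _ => mtail k i)) _.
  rewrite (eq_bigr (fun=> P [set w | k%:R < X 0%N w])); last by move=> i _; exact: tail_ident.
  have Pc := fineK (fin_num_measure P _ (mtail k 0)).
  rewrite -[in leLHS]Pc sumEFin sumr_const card_ord.
  under eq_integral do rewrite EFinM.
  rewrite ge0_integralZl//.
  have -> : (\int[P]_w (\1_(tail k) (X 0%N w))%:E)%E = P [set w | k%:R < X 0%N w].
    have -> : (fun w => (\1_(tail k) (X 0%N w) : R)%:E) =
        (fun w => (\1_[set w | k%:R < X 0%N w] w : R)%:E).
      by apply/funext => w; rewrite !indicE /tail !mem_setE in_itv/= andbT.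
    by rewrite integral_indic// setIT.
  by rewrite -[in leRHS]Pc -EFinM mulr_natl.
rewrite (_ : (\int[P]_w ((eps ^+ 2)^-1 * k%:R^-1 * trunc_at k%:R (X 0%N w) ^+ 2)%:E)%E
  = ((eps ^+ 2)^-1 * k%:R^-1 * \int[P]_w Y k 0%N w ^+ 2)%:E); last first.
  rewrite -RintegralZl//; last first.
    by under eq_fun do rewrite expr2; exact: YY_int.
  rewrite EFin_Rintegral//.
  have := integrableZl measurableT ((eps ^+ 2)^-1 * k%:R^-1) (YY_int k 0 0).
  by congr (_.-integrable _ _); apply/funext => w /=; rewrite expr2.
have e2 : 0 < (eps * k%:R) ^+ 2 by rewrite exprn_gt0// mulr_gt0.
have mk := markov_sqr P (mS k) (ltW (mulr_gt0 eps0 k0')).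
rewrite -(@lee_pmul2l _ ((eps * k%:R) ^+ 2)%:E)//.
apply: le_trans mk _.
rewrite -EFin_Rintegral; last first.
  apply: (@bounded_integrable _ _ _ _ _ ((k%:R * k%:R + k%:R * `|mean k|) ^+ 2)).
    exact: measurable_funX.
  move=> w; rewrite normrX lerXn2r ?nnegrE ?addr_ge0 ?mulr_ge0//.
  apply: le_trans (ler_normB _ _) _; rewrite normrM normr_nat lerD2r.
  apply: le_trans (ler_norm_sum _ _ _) _.
  apply: (@le_trans _ _ (\sum_(i < k) k%:R)); first exact: ler_sum.
  by rewrite sumr_const card_ord mulr_natl.
rewrite lee_fin; apply: le_trans (var_Y k) _.
rewrite le_eqVlt; apply/orP; left; apply/eqP; field.
by rewrite !gt_eqF.
Qed.

Let K := \int[P]_w X 0%N w.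

(** The sum is taken inside the expectation, where the two geometric bounds dominate it pointwise by
    a multiple of the integrable variable X 0. *)
Let sum_bad_lty (a eps : R) : 1 < a -> 0 < eps ->
  (\sum_(0 <= n <oo) P (bad eps (geom_idx a n)) < +oo)%E.
Proof.
move=> a1 eps0.
pose C := 2 * a / (a - 1) + (eps ^+ 2)^-1 * (2 * a / (a - 1)).
apply: (@le_lt_trans _ _ (C * K)%:E); last exact: ltry.
apply: lime_le; first by apply: is_cvg_nneseries => n _ _; exact: measure_ge0.
apply: nearW => N.
apply: (@le_trans _ _ (\sum_(0 <= n < N)
    \int[P]_w (g eps (geom_idx a n) (X 0%N w))%:E)%E).
  by apply: lee_sum => n _; exact: P_bad.
rewrite -ge0_integral_sum//; last 2 first.
- by move=> n; apply/measurable_EFinP; exact: measurableT_comp.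
- by move=> n w _; rewrite lee_fin.
rewrite EFinM (EFin_Rintegral X_int) -integralZl//.
apply: ge0_le_integral => //.
- by move=> w _; apply: sume_ge0 => n _; rewrite lee_fin.
- apply: emeasurable_sum => n; apply/measurable_EFinP; exact: measurableT_comp.
- by apply: measurable_funeM; exact/measurable_EFinP.
move=> w _; rewrite sumEFin -EFinM lee_fin big_mkord.
set x := X 0%N w; have x0 : 0 <= x by exact: X_ge0.
rewrite /g big_split/= /C mulrDl; apply: lerD.
  apply: le_trans (geom_sum_below a1 N x0).
  by apply: ler_sum => n _; rewrite indicE /tail mem_setE in_itv/= andbT.
rewrite -[leRHS]mulrA; apply: le_trans (ler_wpM2l _ (geom_sum_above a1 N x0)).
  rewrite mulr_sumr; apply: ler_sum => n _.
  rewrite trunc_atE//; case: ifP => _; last by rewrite expr0n !mulr0 mul0r mulr0.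
  have -> : true%:R = 1 :> R by [].
  by rewrite mulr1 -[leLHS]mulrA.
by rewrite invr_ge0 sqr_ge0.
Qed.

Let mean_cvg : mean k @[k --> \oo] --> K.
Proof.
have m1 k : measurable_fun setT (fun w => (Y k 0%N w)%:E) by exact/measurable_EFinP.
have m2 : measurable_fun setT (fun w => (X 0%N w)%:E) by exact/measurable_EFinP.
have cv : {ae P, forall w, setT w -> (Y k 0%N w)%:E @[k --> \oo] --> (X 0%N w)%:E}.
  apply: aeW => w _; apply: cvg_near_cst; near=> k.
  by rewrite /Y trunc_atE// ifT//; near: k; exact: nbhs_infty_ger.
have bd : {ae P, forall w k, setT w -> (`|(Y k 0%N w)%:E| <= (X 0%N w)%:E)%E}.
  apply: aeW => w k _; rewrite abse_EFin lee_fin.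
  by rewrite ger0_norm ?trunc_at_ge0// (le_trans (trunc_at_le_norm _ _))// ger0_norm.
have [_ _] := dominated_convergence measurableT m1 m2 cv X_int bd.
have -> : (fun n => \int[P]_w (Y n 0%N w)%:E)%E = EFin \o mean.
  by apply/funext => k /=; rewrite -EFin_Rintegral.
by rewrite -EFin_Rintegral// => /fine_cvgP[].
Unshelve. all: by end_near. Qed.

(** Borel-Cantelli: almost surely only finitely many bad events occur along the geometric indices,
    and then sums of X are sums of truncated variables. *)
Let slln_geom (a eps : R) : 1 < a -> 0 < eps ->
  {ae P, forall w, \forall n \near \oo,
     `|(geom_idx a n)%:R^-1 * \sum_(i < geom_idx a n) X i w - K| <= eps}.
Proof.
move=> a1 eps0; have e2 : 0 < eps / 2 by rewrite divr_gt0.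
have := lim_sup_set_cvg0 (fun n => mbad (eps / 2) (geom_idx a n)) (sum_bad_lty a1 e2).
set L := lim_sup_set _ => L0.
exists L; split => //.
  by apply: bigcap_measurable => // n _; apply: bigcup_measurable => j _; exact: mbad.
move=> w; apply: contra_notP => /= wL.
have [N HN] : exists N, forall n, (N <= n)%N -> ~ bad (eps / 2) (geom_idx a n) w.
  apply: contrapT => h; apply: wL => n _; apply: contrapT => hn; apply: h.
  by exists n => m nm bm; apply: hn; exists m.
have [M _ HM] : \forall n \near \oo, `|mean (geom_idx a n) - K| <= eps / 2.
  have /cvgrPdist_le/(_ _ e2)[M _ HM] := mean_cvg.
  near=> n; rewrite distrC; apply: HM => /=; apply: ltnW.
  by near: n; exact: (geom_idx_gt a1).
near=> n; set k := geom_idx a n.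
have nN : (N <= n)%N by near: n; exact: nbhs_infty_ge.
have k0 : 0 < k%:R :> R by rewrite ltr0n.
have /not_orP[h1 h2] := HN n nN.
have XY i : (i < k)%N -> X i w = Y k i w.
  move=> ik; rewrite /Y trunc_atE//; case: ifPn => //; rewrite -ltNge => kX.
  by exfalso; apply: h1; rewrite -(bigcup_mkord k (fun i => [set w | k%:R < X i w])); exists i.
have -> : \sum_(i < k) X i w = \sum_(i < k) Y k i w.
  by apply: eq_bigr => i _; exact: XY.
move/negP: h2; rewrite -ltNge => h2.
have -> : eps = eps / 2 + eps / 2 by field.
apply: le_trans (ler_distD (mean k) _ _) _; apply: lerD; last first.
  by apply: HM => /=; near: n; exact: nbhs_infty_ge.
have -> : k%:R^-1 * \sum_(i < k) Y k i w - mean k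
    = k%:R^-1 * (\sum_(i < k) Y k i w - k%:R * mean k).
  by rewrite mulrBr mulKf// gt_eqF.
rewrite normrM ger0_norm ?invr_ge0 ?(ltW k0)// ler_pdivrMl// [leRHS]mulrC.
exact: ltW.
Unshelve. all: by end_near. Qed.

Theorem strong_law :
  {ae P, forall w, n%:R^-1 * \sum_(i < n) X i w @[n --> \oo] --> \int[P]_w X 0%N w}.
Proof.
have a1 p : 1 < 1 + p.+1%:R^-1 :> R by rewrite ltrDl.
have q0 q : 0 < q.+1%:R^-1 :> R by rewrite invr_gt0.
have := ae_foralln (fun p => ae_foralln (fun q => slln_geom (a1 p) (q0 q))).
apply: filterS => w Hw; apply: geom_idx_cvg => //.
- by move=> n; exact: sumr_ge0.
- apply/nondecreasing_seqP => n; rewrite big_ord_recr/= lerDl; exact: X_ge0.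
- by apply: Rintegral_ge0 => v _; exact: X_ge0.
Qed.

End pairwise_iid.

(** * Weighted sums of squares of Gaussian variables *)

Section normal_square.
Context {R : realType}.
Local Notation mu := (@lebesgue_measure R).

(** The Radon-Nikodym derivative is identified almost everywhere with the density, because both have
    the same integral over every measurable set. *)
Lemma integral_normal_prob (f : R -> \bar R) :
  (normal_prob (0 : R) 1).-integrable setT f ->
  (\int[normal_prob 0 1]_x f x = \int[mu]_x (f x * (normal_pdf 0 1 x)%:E))%E.
Proof.
move=> fi; have dom := @normal_prob_dominates R 0 1.
rewrite -(Radon_Nikodym_change_of_variables dom)//.
apply: ae_eq_integral => //.
- apply: emeasurable_funM; first exact: measurable_int fi.
  by apply: (measurable_int mu); exact: Radon_Nikodym_integrable.
- apply: emeasurable_funM; first exact: measurable_int fi.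
  by apply/measurable_EFinP; exact: measurable_normal_pdf.
- apply: ae_eqe_mul2l; rewrite Radon_NikodymE//=.
  case: cid => /= h [h1 h2 h3].
  apply: integral_ae_eq => //.
  + by apply/measurable_EFinP; exact: measurable_normal_pdf.
  + by move=> E _ mE; rewrite -h3.
Qed.

(** The factor exp(-c x^2) turns the standard density into s times the centred normal density of
    variance s^2 = 1 / (1 + 2 c). Writing s as an exponential turns later products into sums. *)
Lemma normal_square_laplace (c : R) : 0 <= c ->
  (\int[normal_prob 0 1]_x (expR (- (c * x ^+ 2)))%:E =
   (expR (- (ln (1 + 2 * c) / 2)))%:E)%E.
Proof.
move=> c0; have c1 : 0 < 1 + 2 * c by lra.
set s := expR (- (ln (1 + 2 * c) / 2)).
have s0 : 0 < s by exact: expR_gt0.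
have s2 : s ^+ 2 = (1 + 2 * c)^-1.
  rewrite /s -expRM_natl -[RHS]lnK ?posrE ?invr_gt0// lnV ?posrE//.
  by congr expR; field.
rewrite integral_normal_prob; last first.
  apply: (@bounded_integrable _ _ _ (normal_prob 0 1) _ 1).
    apply: measurableT_comp => //; apply: measurableT_comp => //.
    exact: measurable_funM.
  move=> x; rewrite ger0_norm ?expR_ge0// -expR0 ler_expR oppr_le0 mulr_ge0//.
  exact: sqr_ge0.
have pdfE x : expR (- (c * x ^+ 2)) * normal_pdf 0 1 x = s * normal_pdf 0 s x.
  rewrite !normal_pdfE ?gt_eqF// /normal_fun /normal_peak !subr0.
  have -> : Num.sqrt (s ^+ 2 * pi *+ 2) = s * Num.sqrt (1 ^+ 2 * pi *+ 2).
    rewrite -mulrnAr sqrtrM ?sqr_ge0// sqrtr_sqr gtr0_norm//.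
    by rewrite expr1n mul1r.
  rewrite invfM -[in RHS]mulrA mulVKf ?gt_eqF// mulrCA -expRD.
  congr (_ * expR _); rewrite s2 expr1n; field.
  by rewrite gt_eqF.
under eq_integral do rewrite -EFinM pdfE EFinM.
rewrite integralZl//; last exact: integrable_normal_pdf.
by rewrite integral_normal_pdf mule1.
Qed.

(** A negative u is allowed, its square root being 0: window endpoints below 0 need no separate
    treatment. *)
Lemma sqrtr_add_le (u v : R) : 0 <= v ->
  Num.sqrt (u + v) <= Num.sqrt u + Num.sqrt v.
Proof.
move=> v0; have [u0|u0] := leP 0 u; last first.
  rewrite (ltr0_sqrtr u0) add0r.
  by apply: ler_wsqrtr; rewrite gerDr ltW.
rewrite -(@ler_pXn2r _ 2) ?nnegrE ?addr_ge0 ?sqrtr_ge0//.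
rewrite sqr_sqrtr ?addr_ge0// sqrrD !sqr_sqrtr//.
by have := mulr_ge0 (sqrtr_ge0 u) (sqrtr_ge0 v); lra.
Qed.

Definition window_bound (lam h : R) := 2 * normal_peak 1 * Num.sqrt (h / lam).

Lemma normal_square_window (lam c h : R) : 0 < lam -> 0 <= h ->
  (normal_prob 0 1 [set x : R | (c < lam * x ^+ 2 <= c + h)%R]
   <= (window_bound lam h)%:E)%E.
Proof.
move=> lam0 h0.
pose r := Num.sqrt (c / lam); pose r' := Num.sqrt ((c + h) / lam).
have rr' : r <= r' by apply: ler_wsqrtr; rewrite ler_wpM2r ?invr_ge0 ?(ltW lam0)// lerDl.
have r'r : r' - r <= Num.sqrt (h / lam).
  by rewrite lerBlDl /r' mulrDl sqrtr_add_le// divr_ge0// ltW.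
(* The window pulls back to two symmetric intervals of length at most sqrt(h / lam); the density is
   bounded by its peak, hence [window_bound]. *)
pose A : set R := `[- r', - r] `|` `[r, r'].
have mA : measurable A by apply: measurableU; exact: measurable_itv.
have sub : [set x : R | c < lam * x ^+ 2 <= c + h] `<=` A.
  move=> x /= /andP[h1 h2].
  have xr : r <= `|x|.
    rewrite -sqrtr_sqr; apply: ler_wsqrtr.
    by rewrite ler_pdivrMr// mulrC ltW.
  have xr' : `|x| <= r'.
    rewrite -sqrtr_sqr; apply: ler_wsqrtr.
    by rewrite ler_pdivlMr// mulrC.
  have [x0|x0] := leP 0 x.
    by right; rewrite /= in_itv/=; move: xr xr'; rewrite ger0_norm// => -> ->.
  by left; rewrite /= in_itv/=; move: xr xr'; rewrite ltr0_norm// lerNr => ->; rewrite lerNl => ->.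
have mS : measurable [set x : R | c < lam * x ^+ 2 <= c + h].
  have -> : [set x : R | c < lam * x ^+ 2 <= c + h] =
      (fun x => lam * x ^+ 2) @^-1` `]c, c + h]%classic.
    by apply/seteqP; split => x /=; rewrite in_itv.
  rewrite -[X in measurable X]setTI.
  have mf : measurable_fun setT (fun x : R => lam * x ^+ 2).
    by apply: measurable_funM => //; exact: measurable_funX.
  by apply: mf.
apply: (@le_trans _ _ (normal_prob 0 1 A)); first by apply: le_measure; rewrite ?inE.
apply: (@le_trans _ _ (\int[mu]_(x in A) (cst (normal_peak 1)%:E x))%E).
  apply: ge0_le_integral => //.
  - by move=> x _; rewrite lee_fin normal_pdf_ge0.
  - by apply: measurable_funTS; apply/measurable_EFinP; exact: measurable_normal_pdf.
  - by move=> x _; rewrite lee_fin normal_pdf_ub.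
rewrite integral_cst//.
apply: (@le_trans _ _ ((normal_peak 1)%:E * ((r' - r) + (r' - r))%:E)%E).
  apply: lee_wpmul2l; first by rewrite lee_fin normal_peak_ge0.
  apply: le_trans (measureU2 _ _ _) _; [exact: measurable_itv|exact: measurable_itv|].
  have itv_le (x y : R) : x <= y -> (mu `[x, y]%classic <= (y - x)%:E)%E.
    move=> xy; rewrite lebesgue_measure_itv/= lte_fin.
    by case: ifPn => _; [rewrite -EFinB|rewrite lee_fin subr_ge0].
  have := itv_le (- r') (- r); rewrite lerN2 opprK addrC => /(_ rr') i1.
  by rewrite EFinD; exact: leeD i1 (itv_le _ _ rr').
rewrite -EFinM lee_fin /window_bound.
have -> : 2 * normal_peak 1 * Num.sqrt (h / lam)
   = normal_peak 1 * (Num.sqrt (h / lam) + Num.sqrt (h / lam)) :> R by ring.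
by rewrite ler_wpM2l ?normal_peak_ge0// lerD.
Qed.

Lemma window_bound_small (lam e : R) : 0 < lam -> 0 < e ->
  exists2 h, 0 < h & window_bound lam h <= e.
Proof.
move=> lam0 e0; have p0 : 0 < 2 * normal_peak 1 :> R by rewrite mulr_gt0// normal_peak_gt0.
exists (lam * (e / (2 * normal_peak 1)) ^+ 2).
  by rewrite mulr_gt0// exprn_gt0// divr_gt0.
rewrite /window_bound [lam * _]mulrC mulfK ?gt_eqF// sqrtr_sqr ger0_norm ?divr_ge0 ?(ltW e0) ?(ltW p0)//.
by rewrite mulrC divfK// gt_eqF.
Qed.

End normal_square.

Section weighted_squares.
Context d (T : measurableType d) (R : realType) (P : probability T R).
Variables (lam : nat -> R) (N : nat -> {RV P >-> R}).
Hypothesis N_indep : mutually_independent N.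
Hypothesis N_normal : forall i, standard_normal (N i).

Lemma integral_setT_cst (c : R) : (\int[P]_w c%:E = c%:E)%E.
Proof. by have := @expectation_cst _ _ _ P c; rewrite unlock. Qed.

(** The predicate Q allows one index to be left out, so that its variable is independent of the
    sum. *)
Definition square_sum (Q : pred nat) (m : nat) (w : T) : R :=
  \sum_(j < m | Q j) lam j * N j w ^+ 2.

Lemma measurable_square_sum Q m : measurable_fun setT (square_sum Q m).
Proof.
rewrite /square_sum.
under eq_fun do rewrite big_mkcond.
apply: measurable_sum => j; case: (Q j) => //.
by apply: measurable_funM => //; exact: measurable_funX.
Qed.

HB.instance Definition _ Q m :=
  isMeasurableFun.Build _ _ _ _ (square_sum Q m) (measurable_square_sum Q m).

Let NB (B : nat -> set R) (J : {fset nat}) := \bigcap_(j in [set` J]) (N j @^-1` B j).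

Let mNB B J : (forall j, measurable (B j)) -> measurable (NB B J).
Proof.
by move=> mB; apply: fin_bigcap_measurable => // j _; exact: measurable_funPTI.
Qed.

Let NB1U B J m : m \notin J ->
  NB B (m |` J)%fset = (N m @^-1` B m) `&` NB B J.
Proof.
move=> mJ; rewrite /NB; have -> : [set` (m |` J)%fset] = m |` [set` J].
  by apply/seteqP; split => x; rewrite /= !inE => /predU1P.
by rewrite bigcap_setU1.
Qed.

Let T0 := g_sigma_algebraType (R.-ocitv.-measurable).

(* [normal_prob] lives on the Caratheodory copy [T0] of R, whose measurable sets
   are convertible to those of R but whose structure is not unifiable with R's. *)
Lemma ge0_integral_standard_normal (X : {RV P >-> R}) (f : R -> \bar R) :
  standard_normal X -> measurable_fun setT f -> (forall x, 0 <= f x)%E ->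
  (\int[P]_w f (X w) = \int[normal_prob 0 1]_y f y)%E.
Proof.
move=> h mf f0.
have mX : measurable_fun (setT : set T) (X : T -> T0) by exact: (measurable_funP X).
have mf0 : measurable_fun (setT : set T0) (f : T0 -> \bar R) by exact: mf.
rewrite -(@ge0_integral_pushforward _ _ T T0 R X mX P setT f)//.
by apply: eq_measure_integral => A mA _; exact: (h A mA).
Qed.

(** Independence is only given on rectangles. The event [NB B J] is carried along so that the
    induction closes: when N m enters the sum, the induction hypothesis is used with N m as one more
    event. *)
Lemma square_sum_indep (Q : pred nat) m : forall (J : {fset nat}),
  (forall j, j \in J -> (m <= j)%N || ~~ Q j) ->
  forall (C : set R) (B : nat -> set R), measurable C ->
  (forall j, measurable (B j)) ->
  P (square_sum Q m @^-1` C `&` NB B J)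
  = (P (square_sum Q m @^-1` C) * \prod_(j <- J) P (N j @^-1` B j))%E.
Proof.
elim: m => [|m IH] J JQ C B mC mB.
  have S0 w : square_sum Q 0 w = 0 by rewrite /square_sum big_ord0.
  have [C0|C0] := pselect (C 0).
    have -> : square_sum Q 0 @^-1` C = setT.
      by apply/seteqP; split => w //= _; rewrite S0.
    by rewrite setTI probability_setT mul1e -N_indep.
  have -> : square_sum Q 0 @^-1` C = set0.
    by apply/seteqP; split => w //=; rewrite S0.
  by rewrite set0I measure0 mul0e.
have [Qm|nQm] := boolP (Q m); last first.
  have SE : square_sum Q m.+1 = square_sum Q m.
    by apply/funext => w; rewrite /square_sum big_mkcond big_ord_recr/= -big_mkcond (negbTE nQm) addr0.
  by rewrite SE; apply: IH => // j /JQ /orP[/ltnW ->//|->]; rewrite orbT.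
have mJ : m \notin J.
  by apply/negP => /JQ; rewrite ltnn Qm.
have SE w : square_sum Q m.+1 w = square_sum Q m w + lam m * N m w ^+ 2.
  by rewrite /square_sum big_mkcond big_ord_recr/= -big_mkcond Qm.
pose F (z : R * R) : \bar R := (\1_C (z.1 + lam m * z.2 ^+ 2))%:E.
have mF : measurable_fun [set: R * R] F.
  apply/measurable_EFinP; apply: measurableT_comp; first exact: measurable_indic.
  apply: measurable_funD => //; apply: measurable_funM => //.
  exact: measurable_funX.
have F0 z : (0 <= F z)%E by rewrite lee_fin indicE.
have PE (mu : {finite_measure set T -> \bar R}) :
   (mu (square_sum Q m.+1 @^-1` C) = \int[mu]_w F (square_sum Q m w, N m w))%E.
  have mS : measurable (square_sum Q m.+1 @^-1` C) by exact: measurable_funPTI.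
  rewrite -[in LHS](setIT (square_sum Q m.+1 @^-1` C)) -integral_indic//.
  apply: eq_integral => w _.
  rewrite /F /= -SE !indicE.
  have -> : (w \in square_sum Q m.+1 @^-1` C) = (square_sum Q m.+1 w \in C); last by [].
  by apply/idP/idP; rewrite !inE.
have mA := mNB J mB; set A := NB B J in mA *.
have Afin : (P A < +oo)%E by rewrite ltey_eq fin_num_measure.
(* Under P restricted to A the pair (sum, N m) factorizes as it does under P, so both sides become
   iterated integrals of the same F. *)
pose muA : {finite_measure set T -> \bar R} := mfrestr mA Afin.
have QJ j : j \in J -> (m <= j)%N || ~~ Q j.
  by move=> /JQ /orP[/ltnW ->//|->]; rewrite orbT.
have QJm j : j \in (m |` J)%fset -> (m <= j)%N || ~~ Q j.
  by rewrite !inE => /predU1P[->|/QJ//]; rewrite leqnn.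
have indA (E D : set R) : measurable E -> measurable D ->
    muA (square_sum Q m @^-1` E `&` N m @^-1` D)
    = (muA (square_sum Q m @^-1` E) * distribution P (N m) D)%E.
  move=> mE mD; rewrite /muA/= /mfrestr/= /mrestr.
  pose B' j := if j == m then D else B j.
  have mB' j : measurable (B' j) by rewrite /B'; case: ifP.
  have B'J : NB B' J = A.
    apply: eq_bigcapr => j /= jJ; rewrite /B' ifN//.
    by apply: contraNneq mJ => <-.
  have h1 := IH (m |` J)%fset QJm E B' mE mB'.
  rewrite NB1U// B'J {1}/B' eqxx setIA in h1; rewrite h1.
  have h2 := IH J QJ E B mE mB; rewrite -/A in h2.
  rewrite h2 big_fsetU1//= {1}/B' eqxx muleA [RHS]muleAC; congr (_ * _ * _)%E.
  rewrite big_seq [RHS]big_seq; apply: eq_bigr => j jJ; rewrite /B' ifN//.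
  by apply: contraNneq mJ => <-.
have ind1 (E D : set R) : measurable E -> measurable D ->
    P (square_sum Q m @^-1` E `&` N m @^-1` D)
    = (P (square_sum Q m @^-1` E) * distribution P (N m) D)%E.
  move=> mE mD.
  have mQ j : j \in [fset m]%fset -> (m <= j)%N || ~~ Q j.
    by rewrite inE => /eqP ->; rewrite leqnn.
  have := IH [fset m]%fset mQ E (fun=> D) mE (fun=> mD).
  by rewrite /NB set_fset1 bigcap_set1 big_seq_fset1.
rewrite -[LHS]/(muA (square_sum Q m.+1 @^-1` C)) !PE.
rewrite (ge0_integral_joint_law (nu := distribution P (N m)) _ mF F0); last exact: indA.
rewrite (ge0_integral_joint_law (nu := distribution P (N m)) _ mF F0); last exact: ind1.
pose G x := (\int[distribution P (N m)]_y F (x, y))%E.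
have mG : measurable_fun setT G by exact: measurable_fun_fubini_tonelli_F.
have G0 x : (0 <= G x)%E by exact: integral_ge0.
have c0 : 0 <= fine (P A) by rewrite fine_ge0.
have PAE : P A = (\prod_(j <- J) P (N j @^-1` B j))%E by exact: N_indep.
(* By the induction hypothesis the sum has, under the restricted measure, P(A) times its law under
   P. *)
transitivity (\int[mscale (NngNum c0) (distribution P (square_sum Q m))]_x G x)%E.
  rewrite -(@ge0_integral_pushforward _ _ _ _ _ _ (measurable_square_sum Q m) muA setT G)//.
  apply: eq_measure_integral => E mE _.
  rewrite /pushforward /muA/= /mfrestr/= /mrestr.
  by rewrite /pushforward IH// -PAE /mscale/= fineK ?fin_num_measure// muleC.
rewrite ge0_integral_mscale//= fineK ?fin_num_measure// PAE muleC.
by rewrite ge0_integral_distribution.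
Qed.

Lemma square_sum_indep1 (Q : pred nat) m k : (m <= k)%N || ~~ Q k ->
  forall E D, measurable E -> measurable D ->
    P (square_sum Q m @^-1` E `&` N k @^-1` D)
    = (P (square_sum Q m @^-1` E) * distribution P (N k) D)%E.
Proof.
move=> mk E D mE mD.
have mQ j : j \in [fset k]%fset -> (m <= j)%N || ~~ Q j.
  by rewrite inE => /eqP ->.
have := square_sum_indep mQ mE (fun=> mD).
by rewrite /NB set_fset1 bigcap_set1 big_seq_fset1.
Qed.

Hypothesis lam_ge0 : forall j, 0 <= lam j.

Local Notation S := (square_sum predT).

Lemma square_sumS m w : S m.+1 w = S m w + lam m * N m w ^+ 2.
Proof. by rewrite /square_sum big_ord_recr. Qed.

Lemma square_sum_ge0 Q m w : 0 <= square_sum Q m w.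
Proof. by apply: sumr_ge0 => j _; apply: mulr_ge0 => //; exact: sqr_ge0. Qed.

Lemma nondecreasing_square_sum w : nondecreasing_seq (S ^~ w).
Proof.
apply/nondecreasing_seqP => m; rewrite square_sumS lerDl.
by apply: mulr_ge0 => //; exact: sqr_ge0.
Qed.

Lemma square_sum_laplace (t : R) m : 0 <= t ->
  (\int[P]_w (expR (- (t * S m w)))%:E =
   (expR (- \sum_(j < m) ln (1 + 2 * t * lam j) / 2))%:E)%E.
Proof.
move=> t0; elim: m => [|m IH].
  rewrite big_ord0 oppr0 expR0.
  under eq_integral do rewrite /square_sum big_ord0 mulr0 oppr0 expR0.
  exact: integral_setT_cst.
pose F (z : R * R) : \bar R :=
  ((expR (- (t * z.1)))%:E * (expR (- (t * lam m * z.2 ^+ 2)))%:E)%E.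
have mE (c : R) d1 (T1 : measurableType d1) (f : T1 -> R) : measurable_fun setT f ->
    measurable_fun setT (fun z => expR (- (c * f z))).
  by move=> mf; apply: measurableT_comp => //; apply: measurableT_comp => //; exact: measurable_funM.
have mF : measurable_fun [set: R * R] F.
  apply: emeasurable_funM; apply/measurable_EFinP; apply: mE => //.
  exact: measurable_funX.
have F0 z : (0 <= F z)%E by rewrite mule_ge0// lee_fin expR_ge0.
transitivity (\int[P]_w F (S m w, N m w))%E.
  by apply: eq_integral => w _; rewrite /F/= square_sumS -EFinM -expRD mulrDr opprD mulrA.
rewrite (ge0_integral_joint_law (nu := distribution P (N m)) _ mF F0); last first.
  by apply: square_sum_indep1; rewrite leqnn.
have mN : measurable_fun setT (fun y : R => (expR (- (t * lam m * y ^+ 2)))%:E).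
  by apply/measurable_EFinP; apply: mE; exact: measurable_funX.
have FE x : (\int[distribution P (N m)]_y F (x, y) =
   (expR (- (t * x)))%:E * (expR (- (ln (1 + 2 * t * lam m) / 2)))%:E)%E.
  rewrite /F/= ge0_integralZl ?lee_fin ?expR_ge0//.
  rewrite ge0_integral_distribution//.
  rewrite [X in (_ * X)%E](@ge0_integral_standard_normal (N m) _ (N_normal m) mN)//.
  by rewrite normal_square_laplace ?mulr_ge0// mulrA.
under eq_integral do rewrite FE.
rewrite ge0_integralZr//; last by apply/measurable_EFinP; apply: mE.
by rewrite IH -EFinM -expRD -opprD big_ord_recr.
Qed.

(** Freezing all variables except N j0 leaves a shifted window for a single Gaussian square, and
    that bound does not depend on the shift. *)
Lemma square_sum_window (j0 m : nat) (y h : R) : (j0 < m)%N -> 0 < lam j0 ->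
  0 <= h ->
  (P [set w | (y < S m w <= y + h)%R] <= (window_bound (lam j0) h)%:E)%E.
Proof.
move=> j0m lam0 h0.
have SE w : S m w = square_sum (predC1 j0) m w + lam j0 * N j0 w ^+ 2.
  by rewrite /square_sum (bigD1 (Ordinal j0m))//= addrC.
pose C : set R := `]y, y + h]%classic.
have mC : measurable C by exact: measurable_itv.
pose F (z : R * R) : \bar R := (\1_C (z.1 + lam j0 * z.2 ^+ 2))%:E.
have mF : measurable_fun [set: R * R] F.
  apply/measurable_EFinP; apply: measurableT_comp; first exact: measurable_indic.
  apply: measurable_funD => //; apply: measurable_funM => //.
  exact: measurable_funX.
have F0 z : (0 <= F z)%E by rewrite lee_fin indicE.
have -> : [set w | (y < S m w <= y + h)%R] = S m @^-1` C.
  by apply/seteqP; split => w /=; rewrite /C /= in_itv.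
have mS : measurable (S m @^-1` C) by exact: measurable_funPTI.
rewrite -[in leLHS](setIT (S m @^-1` C)) -integral_indic//.
rewrite (_ : (\int[P]_x _)%E = (\int[P]_w F (square_sum (predC1 j0) m w, N j0 w))%E); last first.
  apply: eq_integral => w _; rewrite /F /= -SE !indicE.
  have -> : (w \in S m @^-1` C) = (S m w \in C); last by [].
  by apply/idP/idP; rewrite !inE.
rewrite (ge0_integral_joint_law (nu := distribution P (N j0)) _ mF F0); last first.
  by apply: square_sum_indep1; rewrite /= eqxx orbT.
apply: (@le_trans _ _ (\int[P]_w (cst (window_bound (lam j0) h)%:E w))%E); last first.
  by rewrite integral_setT_cst.
apply: ge0_le_integral => //.
- by move=> x _; exact: integral_ge0.
- have mG := @measurable_fun_fubini_tonelli_F _ _ _ _ _ (distribution P (N j0)) F mF F0.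
  by apply: (measurableT_comp mG); exact: measurable_square_sum.
- move=> w _; rewrite [leLHS]/=; set s := square_sum _ _ w.
  pose D := [set x : R | (y - s < lam j0 * x ^+ 2 <= y - s + h)%R].
  have DE : D = (fun x => s + lam j0 * x ^+ 2) @^-1` C.
    by apply/seteqP; split => x; rewrite /D/C/= in_itv/= ltrBlDl addrAC lerBrDl.
  have mD : measurable D.
    rewrite DE -[X in measurable X]setTI.
    have mf : measurable_fun setT (fun x : R => s + lam j0 * x ^+ 2).
      by apply: measurable_funD => //; apply: measurable_funM.
    exact: (mf measurableT).
  have -> : (\int[distribution P (N j0)]_y0 F (s, y0) = distribution P (N j0) D)%E.
    rewrite -[in RHS](setIT D) -integral_indic//.
    apply: eq_integral => x _; rewrite /F/= !indicE DE.
    have -> : (x \in (fun x => s + lam j0 * x ^+ 2) @^-1` C) = (s + lam j0 * x ^+ 2 \in C); last by [].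
    by apply/idP/idP; rewrite !inE.
  by rewrite N_normal//; exact: normal_square_window.
Qed.

Local Notation V := (weighted_chi2 lam N).

Lemma weighted_chi2_le w (x : R) :
  (V w <= x%:E)%E <-> forall m, S m w <= x.
Proof.
have E m : (\sum_(0 <= i < m) (lam i * N i w ^+ 2)%:E)%E = (S m w)%:E.
  by rewrite sumEFin big_mkord.
have t0 i : (0 <= (lam i * N i w ^+ 2)%:E)%E.
  by rewrite lee_fin; apply: mulr_ge0 => //; exact: sqr_ge0.
split=> [h m|h].
  rewrite -lee_fin -E; apply: le_trans h.
  by apply: nneseries_lim_ge => i _ _; exact: t0.
apply: lime_le; first by apply: is_cvg_nneseries => i _ _; exact: t0.
by apply: nearW => m; rewrite E lee_fin.
Qed.

(* The distribution function of the possibly infinite sum V is studied through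
   exp(-V), which lies in [0, 1] and is determined by its moments. *)
Definition exp_chi2 w : R := limn (fun m => expR (- S m w)).

Lemma exp_chi2_nonincreasing w : nonincreasing_seq (fun m => expR (- S m w)).
Proof. by move=> m n mn; rewrite ler_expR lerN2; exact: nondecreasing_square_sum. Qed.

Lemma exp_chi2_cvg w : expR (- S m w) @[m --> \oo] --> exp_chi2 w.
Proof.
apply: nonincreasing_is_cvgn; first exact: exp_chi2_nonincreasing.
by exists 0 => _ [m _ <-]; exact: expR_ge0.
Qed.

Lemma exp_chi2_itv w : 0 <= exp_chi2 w <= 1.
Proof.
apply/andP; split.
  apply: limr_ge; first by apply/cvg_ex; exists (exp_chi2 w); exact: exp_chi2_cvg.
  by apply: nearW => m; exact: expR_ge0.
apply: limr_le; first by apply/cvg_ex; exists (exp_chi2 w); exact: exp_chi2_cvg.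
by apply: nearW => m; rewrite -expR0 ler_expR oppr_le0 square_sum_ge0.
Qed.

Lemma measurable_exp_square_sum m : measurable_fun setT (fun w => expR (- S m w)).
Proof.
apply: measurableT_comp => //; apply: measurable_funN; exact: measurable_square_sum.
Qed.

Lemma measurable_exp_chi2 : measurable_fun setT exp_chi2.
Proof.
apply: (@measurable_fun_cvg _ _ _ _ (fun m w => expR (- S m w))) => //.
  move=> m; exact: measurable_exp_square_sum.
by move=> w _; exact: exp_chi2_cvg.
Qed.

Lemma weighted_chi2_exp w (x : R) :
  (V w <= x%:E)%E <-> expR (- x) <= exp_chi2 w.
Proof.
rewrite weighted_chi2_le; split=> [h|h m].
  apply: limr_ge; first by apply/cvg_ex; exists (exp_chi2 w); exact: exp_chi2_cvg.
  by apply: nearW => m; rewrite ler_expR lerN2.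
rewrite -lerN2 -ler_expR; apply: le_trans h _.
apply: (nonincreasing_cvgn_ge (@exp_chi2_nonincreasing w)).
by apply/cvg_ex; exists (exp_chi2 w); exact: exp_chi2_cvg.
Qed.

Lemma exp_chi2_moment (k : nat) :
  (expR (- \sum_(j < m) ln (1 + 2 * k%:R * lam j) / 2))%:E @[m --> \oo]
  --> (\int[P]_w (exp_chi2 w ^+ k)%:E)%E.
Proof.
have E m : (expR (- \sum_(j < m) ln (1 + 2 * k%:R * lam j) / 2))%:E =
    (\int[P]_w (expR (- S m w) ^+ k)%:E)%E.
  rewrite -square_sum_laplace//; apply: eq_integral => w _.
  by rewrite -expRM_natl mulrN.
under eq_fun do rewrite E.
have me m : measurable_fun setT (fun w => (expR (- S m w) ^+ k)%:E).
  apply/measurable_EFinP; apply: measurable_funX.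
  exact: measurable_exp_square_sum.
have mU : measurable_fun setT (fun w => (exp_chi2 w ^+ k)%:E).
  by apply/measurable_EFinP; apply: measurable_funX; exact: measurable_exp_chi2.
have int1 : P.-integrable setT (cst 1%:E).
  exact: finite_measure_integrable_cst.
suff [cv bd] : {ae P, forall w, setT w -> (expR (- S m w) ^+ k)%:E @[m --> \oo] --> (exp_chi2 w ^+ k)%:E} /\
    {ae P, forall w m, setT w -> (`|(expR (- S m w) ^+ k)%:E| <= cst 1%:E w)%E}.
  by have [_ _] := dominated_convergence measurableT me mU cv int1 bd.
split.
- apply: aeW => w _; apply: cvg_EFin; first by apply: nearW.
  have := @exp_chi2_cvg w; move: (exp_chi2 w) => u cu.
  elim: k {E me mU} => [|k IH]; first by under eq_fun do rewrite expr0; exact: cvg_cst.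
  by under eq_fun do rewrite exprS; rewrite exprS; exact: cvgM.
- apply: aeW => w m _; rewrite lee_fin ger0_norm ?exprn_ge0 ?expR_ge0//.
  rewrite exprn_ile1 ?expR_ge0//.
  by rewrite -expR0 ler_expR oppr_le0 square_sum_ge0.
Qed.

Definition chi2_cdf (x : R) := P [set w | (V w <= x%:E)%E].

Lemma measurable_chi2_le (x : R) : measurable [set w | (V w <= x%:E)%E].
Proof.
have -> : [set w | (V w <= x%:E)%E] = exp_chi2 @^-1` `[expR (- x), +oo[%classic.
  by apply/seteqP; split => w /=; rewrite in_itv/= andbT => /weighted_chi2_exp.
rewrite -[X in measurable X]setTI; apply: measurable_exp_chi2 => //.
Qed.

(** The event y < V <= y + h is the increasing union of the events D m, on which the partial sum
    already exceeds y; for m > j0 each lies in a window of a finite sum. *)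
Lemma chi2_cdf_window (j0 : nat) (y h : R) : 0 < lam j0 -> 0 <= h ->
  (chi2_cdf (y + h) <= chi2_cdf y + (window_bound (lam j0) h)%:E)%E.
Proof.
move=> lam0 h0; rewrite /chi2_cdf.
set A := [set w | (V w <= (y + h)%:E)%E].
set B := [set w | (V w <= y%:E)%E].
have mA : measurable A by exact: measurable_chi2_le.
have mB : measurable B by exact: measurable_chi2_le.
have mD (x : R) m : measurable [set w | x < S m w].
  have -> : [set w | x < S m w] = S m @^-1` `]x, +oo[%classic.
    by apply/seteqP; split => w /=; rewrite in_itv/= andbT.
  by apply: measurable_funPTI; exact: measurable_itv.
pose D m := A `&` [set w | y < S m w].
have mDm m : measurable (D m) by exact: measurableI.
have DU : A `\` B = \bigcup_m D m.
  apply/seteqP; split => w.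
    move=> [Aw /= nB].
    have [m ym] : exists m, y < S m w.
      apply/not_existsP => nm; apply: nB; apply/weighted_chi2_le => m.
      by rewrite leNgt; apply/negP/nm.
    by exists m.
  move=> [m _ [Aw ym]]; split => // /weighted_chi2_le /(_ m).
  by rewrite leNgt ym.
have cD : P (D m) @[m --> \oo] --> P (A `\` B).
  rewrite DU; apply: nondecreasing_cvg_mu => //.
    exact: bigcup_measurable.
  move=> m n mn; apply/subsetPset => w [Aw ym]; split => //=.
  by apply: lt_le_trans ym _; exact: nondecreasing_square_sum.
have AB : A = (A `&` B) `|` (A `\` B) by rewrite setUIDK.
rewrite AB measureU//; last 3 first.
- exact: measurableI.
- exact: measurableD.
- by rewrite setDE setIACA setICr setI0.
apply: leeD; first by apply: le_measure; rewrite ?inE//; exact: measurableI.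
apply: (cvge_to_le cD).
exists j0.+1 => // m /= jm.
apply: le_trans (square_sum_window y jm lam0 h0).
apply: le_measure; rewrite ?inE//.
  have -> : [set w | (y < S m w <= y + h)%R] = S m @^-1` `]y, y + h]%classic.
    by apply/seteqP; split => w /=; rewrite in_itv.
  by apply: measurable_funPTI; exact: measurable_itv.
by move=> w [/weighted_chi2_le /(_ m) /= -> ->].
Qed.

Lemma chi2_cdf_neg (x : R) : x < 0 -> chi2_cdf x = 0%E.
Proof.
move=> x0; rewrite /chi2_cdf; rewrite (_ : [set w | _] = set0) ?measure0//.
apply/seteqP; split => w //= /weighted_chi2_le /(_ 0%N).
by rewrite /square_sum big_ord0 leNgt x0.
Qed.

(** Chernoff-type bound: E exp(-t S) <= P(S <= x) + exp(-t x), while ln(1 + y) <= y bounds the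
    Laplace transform below by exp(-t M). It shows that no mass of V escapes to infinity. *)
Lemma chi2_cdf_ge (M t x : R) : (forall m : nat, \sum_(j < m) lam j <= M) ->
  0 <= t -> ((expR (- (t * M)) - expR (- (t * x)))%:E <= chi2_cdf x)%E.
Proof.
move=> hM t0.
have mE m : measurable (S m @^-1` `]-oo, x]%classic) by apply: measurable_funPTI; exact: measurable_itv.
have EE : [set w | (V w <= x%:E)%E] = \bigcap_m S m @^-1` `]-oo, x]%classic.
  apply/seteqP; split => w /=.
    by move=> /weighted_chi2_le h m _ /=; rewrite in_itv/=.
  by move=> h; apply/weighted_chi2_le => m; have := h m I; rewrite /= in_itv.
have cE : P (S m @^-1` `]-oo, x]%classic) @[m --> \oo] --> chi2_cdf x.
  rewrite /chi2_cdf EE; apply: nonincreasing_cvg_mu => //.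
  - by rewrite ltey_eq fin_num_measure.
  - exact: bigcap_measurable.
  - move=> m n mn; apply/subsetPset => w /=; rewrite !in_itv/=.
    by apply: le_trans; exact: nondecreasing_square_sum.
apply: (cvge_to_ge cE).
apply: nearW => m.
have mexp : measurable_fun setT (fun w => expR (- (t * S m w))).
  apply: measurableT_comp => //; apply: measurableT_comp => //.
  by apply: measurable_funM => //; exact: measurable_square_sum.
have : (\int[P]_w (expR (- (t * S m w)))%:E <=
   \int[P]_w (\1_(S m @^-1` `]-oo, x]%classic) w + expR (- (t * x)))%:E)%E.
  apply: ge0_le_integral => //.
  - exact/measurable_EFinP.
  - by apply/measurable_EFinP; apply: measurable_funD => //; exact: measurable_indic.
  - move=> w _; rewrite lee_fin indicE.
    have [h|h] := leP (S m w) x.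
      rewrite mem_set/= ?in_itv//=; apply: (@le_trans _ _ 1).
        by rewrite -expR0 ler_expR oppr_le0 mulr_ge0// square_sum_ge0.
      by rewrite lerDl expR_ge0.
    rewrite ler_wpDl// ler_expR lerN2; apply: ler_wpM2l => //; exact: ltW.
rewrite square_sum_laplace//.
under eq_integral do rewrite EFinD.
rewrite ge0_integralD//.
  rewrite integral_indic// setIT integral_setT_cst.
  move=> h; rewrite EFinB leeBlDr//; apply: le_trans h.
  rewrite lee_fin ler_expR lerN2.
  have : \sum_(j < m) ln (1 + 2 * t * lam j) / 2 <= \sum_(j < m) t * lam j.
    apply: ler_sum => j _; rewrite ler_pdivrMr//.
    have tl : 0 <= t * lam j by exact: mulr_ge0.
    by have := le_ln1Dx (x := 2 * t * lam j); rewrite mulrAC -mulrA; lra.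
  by rewrite -mulr_sumr => /le_trans; apply; exact: ler_wpM2l.
by apply/measurable_EFinP; exact: measurable_indic.
Qed.

End weighted_squares.

(** * From moments to distribution functions *)

Section test_function.
Context {R : realType}.

(* Approximates the indicator of u >= exp(-x) when b is of the order of exp(a x)
   and a is large. *)
Definition test_poly (a b : nat) : {poly R} := 1 - (1 - 'X^a) ^+ b.

Lemma test_polyE a b u : (test_poly a b).[u] = 1 - (1 - u ^+ a) ^+ b.
Proof. by rewrite /test_poly !hornerE. Qed.

Definition test_exp (a : nat) (x : R) := (Num.truncn (expR (a%:R * x))).+1.

Lemma test_poly_itv a b (u : R) : 0 <= u <= 1 -> 0 <= (test_poly a b).[u] <= 1.
Proof.
move=> /andP[u0 u1]; rewrite test_polyE.
have h0 : 0 <= 1 - u ^+ a by rewrite subr_ge0 exprn_ile1.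
have h1 : 1 - u ^+ a <= 1 by rewrite gerBl exprn_ge0.
by rewrite gerBl exprn_ge0// andbT subr_ge0 exprn_ile1.
Qed.

(** Here b u^a >= exp(a eta), and (1 - u^a)^b <= exp(-b u^a). *)
Lemma test_poly_ge a (x eta u : R) : u <= 1 ->
  expR (- (x - eta)) <= u ->
  1 - expR (- (a%:R * eta)) <= (test_poly a (test_exp a x)).[u].
Proof.
move=> u1 xu; have u0 : 0 <= u by exact: le_trans (expR_ge0 _) xu.
rewrite test_polyE lerD2l lerN2.
have ua : expR (- (a%:R * (x - eta))) <= u ^+ a.
  by rewrite -mulrN expRM_natl; apply: lerXn2r; rewrite ?nnegrE ?expR_ge0.
have h0 : 0 <= 1 - u ^+ a by rewrite subr_ge0 exprn_ile1.
set b := test_exp a x.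
have bx : expR (a%:R * x) <= b%:R by exact/ltW/truncnS_gt.
apply: (@le_trans _ _ (expR (- (b%:R * u ^+ a)))).
  rewrite -mulrN expRM_natl; apply: lerXn2r; rewrite ?nnegrE ?expR_ge0//.
  by have := expR_ge1Dx (- u ^+ a).
have by_ : expR (a%:R * eta) <= b%:R * u ^+ a.
  apply: le_trans (ler_pM (expR_ge0 _) (expR_ge0 _) bx ua).
  by rewrite -expRD ler_expR; lra.
apply: (@le_trans _ _ (expR (- expR (a%:R * eta)))); first by rewrite ler_expR lerN2.
rewrite !expRN lef_pV2 ?posrE ?expR_gt0//.
by apply: le_trans (expR_ge1Dx _); rewrite lerDr.
Qed.

(** Bernoulli's inequality bounds the polynomial by b u^a. The factor 2 is the rounding in b, at
    most a doubling because exp(a x) >= 1 for x >= 0. *)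
Lemma test_poly_le a (x eta u : R) : 0 <= x -> 0 <= u <= 1 ->
  u <= expR (- (x + eta)) ->
  (test_poly a (test_exp a x)).[u] <= 2 * expR (- (a%:R * eta)).
Proof.
move=> x0 /andP[u0 u1] ux; rewrite test_polyE.
have ua : u ^+ a <= expR (- (a%:R * (x + eta))).
  by rewrite -mulrN expRM_natl; apply: lerXn2r; rewrite ?nnegrE ?expR_ge0.
set b := test_exp a x.
have bx : b%:R <= 2 * expR (a%:R * x).
  have e1 : 1 <= expR (a%:R * x) by rewrite -expR0 ler_expR mulr_ge0.
  have : (Num.truncn (expR (a%:R * x)))%:R <= expR (a%:R * x) by rewrite truncn_le ?expR_ge0.
  by rewrite /b /test_exp -natr1; lra.
have bern (v : R) k : 0 <= v <= 1 -> 1 - (1 - v) ^+ k <= k%:R * v.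
  move=> /andP[v0 v1]; elim: k => [|k IH]; first by rewrite expr0 mul0r subrr.
  have hk : 0 <= (1 - v) ^+ k <= 1.
    by rewrite exprn_ge0 ?exprn_ile1 ?subr_ge0// gerBl.
  rewrite exprS -natr1; move: hk IH; move: ((1 - v) ^+ k) => y; nra.
apply: le_trans (bern _ _ _) _; first by rewrite exprn_ge0 ?exprn_ile1.
apply: le_trans (ler_pM _ _ bx ua) _ => //; first by rewrite exprn_ge0.
by rewrite -mulrA -expRD ler_pM2l// ler_expR; lra.
Qed.

End test_function.

Section moment_convergence.
Context (R : realType).

Lemma integrable_addR d (T : measurableType d) (P : probability T R) (f g : T -> R) :
  P.-integrable setT (EFin \o f) -> P.-integrable setT (EFin \o g) ->
  P.-integrable setT (EFin \o (fun w => f w + g w)).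
Proof.
move=> fi gi; have := integrableD measurableT fi gi.
by congr (_.-integrable _ _); apply/funext => w /=; rewrite EFinD.
Qed.

Lemma Rintegral_indic d (T : measurableType d) (P : probability T R) A :
  measurable A -> \int[P]_w \1_A w = fine (P A).
Proof. by move=> mA; rewrite /Rintegral integral_indic// setIT. Qed.

Lemma measurable_horner (p : {poly R}) d (T : measurableType d) (U : T -> R) :
  measurable_fun setT U -> measurable_fun setT (fun w => p.[U w]).
Proof.
move=> mU; under eq_fun do rewrite horner_coef.
apply: measurable_sum => i; apply: measurable_funM => //.
exact: measurable_funX.
Qed.

Lemma moment_poly_cvg d (T : measurableType d) (P : probability T R)
  d' (T' : measurableType d') (P' : probability T' R)
  (U : nat -> T -> R) (V : T' -> R) :
  (forall n, measurable_fun setT (U n)) -> measurable_fun setT V ->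
  (forall n w, 0 <= U n w <= 1) -> (forall w, 0 <= V w <= 1) ->
  (forall k, \int[P]_w (U n w ^+ k) @[n --> \oo] --> \int[P']_w (V w ^+ k)) ->
  forall p : {poly R}, \int[P]_w p.[U n w] @[n --> \oo] --> \int[P']_w p.[V w].
Proof.
move=> mU mV U01 V01 UV p.
have E e (S : measurableType e) (Q : probability S R) (X : S -> R) :
    measurable_fun setT X -> (forall w, 0 <= X w <= 1) ->
    \int[Q]_w p.[X w] = \sum_(i < size p) p`_i * \int[Q]_w (X w ^+ i).
  move=> mX X01.
  have iX i : Q.-integrable setT (EFin \o (fun w => X w ^+ i)).
    apply: (@bounded_integrable _ _ _ Q _ 1); first exact: measurable_funX.
    move=> w; have /andP[x0 x1] := X01 w.
    by rewrite ger0_norm ?exprn_ge0// exprn_ile1.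
  under eq_Rintegral do rewrite horner_coef.
  rewrite Rintegral_sum; last first.
    move=> i; apply: (@bounded_integrable _ _ _ Q _ `|p`_i|).
      by apply: measurable_funM => //; exact: measurable_funX.
    move=> w; have /andP[x0 x1] := X01 w.
    by rewrite normrM ler_piMr// ger0_norm ?exprn_ge0// exprn_ile1.
  by apply: eq_bigr => i _; rewrite RintegralZl.
rewrite E//; under eq_fun do rewrite E//.
by apply: cvg_big => [|i _]; first exact: add_continuous; apply: cvgM => //; exact: cvg_cst.
Qed.

(** The threshold x + eta lies in the middle of the gap: with r = exp(-a eta), the polynomial is at
    least 1 - r where U >= exp(-x) and at most 2 r where V < exp(-(x + 2 eta)). Exchanging the two
    laws gives the converse comparison. *)
Lemma cdf_compare d (T : measurableType d) (P : probability T R)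
  d' (T' : measurableType d') (P' : probability T' R)
  (U : T -> R) (V : T' -> R) (a : nat) (x eta : R) :
  measurable_fun setT U -> measurable_fun setT V ->
  (forall w, 0 <= U w <= 1) -> (forall w, 0 <= V w <= 1) -> 0 <= x -> 0 <= eta ->
  fine (P [set w | expR (- x) <= U w]) <=
  fine (P' [set w | expR (- (x + 2 * eta)) <= V w]) + 3 * expR (- (a%:R * eta))
  + (\int[P]_w (test_poly a (test_exp a (x + eta))).[U w]
     - \int[P']_w (test_poly a (test_exp a (x + eta))).[V w]).
Proof.
move=> mU mV U01 V01 x0 eta0; set f := test_poly _ _.
have mset e (S : measurableType e) (X : S -> R) (c : R) : measurable_fun setT X ->
    measurable [set w | c <= X w].
  move=> mX; rewrite -[X in measurable X]setTI.
  exact: measurable_fun_le.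
set A := [set w | _ <= U w]; set B := [set w | _ <= V w].
have mA : measurable A by exact: mset.
have mB : measurable B by exact: mset.
have iI e (S : measurableType e) (Q : probability S R) (C : set S) : measurable C ->
    Q.-integrable setT (EFin \o (\1_C : S -> R)).
  move=> mC; apply: (@bounded_integrable _ _ _ Q _ 1) => // w.
  by rewrite indicE; case: (_ \in _); rewrite ?normr1 ?normr0.
have iF e (S : measurableType e) (Q : probability S R) (X : S -> R) :
    measurable_fun setT X -> (forall w, 0 <= X w <= 1) ->
    Q.-integrable setT (EFin \o (fun w => f.[X w])).
  move=> mX X01; apply: (@bounded_integrable _ _ _ Q _ 1); first exact: measurable_horner.
  by move=> w; have /andP[? ?] := @test_poly_itv _ a (test_exp a (x + eta)) _ (X01 w); rewrite ger0_norm.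
have iC e (S : measurableType e) (Q : probability S R) (c : R) :
    Q.-integrable setT (EFin \o (fun _ : S => c)).
  by apply: (@bounded_integrable _ _ _ Q _ `|c|).
set r := expR (- (a%:R * eta)).
have h1 : fine (P A) <= \int[P]_w f.[U w] + r.
  rewrite -Rintegral_indic// -[X in _ <= _ + X](Rintegral_setT_cst P) -RintegralD; [|by []|exact: iF|exact: iC].
  apply: le_Rintegral => //.
  - exact: iI.
  - by apply: integrable_addR; [exact: iF|exact: iC].
  move=> w _; rewrite indicE; case: (boolP (w \in A)) => [|_].
    rewrite inE => Aw; rewrite -lerBlDr; apply: test_poly_ge.
      by have /andP[] := U01 w.
    by rewrite addrK.
  by rewrite addr_ge0 ?expR_ge0//; have /andP[] := @test_poly_itv _ a (test_exp a (x + eta)) _ (U01 w).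
have h2 : \int[P']_w f.[V w] <= fine (P' B) + 2 * r.
  rewrite -Rintegral_indic// -[X in _ <= _ + X](Rintegral_setT_cst P') -RintegralD; [|by []|exact: iI|exact: iC].
  apply: le_Rintegral => //.
  - exact: iF.
  - by apply: integrable_addR; [exact: iI|exact: iC].
  move=> w _; rewrite indicE; case: (boolP (w \in B)) => [|].
    rewrite inE => Bw; apply: (@le_trans _ _ 1).
      by have /andP[] := @test_poly_itv _ a (test_exp a (x + eta)) _ (V01 w).
    by rewrite lerDl mulr_ge0// expR_ge0.
  rewrite notin_setE /B/= => /negP; rewrite -ltNge => wB.
  rewrite add0r; apply: test_poly_le => //; first exact: addr_ge0.
  by apply: ltW; move: wB; congr (_ < expR (- _)); lra.
lra.
Qed.

(** Polya's argument: comparison on a finite grid, monotonicity between grid points, uniform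
    continuity of G to undo the shifts, and tightness of G beyond the grid. *)
Lemma uniform_cdf_cvg (F : nat -> R -> R) (G : R -> R) :
  (forall n, {homo F n : x y / x <= y}) -> {homo G : x y / x <= y} ->
  (forall n x, 0 <= F n x <= 1) -> (forall x, 0 <= G x <= 1) ->
  (forall n x, x < 0 -> F n x = 0) -> (forall x, x < 0 -> G x = 0) ->
  (forall e, 0 < e -> exists2 h, 0 < h & forall y, G (y + h) <= G y + e) ->
  (forall e, 0 < e -> exists x, 1 - e <= G x) ->
  (forall x h e : R, 0 <= x -> 0 < h -> 0 < e -> \forall n \near \oo,
     F n x <= G (x + h) + e /\ G x <= F n (x + h) + e) ->
  forall e, 0 < e -> \forall n \near \oo, forall x, `|F n x - G x| <= e.
Proof.
move=> Fnd Gnd F01 G01 Fneg Gneg Gcont G1 FG e' e'0.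
pose e := e' / 3; have e0 : 0 < e by rewrite divr_gt0.
have [h h0 Gh] := Gcont e e0.
have [X GX] := G1 e e0.
(* The last but one grid point must already lie beyond X, because the comparison at the end of the
   grid loses one mesh. *)
pose K := (Num.truncn (`|X| / h)).+2.
have KX : X <= K.-1%:R * h.
  rewrite -ler_pdivrMr//; apply: le_trans (ltW (truncnS_gt _)).
  by rewrite ler_pM2r ?invr_gt0// ler_norm.
pose x_ (i : nat) := i%:R * h.
have xS i : x_ i.+1 = x_ i + h by rewrite /x_ -natr1 mulrDl mul1r.
have x_ge0 i : 0 <= x_ i by rewrite mulr_ge0 ?(ltW h0).
have grid : \forall n \near \oo, forall i : 'I_K.+1,
    F n (x_ i) <= G (x_ i + h) + e /\ G (x_ i) <= F n (x_ i + h) + e.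
  by apply: filter_forall => i; exact: FG.
apply: filterS grid => n grid x.
have g i : (i <= K)%N -> F n (x_ i) <= G (x_ i.+1) + e /\ G (x_ i) <= F n (x_ i.+1) + e.
  by rewrite -ltnS => iK; rewrite xS; exact: (grid (Ordinal iK)).
have [x0|x0] := ltP x 0.
  by rewrite Fneg// Gneg// subrr normr0 ltW.
pose i := Num.truncn (x / h).
have xi : x_ i <= x by rewrite /x_ -ler_pdivlMr// truncn_le// divr_ge0// ltW.
have xi1 : x <= x_ i.+1 by rewrite /x_ -ler_pdivrMr//; exact/ltW/truncnS_gt.
have e3 : e' = e + e + e by rewrite /e; field.
have [Fx0 Fx1] := andP (F01 n x); have [Gx0 Gx1] := andP (G01 x).
have Gi k : G (x_ k.+1) <= G (x_ k) + e by rewrite xS.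
have [iK|Ki] := ltnP i K.
  have [f1 _] := g _ iK.
  have up : F n x <= G x + e'.
    have := Fnd n _ _ xi1; have := Gnd _ _ xi; have := Gi i; have := Gi i.+1; lra.
  have dn : G x <= F n x + e'.
    (* In the first cell no grid point precedes; there G is at most 2 e since it vanishes at -h. *)
    case: i xi xi1 iK {f1 up} => [|j] xj xj1 jK.
      have := Gnd _ _ xj1; have := Gh (- h); have := Gi 0%N.
      rewrite addNr (Gneg (- h)) ?oppr_lt0// {1 2}/x_ mul0r; lra.
    have [_ g2] := g j (ltnW (ltnW jK)).
    have := Fnd n _ _ xj; have := Gnd _ _ xj1; have := Gi j; have := Gi j.+1; lra.
  by rewrite ler_norml; lra.
have xK : x_ K <= x by apply: le_trans xi; rewrite /x_ ler_pM2r// ler_nat.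
have [_ g2] := g K.-1 (leq_pred K).
have h1 := Fnd n _ _ xK; have h2 := Gnd _ _ KX.
have h3 : X <= x by apply: le_trans xK; rewrite xS; apply: le_trans KX _; rewrite lerDl ltW.
have h4 := Gnd _ _ h3.
by rewrite ler_norml; rewrite /K/= -/K in g2; lra.
Qed.

End moment_convergence.

(** * Hilbert space and spectral decomposition *)

Section l2_facts.
Context {R : realType}.
Implicit Types (x y z : l2 R).

Lemma l2_dotDr x y z : l2_dot x (y + z) = l2_dot x y + l2_dot x z.
Proof. by rewrite !(l2_dotC x) l2_dotDl. Qed.

Lemma l2_dotZr a x z : l2_dot x (a *: z) = a * l2_dot x z.
Proof. by rewrite !(l2_dotC x) l2_dotZl. Qed.

Lemma l2_dot0r x : l2_dot x 0 = 0.
Proof. by rewrite l2_dotC l2_dot0l. Qed.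

Lemma l2_dotNl x z : l2_dot (- x) z = - l2_dot x z.
Proof. by rewrite -scaleN1r l2_dotZl mulN1r. Qed.

Lemma l2_dotNr x z : l2_dot x (- z) = - l2_dot x z.
Proof. by rewrite !(l2_dotC x) l2_dotNl. Qed.

Lemma l2_dot_suml (I : Type) (s : seq I) (F : I -> l2 R) z :
  l2_dot (\sum_(i <- s) F i) z = \sum_(i <- s) l2_dot (F i) z.
Proof.
elim: s => [|i s IH]; first by rewrite !big_nil l2_dot0l.
by rewrite !big_cons l2_dotDl IH.
Qed.

Lemma l2_dot_sumr (I : Type) (s : seq I) (F : I -> l2 R) z :
  l2_dot z (\sum_(i <- s) F i) = \sum_(i <- s) l2_dot z (F i).
Proof. by rewrite l2_dotC l2_dot_suml; apply: eq_bigr => i _; rewrite l2_dotC. Qed.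

Lemma l2_sum_coord (I : Type) (s : seq I) (F : I -> l2 R) k :
  (\sum_(i <- s) F i) k = \sum_(i <- s) F i k.
Proof.
elim: s => [|i s IH]; first by rewrite !big_nil.
by rewrite !big_cons -IH.
Qed.

Lemma l2_norm_sqr x : `|x| ^+ 2 = l2_dot x x.
Proof. by rewrite -[ `|x| ]/(l2_norm x) l2_normE sqr_sqrtr// l2_dot_ge0. Qed.

Lemma l2_dot_cvg x y : \sum_(k < n) x k * y k @[n --> \oo] --> l2_dot x y.
Proof.
have := square_summable_mul (l2_seqP x) (l2_seqP y).
rewrite (_ : (fun n => \sum_(k < n) x k * y k) = series (fun k => x k * y k))//.
by apply/funext => n; rewrite /series/= big_mkord.
Qed.

Lemma l2_coord_norm x k : `|x k| <= `|x|.
Proof.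
rewrite -(@ler_pXn2r _ 2) ?nnegrE// l2_norm_sqr real_normK ?num_real//.
exact: l2_sqr_le_dot.
Qed.

Definition delta_seq (k i : nat) : R := (i == k)%:R.

Lemma delta_seq_summable k : delta_seq k \in square_summable.
Proof.
apply/asboolP/cvg_ex; exists 1; apply: cvg_near_cst.
exists k.+1 => // n /= kn; rewrite /series/= big_mkord (bigD1 (Ordinal kn))//=.
rewrite /delta_seq eqxx expr1n big1 ?addr0// => i ik.
by rewrite -val_eqE/= in ik; rewrite (negbTE ik) expr0n.
Qed.

Definition delta k : l2 R := L2 (delta_seq_summable k).

Lemma l2_dot_delta x k : l2_dot x (delta k) = x k.
Proof.
apply: (cvg_lim (@Rhausdorff R)).
apply: cvg_near_cst.
exists k.+1 => // n /= kn; rewrite /series/= big_mkord (bigD1 (Ordinal kn))//=.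
rewrite /delta_seq eqxx mulr1 big1 ?addr0// => i ik.
by rewrite -val_eqE/= in ik; rewrite (negbTE ik) mulr0.
Qed.

Definition l2_head K x : l2 R := \sum_(k < K) x k *: delta k.

Lemma l2_dot_head K x y : l2_dot (l2_head K x) y = \sum_(k < K) x k * y k.
Proof.
rewrite l2_dot_suml; apply: eq_bigr => k _.
by rewrite l2_dotZl l2_dotC l2_dot_delta.
Qed.

Lemma l2_head_coord K x k : (k < K)%N -> l2_head K x k = x k.
Proof.
move=> kK; rewrite -l2_dot_delta l2_dot_head (bigD1 (Ordinal kK))//=.
rewrite /delta_seq eqxx mulr1 big1 ?addr0// => i ik.
by rewrite -val_eqE/= in ik; rewrite (negbTE ik) mulr0.
Qed.

Lemma l2_tail_sqr K x : l2_dot (x - l2_head K x) (x - l2_head K x)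
  = l2_dot x x - \sum_(k < K) x k ^+ 2.
Proof.
rewrite l2_dotDl !l2_dotDr !l2_dotNl !l2_dotNr (l2_dotC x) !l2_dot_head.
under [in X in _ + (- _ + X)]eq_bigr => k _ do rewrite l2_head_coord//.
by rewrite subrr addr0.
Qed.

Lemma l2_dot_sqr_le x y : l2_dot x y ^+ 2 <= l2_dot x x * l2_dot y y.
Proof.
have := l2_cauchy_schwarz x y; have := l2_cauchy_schwarz (- x) y.
rewrite l2_dotNl -[l2_norm (- x)]/(`|- x|) normrN -[l2_norm y]/(`|y|).
rewrite -[l2_norm x]/(`|x|) => h1 h2.
rewrite -!l2_norm_sqr -exprMn -real_normK ?num_real//.
by apply: lerXn2r; rewrite ?nnegrE ?mulr_ge0// ler_norml; lra.
Qed.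

Lemma l2_dot_eq0 x : l2_dot x x = 0 -> x = 0.
Proof. by rewrite -l2_norm_sqr => /eqP; rewrite sqrf_eq0 normr_eq0 => /eqP. Qed.

(* Orthogonal vectors, each of norm 1 or 0: the zero vectors stand for the entries
   of [lam] that are 0, to which no eigenvector is attached. *)
Definition bessel_system (e : nat -> l2 R) :=
  forall i j, l2_dot (e i) (e j) = l2_dot (e i) (e i) *+ (i == j)
    /\ (l2_dot (e i) (e i) = 0 \/ l2_dot (e i) (e i) = 1).

Lemma bessel_inequality e m z : bessel_system e ->
  \sum_(j < m) l2_dot z (e j) ^+ 2 <= l2_dot z z.
Proof.
move=> be; set s := \sum_(j < m) l2_dot z (e j) *: e j.
have zs : l2_dot z s = \sum_(j < m) l2_dot z (e j) ^+ 2.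
  by rewrite l2_dot_sumr; apply: eq_bigr => j _; rewrite l2_dotZr expr2.
have ss : l2_dot s s = \sum_(j < m) l2_dot z (e j) ^+ 2.
  rewrite l2_dot_suml; apply: eq_bigr => j _.
  rewrite l2_dotZl l2_dot_sumr (bigD1 j)//= big1 => [|i ij]; last first.
    rewrite l2_dotZr; have [-> _] := be j i; rewrite val_eqE eq_sym (negbTE ij).
    by rewrite mulr0n mulr0.
  rewrite addr0 l2_dotZr; have [_ [e0|->]] := be j j; last by rewrite mulr1 expr2.
  by rewrite (l2_dot_eq0 e0) l2_dot0r !mul0r expr0n.
have := l2_dot_ge0 (z - s); rewrite l2_dotDl !l2_dotDr !l2_dotNl !l2_dotNr (l2_dotC s).
by rewrite zs ss; lra.
Qed.

Lemma continuous_coord k : continuous (fun x : l2 R => x k).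
Proof.
move=> x; apply/(@cvgrPdist_le _ _ _ _ (@nbhs_filter _ x)) => e e0; apply/nbhs_ballP; exists e => //= y.
rewrite -ball_normE => /ltW; apply: le_trans; exact: (l2_coord_norm (x - y)).
Qed.

Lemma measurable_coord k : measurable_fun setT (fun x : l2 R => x k).
Proof.
apply: (measurability _ (RGenOInfty.measurableE R)) => // _ [_ [a ->] <-].
rewrite setTI; apply: sub_sigma_algebra.
by apply: open_comp; [move=> x _; exact: continuous_coord|exact: interval_open].
Qed.

End l2_facts.

Section l2_measurable.
Context d (T : measurableType d) (R : realType) (Z : T -> l2 R).
Hypothesis mZ : measurable_fun setT Z.

Lemma measurable_l2_coord k : measurable_fun setT (fun w => Z w k).
Proof. exact: measurableT_comp (@measurable_coord R k) mZ. Qed.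

Lemma measurable_l2_dot u : measurable_fun setT (fun w => l2_dot (Z w) u).
Proof.
apply: (@measurable_fun_cvg _ _ _ _ (fun n w => \sum_(k < n) Z w k * u k)).
  move=> n; apply: measurable_sum => k; apply: measurable_funM => //.
  exact: measurable_l2_coord.
by move=> w _; exact: l2_dot_cvg.
Qed.

Lemma measurable_l2_sqr : measurable_fun setT (fun w => l2_dot (Z w) (Z w)).
Proof.
apply: (@measurable_fun_cvg _ _ _ _ (fun n w => \sum_(k < n) Z w k * Z w k)).
  move=> n; apply: measurable_sum => k; apply: measurable_funM => //;
  exact: measurable_l2_coord.
by move=> w _; exact: l2_dot_cvg.
Qed.

End l2_measurable.

Lemma quad_nonneg {R : realFieldType} (a b c : R) : 0 <= a ->
  (forall t, 0 <= t ^+ 2 * a + 2 * t * b + c) -> b ^+ 2 <= a * c.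
Proof.
rewrite le_eqVlt => /predU1P[<-|a0] h; last first.
  have := mulr_ge0 (ltW a0) (h (- b / a)).
  have -> : a * ((- b / a) ^+ 2 * a + 2 * (- b / a) * b + c) = a * c - b ^+ 2.
    by field; rewrite gt_eqF.
  by rewrite subr_ge0.
have [->|b0] := eqVneq b 0; first by rewrite mul0r expr0n.
have := h (- (c + 1) / (2 * b)).
rewrite (_ : _ + c = -1); first by rewrite lerNr oppr0 ler10.
by field.
Qed.

Lemma ultra_fmap (T U : Type) (f : T -> U) (F : set_system T) :
  UltraFilter F -> UltraFilter (f @ F).
Proof.
move=> UF; apply: Build_UltraFilter => G GP sG.
apply/seteqP; split => A; last exact: sG.
move=> GA; have [//|nA] := in_ultra_setVsetC (f @^-1` A) UF.
have : G (A `&` ~` A) by apply: filterI => //; exact: sG.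
by rewrite setICr => G0; case: (@filter_not_empty _ G GP).
Qed.

(** * Positive forms with uniformly small tails *)

Section positive_form.
Context {R : realType} (C : l2 R -> l2 R -> R).
Hypothesis C_sym : forall u v, C u v = C v u.
Hypothesis C_lin : forall a u v w, C (a *: u + v) w = a * C u w + C v w.
Implicit Types u v w : l2 R.

Lemma bform0l w : C 0 w = 0.
Proof. by have := C_lin 1 0 0 w; rewrite scaler0 add0r; lra. Qed.

Lemma bformDl u v w : C (u + v) w = C u w + C v w.
Proof. by rewrite -[u]scale1r C_lin mul1r scale1r. Qed.

Lemma bformZl a u w : C (a *: u) w = a * C u w.
Proof. by rewrite -[a *: u]addr0 C_lin bform0l addr0. Qed.

Lemma bformNl u w : C (- u) w = - C u w.
Proof. by rewrite -scaleN1r bformZl mulN1r. Qed.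

Lemma bform0r w : C w 0 = 0.
Proof. by rewrite C_sym bform0l. Qed.

Lemma bformDr u v w : C w (u + v) = C w u + C w v.
Proof. by rewrite C_sym bformDl !(C_sym w). Qed.

Lemma bformZr a u w : C w (a *: u) = a * C w u.
Proof. by rewrite C_sym bformZl (C_sym w). Qed.

Lemma bformNr u w : C w (- u) = - C w u.
Proof. by rewrite C_sym bformNl (C_sym w). Qed.

Lemma bform_suml (I : Type) (s : seq I) (F : I -> l2 R) w :
  C (\sum_(i <- s) F i) w = \sum_(i <- s) C (F i) w.
Proof.
elim: s => [|i s IH]; first by rewrite !big_nil bform0l.
by rewrite !big_cons bformDl IH.
Qed.

Lemma bform_sumr (I : Type) (s : seq I) (F : I -> l2 R) w :
  C w (\sum_(i <- s) F i) = \sum_(i <- s) C w (F i).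
Proof. by rewrite C_sym bform_suml; apply: eq_bigr => i _; rewrite C_sym. Qed.

Hypothesis C_ge0 : forall u, 0 <= C u u.

Lemma form_cauchy_schwarz u v : C u v ^+ 2 <= C u u * C v v.
Proof.
apply: quad_nonneg => // t; have := C_ge0 (t *: u + v).
by rewrite bformDl !bformDr !bformZl !bformZr (C_sym v); congr (0 <= _); ring.
Qed.

Lemma form_triangle u v :
  Num.sqrt (C (u + v) (u + v)) <= Num.sqrt (C u u) + Num.sqrt (C v v).
Proof.
rewrite -(@ler_pXn2r _ 2) ?nnegrE ?addr_ge0 ?sqrtr_ge0//.
rewrite sqrrD !sqr_sqrtr//.
have : C u v <= Num.sqrt (C u u) * Num.sqrt (C v v).
  apply: le_trans (ler_norm _) _; rewrite -sqrtrM// -sqrtr_sqr.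
  by apply: ler_wsqrtr; exact: form_cauchy_schwarz.
by rewrite bformDl !bformDr (C_sym v); lra.
Qed.

Lemma form_dist u v :
  `|Num.sqrt (C u u) - Num.sqrt (C v v)| <= Num.sqrt (C (u - v) (u - v)).
Proof.
have := form_triangle (u - v) v; have := form_triangle (v - u) u.
rewrite !subrK -(opprB u v) bformNl bformNr opprK => h1 h2.
by rewrite ler_norml; lra.
Qed.

Variable tau : nat -> R.
Hypothesis tau_cvg : tau @ \oo --> 0.
Hypothesis C_tail : forall K u,
  C (u - l2_head K u) (u - l2_head K u) <= tau K * l2_dot u u.

Lemma tau_small (e : R) : 0 < e -> exists K, tau K <= e.
Proof.
move=> e0; move/cvgrPdist_le: tau_cvg => /(_ e e0) [K _ /(_ K (leqnn K))].
by rewrite /= sub0r normrN => /(le_trans (ler_norm _)); exists K.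
Qed.

Lemma form_bounded u : C u u <= tau 0%N * l2_dot u u.
Proof.
have := C_tail 0 u; have -> : l2_head 0 u = 0 by rewrite /l2_head big_ord0.
by rewrite subr0.
Qed.

(** The form is determined by its matrix: Cauchy-Schwarz for C turns the tail bound into convergence
    along finite heads. *)
Lemma form_head_cvg u v : C (l2_head n u) v @[n --> \oo] --> C u v.
Proof.
apply/cvgrPdist_le => e e0.
pose M := l2_dot u u * C v v + 1.
have M0 : 0 < M by rewrite ltr_wpDl// mulr_ge0// l2_dot_ge0.
have d0 : 0 < e ^+ 2 / M by rewrite divr_gt0// exprn_gt0.
move/cvgrPdist_le: tau_cvg => /(_ _ d0); apply: filterS => n.
rewrite sub0r normrN => /(le_trans (ler_norm _)) tn.
have -> : C u v - C (l2_head n u) v = C (u - l2_head n u) v.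
  by rewrite bformDl bformNl.
rewrite -(@ler_pXn2r _ 2) ?nnegrE ?(ltW e0)// real_normK ?num_real//.
apply: le_trans (form_cauchy_schwarz _ _) _.
apply: le_trans (ler_wpM2r (C_ge0 v) (C_tail n u)) _.
apply: (@le_trans _ _ (e ^+ 2 / M * (l2_dot u u * C v v))).
  by rewrite -[leLHS]mulrA ler_wpM2r// mulr_ge0// l2_dot_ge0.
rewrite -mulrA ler_piMr ?sqr_ge0// mulrC ler_pdivrMr// mul1r.
by rewrite /M lerDl.
Qed.

(** The square root of C is a seminorm, so replacing a vector of the unit ball by its head changes
    it by at most sqrt(tau K), uniformly; heads depend on finitely many coordinates. *)
Lemma form_weak_cvg (F : set_system nat) (FF : ProperFilter F)
    (u : nat -> l2 R) v :
  (forall n, l2_dot (u n) (u n) <= 1) -> l2_dot v v <= 1 ->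
  (forall k, u n k @[n --> F] --> v k) ->
  C (u n) (u n) @[n --> F] --> C v v.
Proof.
move=> u1 v1 uv.
have hu K w : Num.sqrt (C (l2_head K w) (l2_head K w)) =
    Num.sqrt (\sum_(k < K) \sum_(l < K) w k * (w l * C (delta k) (delta l))).
  congr (Num.sqrt _); rewrite bform_suml; apply: eq_bigr => k _.
  rewrite bformZl bform_sumr mulr_sumr; apply: eq_bigr => l _.
  by rewrite bformZr.
suff h : Num.sqrt (C (u n) (u n)) @[n --> F] --> Num.sqrt (C v v).
  have E w : C w w = Num.sqrt (C w w) * Num.sqrt (C w w).
    by rewrite -expr2 sqr_sqrtr.
  rewrite E (_ : (fun n => C (u n) (u n)) =
    (fun n => Num.sqrt (C (u n) (u n)) * Num.sqrt (C (u n) (u n)))); last exact/funext.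
  exact: cvgM.
apply/cvgrPdist_le => e e0.
have e30 : 0 < e / 3 by rewrite divr_gt0.
have [K tK] := tau_small (exprn_gt0 2 e30).
have tail w : l2_dot w w <= 1 ->
    `|Num.sqrt (C w w) - Num.sqrt (C (l2_head K w) (l2_head K w))| <= e / 3.
  move=> w1; apply: le_trans (form_dist _ _) _.
  rewrite -[leRHS]ger0_norm ?(ltW e30)// -sqrtr_sqr; apply: ler_wsqrtr.
  apply: le_trans (C_tail _ _) _.
  apply: le_trans (ler_wpM2r (l2_dot_ge0 w) tK) _.
  by rewrite ler_piMr// sqr_ge0.
have hc : Num.sqrt (C (l2_head K (u n)) (l2_head K (u n))) @[n --> F]
    --> Num.sqrt (C (l2_head K v) (l2_head K v)).
  under eq_fun do rewrite hu; rewrite hu.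
  have hS : \sum_(k < K) \sum_(l < K) u n k * (u n l * C (delta k) (delta l))
      @[n --> F] --> \sum_(k < K) \sum_(l < K) v k * (v l * C (delta k) (delta l)).
    apply: cvg_big => [|k _]; first exact: add_continuous.
    apply: cvg_big => [|l _]; first exact: add_continuous.
    by apply: cvgM => //; apply: cvgM => //; exact: cvg_cst.
  exact: cvg_comp hS (@sqrt_continuous R _).
move/cvgrPdist_le: hc => /(_ _ e30); apply: filterS => n hn.
have h1 := tail _ v1; have h2 := tail _ (u1 n).
by move: h1 h2 hn; rewrite !ler_norml; lra.
Qed.

Lemma bounded_ultra_cvg (F : set_system nat) (UF : UltraFilter F)
    (x : nat -> R) : (forall n, `|x n| <= 1) -> exists l : R, x n @[n --> F] --> l.
Proof.
move=> x1; have := @segment_compact R (-1) 1.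
rewrite compact_ultra => /(_ (x @ F)).
have FI : F (x @^-1` `[-1, 1]%classic).
  by apply: filterS filterT => n _ /=; rewrite in_itv/= -ler_norml.
by move=> /(_ (ultra_fmap _ UF) FI)[l [_ xl]]; exists l.
Qed.

(** Weak compactness of the ball. One ultrafilter makes all coordinates converge at once, in place
    of a diagonal extraction; bounds on finite sums put the limit in the ball. *)
Lemma l2_weak_limit (F : set_system nat) (UF : UltraFilter F) (u : nat -> l2 R) :
  (forall n, l2_dot (u n) (u n) <= 1) ->
  exists v, l2_dot v v <= 1 /\ forall k, u n k @[n --> F] --> v k.
Proof.
move=> u1.
have uc k : exists l : R, u n k @[n --> F] --> l.
  apply: bounded_ultra_cvg => n; apply: le_trans (l2_coord_norm _ _) _.
  by rewrite -(@ler_pXn2r _ 2) ?nnegrE// l2_norm_sqr expr1n.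
have [v uv] := choice uc.
have v1 K : \sum_(k < K) v k ^+ 2 <= 1.
  have h : \sum_(k < K) u n k ^+ 2 @[n --> F] --> \sum_(k < K) v k ^+ 2.
    apply: cvg_big => [|k _]; first exact: add_continuous.
    by rewrite expr2; under eq_fun do rewrite expr2; exact: cvgM.
  rewrite -(cvg_lim _ h)//; apply: limr_le; first by apply/cvg_ex; exists (\sum_(k < K) v k ^+ 2).
  apply: nearW => n; apply: le_trans (u1 n).
  by rewrite -subr_ge0 -l2_tail_sqr l2_dot_ge0.
have vS : v \in square_summable.
  apply/asboolP/nondecreasing_is_cvgn.
    by apply/nondecreasing_seqP => n; rewrite /series/= big_nat_recr//= lerDl sqr_ge0.
  by exists 1 => _ [n _ <-]; rewrite /series/= big_mkord.
exists (L2 vS); split; last exact: uv.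
have h := @l2_dot_cvg _ (L2 vS) (L2 vS).
rewrite -(cvg_lim _ h)//; apply: limr_le; first by apply/cvg_ex; exists (l2_dot (L2 vS) (L2 vS)).
by apply: nearW => n; exact: v1.
Qed.

(* A maximizing sequence on the unit ball converges coordinatewise along an
   ultrafilter, and the tail bound makes the form weakly continuous. *)
Lemma top_eigenvector : exists v, [/\ l2_dot v v <= 1,
  forall w, C w w <= C v v * l2_dot w w,
  forall w, C v w = C v v * l2_dot v w &
  C v v * l2_dot v v = C v v].
Proof.
pose A := [set C u u | u in [set u | l2_dot u u <= 1]].
have A0 : A !=set0 by exists (C 0 0); exists 0 => //=; rewrite l2_dot0l.
have Aub : has_ubound A.
  exists `|tau 0%N| => _ [u /= u1 <-]; apply: le_trans (form_bounded u) _.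
  apply: le_trans (ler_wpM2r (l2_dot_ge0 u) (ler_norm _)) _.
  by rewrite ler_piMr.
have /choice[u Hu] n : exists u, l2_dot u u <= 1 /\ sup A - n.+1%:R^-1 < C u u.
  have [|_ [u u1 <-] h] := @sup_adherent _ A n.+1%:R^-1 _ (conj A0 Aub).
    by rewrite invr_gt0.
  by exists u.
have [F [UF oF]] := ultraFilterLemma (@eventually_filter).
have u1 n := (Hu n).1.
have [v [v1 uv]] := l2_weak_limit UF u1.
have Cuv := form_weak_cvg _ u1 v1 uv.
have supv : sup A <= C v v.
  have h : C (u n) (u n) + n.+1%:R^-1 @[n --> F] --> C v v + 0.
    by apply: cvgD; [exact: Cuv|apply: cvg_trans (@cvg_harmonic R); exact: cvg_app].
  rewrite -[leRHS]addr0 -(cvg_lim _ h)//; apply: limr_ge; first by apply/cvg_ex; exists (C v v + 0).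
  by apply: nearW => n; rewrite -lerBlDr ltW// (Hu n).2.
have Cle w : C w w <= C v v * l2_dot w w.
  have [w0|w0] := eqVneq (l2_dot w w) 0.
    by rewrite (l2_dot_eq0 w0) bform0l l2_dot0l mulr0.
  have wp : 0 < l2_dot w w by rewrite lt_neqAle eq_sym w0 l2_dot_ge0.
  pose s := (Num.sqrt (l2_dot w w))^-1.
  have s2 : s ^+ 2 = (l2_dot w w)^-1 by rewrite exprVn sqr_sqrtr// ltW.
  have : C (s *: w) (s *: w) <= sup A.
    apply: ub_le_sup => //; exists (s *: w) => //=.
    by rewrite l2_dotZl l2_dotZr mulrA -expr2 s2 mulVf.
  rewrite bformZl bformZr mulrA -expr2 s2 => /le_trans /(_ supv).
  by rewrite mulrC ler_pdivrMr.
(* The maximizer has norm 1 unless the form is zero; this equation covers both cases. *)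
have Cvv : C v v * l2_dot v v = C v v.
  by apply/eqP; rewrite eq_le Cle andbT ler_piMr.
(* First variation: the form C v v <w, w> - C w w is nonnegative and vanishes at v, so its polar
   form at v vanishes too. *)
exists v; split => // w; apply/esym/eqP; rewrite -subr_eq0 -sqrf_eq0 eq_le sqr_ge0 andbT.
have := @quad_nonneg _ (C v v * l2_dot w w - C w w) (C v v * l2_dot v w - C v w) 0.
rewrite mulr0 subr_ge0; apply => // t.
have := Cle (v + t *: w); rewrite -subr_ge0; congr (0 <= _).
rewrite bformDl !bformDr !bformZl !bformZr l2_dotDl !l2_dotDr !l2_dotZl !l2_dotZr.
rewrite (C_sym w v) (l2_dotC w v) mulrDr mulrDr Cvv.
ring.
Qed.

End positive_form.

(** * Spectral decomposition along a given list of eigenvalues *)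

Section spectral.
Context {R : realType} (C : l2 R -> l2 R -> R).
Hypothesis C_sym : forall u v, C u v = C v u.
Hypothesis C_lin : forall a u v w, C (a *: u + v) w = a * C u w + C v w.
Hypothesis C_ge0 : forall u, 0 <= C u u.
Variable tau : nat -> R.
Hypothesis tau_cvg : tau @ \oo --> 0.
Hypothesis C_tail : forall K u,
  C (u - l2_head K u) (u - l2_head K u) <= tau K * l2_dot u u.
Variables (trC : R) (lam : nat -> R).
Hypothesis C_bessel : forall e m, bessel_system e ->
  \sum_(j < m) C (e j) (e j) <= trC.
Hypothesis C_trace : \sum_(k < n) C (delta k) (delta k) @[n --> \oo] --> trC.

Let G k l := C (delta k) (delta l).
Hypothesis lam_eig : eigenvalue_list G lam.

(** The coordinatewise matrix equation is turned into a weak equation, both sides being limits along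
    the heads of u. *)
Lemma eigenspaceP mu v :
  l2_eigenspace G mu v <-> forall u, C u v = mu * l2_dot u v.
Proof.
have Gv k : series (fun l => G k l * v l) @ \oo --> C (delta k) v.
  have := @form_head_cvg _ _ C_sym C_lin C_ge0 _ tau_cvg C_tail v (delta k).
  rewrite C_sym (_ : (fun n => _) = series (fun l => G k l * v l))//.
  apply/funext => n; rewrite C_sym (bform_sumr C_sym C_lin) /series/= big_mkord.
  by apply: eq_bigr => l _; rewrite (bformZr C_sym C_lin) mulrC.
split => [h u|h k]; last by rewrite -l2_dot_delta l2_dotC -h; exact: Gv.
have h' k : C (delta k) v = mu * l2_dot (delta k) v.
  by rewrite (l2_dotC _ v) l2_dot_delta; apply: (@norm_cvg_unique _ _ _ _ _ _ (Gv k) (h k)).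
have h1 := @form_head_cvg _ _ C_sym C_lin C_ge0 _ tau_cvg C_tail u v.
have h2 : mu * \sum_(k < n) u k * v k @[n --> \oo] --> mu * l2_dot u v.
  by apply: cvgM; [exact: cvg_cst|exact: l2_dot_cvg].
apply: (@norm_cvg_unique _ _ _ _ _ _ h1).
rewrite (_ : (fun n => _) = (fun n => mu * \sum_(k < n) u k * v k))//.
apply/funext => n; rewrite -l2_dot_head /l2_head (bform_suml C_lin) l2_dot_suml mulr_sumr.
by apply: eq_bigr => k _; rewrite (bformZl C_lin) h' l2_dotZl mulrCA.
Qed.

Let orthonormal_in (E : set (l2 R)) n (f : nat -> l2 R) :=
  (forall i, (i < n)%N -> E (f i)) /\
  (forall i j, (i < n)%N -> (j < n)%N -> l2_dot (f i) (f j) = (i == j)%:R).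

(** Each of the n orthonormal eigenvectors contributes mu to a sum bounded by the trace; hence
    nonzero eigenvalues have finite multiplicity. *)
Lemma eigenspace_size mu n f : mu != 0 ->
  orthonormal_in [set v | forall u, C u v = mu * l2_dot u v] n f ->
  n%:R * `|mu| <= trC.
Proof.
move=> mu0 [fE fo]; pose e i := if (i < n)%N then f i else 0.
have be : bessel_system e.
  move=> i j; rewrite /e; case: ifPn => ni; last first.
    by rewrite !l2_dot0l mul0rn; split => //; left.
  rewrite fo// eqxx; split; last by right.
  case: ifPn => nj; first by rewrite fo// mulr_natr -mulrb.
  have -> : (i == j) = false by apply: contraNF nj => /eqP <-.
  by rewrite l2_dot0r.
have := C_bessel n be.
have E : \sum_(j < n) C (e j) (e j) = n%:R * mu.
  rewrite (eq_bigr (fun=> mu)) => [|j _]; first by rewrite sumr_const card_ord mulr_natl.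
  by rewrite /e ltn_ord fE// fo// eqxx mulr1.
have : 0 <= n%:R * mu by rewrite -E; apply: sumr_ge0 => j _.
by rewrite E => h; rewrite -[in X in X -> _](ger0_norm h) normrM normr_nat.
Qed.

(** A largest orthonormal family in the eigenspace spans it. The condition on mu stands under the
    existential so that a choice can be made for all mu together. *)
Lemma eigenbasis mu : exists e : nat -> l2 R, mu != 0 ->
  [/\ forall i, lam i = mu -> forall u, C u (e i) = mu * l2_dot u (e i),
   forall i j, lam i = mu -> lam j = mu -> l2_dot (e i) (e j) = (i == j)%:R &
   forall v, (forall u, C u v = mu * l2_dot u v) ->
     (forall i, lam i = mu -> l2_dot v (e i) = 0) -> v = 0].
Proof.
have [->|mu0] := eqVneq mu 0; first by exists (fun=> 0).
set E := [set v | forall u, C u v = mu * l2_dot u v].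
pose Q n := `[< exists f, orthonormal_in E n f >].
have Q0 : exists n, Q n by exists 0%N; apply/asboolP; exists (fun=> 0); split.
have Qb n : Q n -> (n <= Num.truncn (trC / `|mu|))%N.
  move=> /asboolP[f /(eigenspace_size mu0) h].
  have h0 : 0 <= trC / `|mu| by rewrite divr_ge0// (le_trans _ h)// mulr_ge0.
  by rewrite truncn_ge_nat// ler_pdivlMr ?normr_gt0.
have [n /asboolP[f [fE fo]] nmax] := ex_maxnP Q0 Qb.
have full v : E v -> (forall i, (i < n)%N -> l2_dot v (f i) = 0) -> v = 0.
  move=> Ev vf; apply: l2_dot_eq0; apply/eqP; apply: contraT => v0.
  have vp : 0 < l2_dot v v by rewrite lt_neqAle eq_sym v0 l2_dot_ge0.
  pose s := (Num.sqrt (l2_dot v v))^-1.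
  have s2 : s ^+ 2 = (l2_dot v v)^-1 by rewrite exprVn sqr_sqrtr// ltW.
  pose g i := if (i < n)%N then f i else s *: v.
  suff /nmax : Q n.+1 by rewrite ltnn.
  apply/asboolP; exists g; split => [i|i j]; rewrite /g ?ltnS.
    case: ifPn => [ni _|_ _]; first exact: fE.
    by move=> u; rewrite (bformZr C_sym C_lin) Ev l2_dotZr mulrCA.
  move=> iN jN; have eqn k : (k <= n)%N -> ~~ (k < n)%N -> k = n.
    by move=> kn; rewrite -leqNgt => nk; apply/eqP; rewrite eqn_leq kn.
  case: ifPn => ni; case: ifPn => nj.
  - by rewrite fo.
  - by rewrite l2_dotZr l2_dotC vf// mulr0 (eqn j)// ltn_eqF.
  - by rewrite l2_dotZl vf// mulr0 (eqn i)// gtn_eqF.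
  - rewrite (eqn i)// (eqn j)// eqxx l2_dotZl l2_dotZr mulrA -expr2 s2.
    by rewrite mulVf.
have Elin (c : 'I_n -> R) : E (\sum_(i < n) c i *: f i).
  move=> u; rewrite (bform_sumr C_sym C_lin) l2_dot_sumr mulr_sumr.
  by apply: eq_bigr => i _; rewrite (bformZr C_sym C_lin) fE// l2_dotZr mulrCA.
have dotf (c : 'I_n -> R) (j : 'I_n) : l2_dot (\sum_(i < n) c i *: f i) (f j) = c j.
  rewrite l2_dot_suml (bigD1 j)//= l2_dotZl fo// eqxx mulr1 big1 ?addr0// => i ij.
  by rewrite l2_dotZl fo// val_eqE (negbTE ij) mulr0.
have dimE : has_dim (l2_eigenspace G mu) n.
  exists (fun i : 'I_n => f i); split.
    by move=> c c0 i; rewrite -dotf c0 l2_dot0l.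
  apply/seteqP; split => v.
    move=> /eigenspaceP Ev; exists (fun i => l2_dot v (f i)) => //.
    apply/eqP; rewrite eq_sym -subr_eq0; apply/eqP; apply: full => [u|i ni].
      by rewrite (bformDr C_sym C_lin) (bformNr C_sym C_lin) l2_dotDr l2_dotNr mulrDr mulrN Ev Elin.
    by rewrite l2_dotDl l2_dotNl (dotf _ (Ordinal ni)) subrr.
  by move=> [c _ <-]; apply/eigenspaceP; exact: Elin.
(* The multiplicity hypothesis is used here: the positions of mu in [lam] are in bijection with the
   basis, and the basis is relabelled by them. *)
have /card_set_bijP[b [b1 b2 b3]] := (lam_eig mu0 n).1 dimE.
exists (f \o b) => _; split => [i imu|i j imu jmu|v Ev vb].
- by apply: fE; apply: b1.
- rewrite fo//; [|exact: b1|exact: b1].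
  congr (_%:R); congr (nat_of_bool _); apply/eqP/eqP => [bij|->//].
  by apply: b2; rewrite ?inE.
- apply: full => // i /b3[j jmu <-]; exact: vb.
Qed.

Theorem spectral_decomposition : exists e : nat -> l2 R,
  [/\ bessel_system e, forall j, 0 <= lam j,
   forall i j, C (e i) (e j) = lam j *+ (i == j) &
   \sum_(j < m) lam j @[m --> \oo] --> trC].
Proof.
have [E HE] := choice eigenbasis.
pose e j := if lam j == 0 then 0 else E (lam j) j.
have eC j u : C u (e j) = lam j * l2_dot u (e j).
  rewrite /e; case: ifPn => [_|l0]; first by rewrite (bform0r C_sym C_lin) l2_dot0r mulr0.
  by have [h _ _] := HE _ l0; exact: h.
have ee j : l2_dot (e j) (e j) = (lam j != 0)%:R.
  rewrite /e; case: ifPn => [_|l0]; first by rewrite l2_dot0l.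
  by have [_ h _] := HE _ l0; rewrite h// eqxx.
have eo i j : i != j -> l2_dot (e i) (e j) = 0.
  move=> ij; have [l0|l0] := eqVneq (lam i) 0.
    by rewrite /e l0 eqxx l2_dot0l.
  have [lij|lij] := eqVneq (lam j) (lam i).
    have [_ h _] := HE _ l0.
    by rewrite /e lij (negbTE l0) h// (negbTE ij).
  have h : (lam j - lam i) * l2_dot (e i) (e j) = 0.
    by rewrite mulrBl -eC C_sym eC l2_dotC subrr.
  by move/eqP: h; rewrite mulf_eq0 subr_eq0 (negbTE lij) => /eqP.
have be : bessel_system e.
  move=> i j; split; last by rewrite ee; case: (lam i != 0); [right|left].
  by have [->//|ij] := eqVneq i j; rewrite eo.
have lam_ge0 j : 0 <= lam j.
  have := C_ge0 (e j); rewrite eC ee; have [->//|_] := eqVneq (lam j) 0.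
  by rewrite mulr1.
have le j : lam j * l2_dot (e j) (e j) = lam j.
  by rewrite ee; have [->|_] := eqVneq (lam j) 0; rewrite (mul0r, mulr1).
have Cee i j : C (e i) (e j) = lam j *+ (i == j).
  rewrite eC; have [->|ij] := eqVneq i j; first by rewrite le.
  by rewrite eo// mulr0.
have sum_le m : \sum_(j < m) lam j <= trC.
  by have := C_bessel m be; under eq_bigr do rewrite Cee eqxx.
have lam0 : lam @ \oo --> 0.
  have := @cvg_series_cvg_0 _ _ lam; apply.
  apply: nondecreasing_is_cvgn.
    by apply/nondecreasing_seqP => n; rewrite /series/= big_nat_recr//= lerDl.
  by exists trC => _ [n _ <-]; rewrite /series/= big_mkord.
exists e; split => //.
(* Deflation: were the top eigenvalue of [Cm m] not small, its eigenvector would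
   be a new eigenvector of [C] orthogonal to all the [e j]. *)
pose Cm m u v := C u v - \sum_(j < m) lam j * l2_dot u (e j) * l2_dot v (e j).
have Cm_sym m u v : Cm m u v = Cm m v u.
  by rewrite /Cm C_sym; congr (_ - _); apply: eq_bigr => j _; rewrite mulrAC.
have Cm_lin m a u v w : Cm m (a *: u + v) w = a * Cm m u w + Cm m v w.
  rewrite /Cm C_lin mulrBr mulr_sumr addrACA; congr (_ + _).
  rewrite -opprD -big_split/=; congr (- _); apply: eq_bigr => j _.
  by rewrite l2_dotP; ring.
have Cm_ge0 m u : 0 <= Cm m u u.
  (* The deflated form at u equals C at u - r, where r is the projection of u on the first m
     vectors. *)
  set r := \sum_(j < m) l2_dot u (e j) *: e j.
  have Cur : C u r = \sum_(j < m) lam j * l2_dot u (e j) * l2_dot u (e j).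
    rewrite (bform_sumr C_sym C_lin); apply: eq_bigr => j _.
    by rewrite (bformZr C_sym C_lin) eC; ring.
  have Crr : C r r = \sum_(j < m) lam j * l2_dot u (e j) * l2_dot u (e j).
    rewrite (bform_suml C_lin); apply: eq_bigr => i _.
    rewrite (bformZl C_lin) (bform_sumr C_sym C_lin) (bigD1 i)//= big1 => [|j ji].
      by rewrite (bformZr C_sym C_lin) Cee eqxx addr0 mulr1n; ring.
    by rewrite (bformZr C_sym C_lin) Cee val_eqE eq_sym (negbTE ji) mulr0.
  have := C_ge0 (u - r).
  rewrite (bformDl C_lin) !(bformDr C_sym C_lin) !(bformNl C_lin) !(bformNr C_sym C_lin).
  by rewrite (C_sym r u) Cur Crr /Cm; lra.
have Cm_le m u : Cm m u u <= C u u.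
  by rewrite /Cm gerBl; apply: sumr_ge0 => j _; rewrite -mulrA -expr2 mulr_ge0// sqr_ge0.
have Cm_tail m K u : Cm m (u - l2_head K u) (u - l2_head K u) <= tau K * l2_dot u u.
  exact: le_trans (Cm_le m _) (C_tail K u).
have Cm_small eps : 0 < eps -> exists m0, forall m, (m0 <= m)%N ->
    forall u, Cm m u u <= eps * l2_dot u u.
  move=> eps0; move/cvgrPdist_lt: lam0 => /(_ eps eps0)[m0 _ Hm0].
  exists m0 => m mm u.
  have [v [v1 vmax veig vv]] := top_eigenvector (Cm_sym m) (Cm_lin m) (Cm_ge0 m) tau_cvg (Cm_tail m).
  set rho := Cm m v v in vmax veig vv *.
  apply: le_trans (vmax u) _; apply: ler_wpM2r; first exact: l2_dot_ge0.
  rewrite leNgt; apply/negP => eps_rho.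
  have rho0 : 0 < rho by exact: lt_trans eps_rho.
  have vej j : (j < m)%N -> l2_dot v (e j) = 0.
    move=> jm; have := veig (e j).
    have -> : Cm m v (e j) = 0.
      rewrite /Cm (bigD1 (Ordinal jm))//= big1 => [|i ij].
        by rewrite eC addr0 -mulrA [X in _ - _ * X]mulrC mulrA le subrr.
      by rewrite (eo j i) ?mulr0// eq_sym.
    by move/esym/eqP; rewrite mulf_eq0 gt_eqF//= => /eqP.
  have Cv w : C w v = rho * l2_dot w v.
    rewrite C_sym l2_dotC -veig /Cm big1 ?subr0// => j _.
    by rewrite vej// mulr0 mul0r.
  have rho_ne0 : rho != 0 by rewrite gt_eqF.
  have [_ _ full] := HE _ rho_ne0.
  (* An index i with lam i = rho is either below m, where v is orthogonal to e i, or beyond m0,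
     where lam i < eps < rho. *)
  have v0 : v = 0.
    apply: full => // i li.
    have [im|mi] := ltnP i m; first by have := vej i im; rewrite /e li (negbTE rho_ne0).
    have := Hm0 i (leq_trans mm mi); rewrite /= sub0r normrN ger0_norm// li.
    by rewrite ltNge (ltW eps_rho).
  by move: rho0; rewrite -vv v0 l2_dot0l mulr0 ltxx.
apply/cvgrPdist_le => eps eps0.
have e20 : 0 < eps / 2 by rewrite divr_gt0.
move/cvgrPdist_le: (C_trace) => /(_ _ e20)[K _ /(_ K (leqnn K)) /= HK].
(* The missing trace is the trace of the deflated form: its first K diagonal entries are small by
   deflation, the others are dominated by the tail of the trace of C. *)
have eK0 : 0 < eps / 2 / K.+1%:R by rewrite divr_gt0.
have [m0 Hm0] := Cm_small _ eK0.
exists m0 => // m /= mm.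
rewrite ger0_norm ?subr_ge0; last exact: sum_le.
have hn n : \sum_(k < n) Cm m (delta k) (delta k) =
   \sum_(k < n) C (delta k) (delta k) - \sum_(j < m) lam j * \sum_(k < n) e j k * e j k.
  rewrite sumrB; congr (_ - _); rewrite exchange_big/=; apply: eq_bigr => j _.
  rewrite mulr_sumr; apply: eq_bigr => k _.
  by rewrite !(l2_dotC (delta k)) !l2_dot_delta mulrA.
have lim : \sum_(k < n) Cm m (delta k) (delta k) @[n --> \oo] --> trC - \sum_(j < m) lam j.
  under eq_fun do rewrite hn.
  apply: cvgB => //.
  have -> : \sum_(j < m) lam j = \sum_(j < m) lam j * l2_dot (e j) (e j).
    by apply: eq_bigr => j _; rewrite le.
  apply: cvg_big => [|j _]; first exact: add_continuous.
  by apply: cvgM; [exact: cvg_cst|exact: l2_dot_cvg].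
have Cdd_ge0 k : 0 <= C (delta k) (delta k) by exact: C_ge0.
have trn n : \sum_(k < n) C (delta k) (delta k) <= trC.
  have nd : nondecreasing_seq (fun n => \sum_(k < n) C (delta k) (delta k)).
    by apply/nondecreasing_seqP => k; rewrite big_ord_recr/= lerDl.
  have := nondecreasing_cvgn_le nd; rewrite (cvg_lim _ C_trace)//; apply.
  exact: C_trace.
rewrite -(cvg_lim _ lim)//; apply: limr_le; first by apply/cvg_ex; exists (trC - \sum_(j < m) lam j).
exists K => // n /= Kn.
rewrite -(subnKC Kn) big_split_ord/=.
have b1 : \sum_(k < K) Cm m (delta k) (delta k) <= eps / 2.
  apply: (@le_trans _ _ (\sum_(k < K) eps / 2 / K.+1%:R)).
    apply: ler_sum => k _; have := Hm0 m mm (delta k).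
    by rewrite l2_dot_delta /= /delta_seq eqxx mulr1.
  rewrite sumr_const card_ord -[leLHS]mulr_natl mulrA ler_pdivrMr//.
  by rewrite mulrC ler_wpM2l ?(ltW e20)// ler_nat.
have b2 : \sum_(i < n - K) Cm m (delta (K + i)%N) (delta (K + i)%N) <= eps / 2.
  apply: (@le_trans _ _ (\sum_(i < n - K) C (delta (K + i)%N) (delta (K + i)%N))).
    by apply: ler_sum => i _; exact: Cm_le.
  have := trn (K + (n - K))%N; rewrite big_split_ord/=.
  have := le_trans (ler_norm _) HK; lra.
by have := lerD b1 b2; rewrite -splitr.
Qed.

End spectral.

(** * Covariance form and sample averages *)

Section covariance_form.
Context d (T : measurableType d) (R : realType) (P : probability T R).
Variable Z : {RV P >-> l2 R}.
Hypothesis Z_sq : ('E_P[fun w => (`|Z w| ^+ 2)%R] < +oo)%E.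
Local Notation sqZ w := (l2_dot (Z w) (Z w)).

Let mZ : measurable_fun setT Z. Proof. exact: measurable_funP. Qed.

Lemma integrable_l2_sqr : P.-integrable setT (EFin \o (fun w => sqZ w)).
Proof.
apply/integrableP; split; first exact/measurable_EFinP/measurable_l2_sqr.
move: Z_sq; rewrite unlock; apply: le_lt_trans; apply: ge0_le_integral => //.
- apply/measurable_EFinP; apply: measurableT_comp => //.
  exact: measurable_l2_sqr.
- under eq_fun do rewrite l2_norm_sqr.
  by apply/measurable_EFinP; exact: measurable_l2_sqr.
- by move=> w _; rewrite lee_fin l2_norm_sqr ger0_norm// l2_dot_ge0.
Qed.

Lemma integrable_l2_dot2 u v :
  P.-integrable setT (EFin \o (fun w => l2_dot (Z w) u * l2_dot (Z w) v)).
Proof.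
have iM : P.-integrable setT (EFin \o (fun w => (l2_dot u u + l2_dot v v) * sqZ w)).
  have := integrableZl measurableT (l2_dot u u + l2_dot v v) integrable_l2_sqr.
  by congr (_.-integrable _ _).
apply: (le_integrable measurableT _ _ iM).
  by apply/measurable_EFinP; apply: measurable_funM; exact: measurable_l2_dot.
move=> w _ /=; rewrite lee_fin.
have h1 := l2_dot_sqr_le (Z w) u; have h2 := l2_dot_sqr_le (Z w) v.
rewrite [leRHS]ger0_norm; last by rewrite mulr_ge0 ?addr_ge0 ?l2_dot_ge0.
have h3 := sqr_ge0 (l2_dot (Z w) u - l2_dot (Z w) v).
have h4 := sqr_ge0 (l2_dot (Z w) u + l2_dot (Z w) v).
rewrite sqrrB in h3; rewrite sqrrD in h4.
have h5 := mulr_ge0 (l2_dot_ge0 (Z w)) (addr_ge0 (l2_dot_ge0 u) (l2_dot_ge0 v)).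
by rewrite ler_norml; lra.
Qed.

Definition cov_form u v := \int[P]_w (l2_dot (Z w) u * l2_dot (Z w) v).

Definition total_var := \int[P]_w sqZ w.

Lemma cov_form_sym u v : cov_form u v = cov_form v u.
Proof. by apply: eq_Rintegral => w _; rewrite mulrC. Qed.

Lemma cov_form_lin a u v w : cov_form (a *: u + v) w = a * cov_form u w + cov_form v w.
Proof.
have ia : P.-integrable setT (EFin \o (fun x => a * (l2_dot (Z x) u * l2_dot (Z x) w))).
  have := integrableZl measurableT a (integrable_l2_dot2 u w).
  by congr (_.-integrable _ _).
rewrite /cov_form -RintegralZl//; last exact: integrable_l2_dot2.
rewrite -RintegralD//; last exact: integrable_l2_dot2.
by apply: eq_Rintegral => x _; rewrite l2_dotDr l2_dotZr mulrDl mulrA.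
Qed.

Lemma cov_form_ge0 u : 0 <= cov_form u u.
Proof. by apply: Rintegral_ge0 => w _; rewrite -expr2 sqr_ge0. Qed.

Lemma cov_form_sum (e : nat -> l2 R) m :
  \sum_(j < m) cov_form (e j) (e j) = \int[P]_w \sum_(j < m) l2_dot (Z w) (e j) ^+ 2.
Proof. by rewrite Rintegral_sum// => j; exact: integrable_l2_dot2. Qed.

Lemma integrable_dot_sum (e : nat -> l2 R) m :
  P.-integrable setT (EFin \o (fun w => \sum_(j < m) l2_dot (Z w) (e j) ^+ 2)).
Proof.
elim: m => [|m IH].
  under eq_fun do rewrite big_ord0.
  by apply: (@bounded_integrable _ _ _ P _ 0) => // w; rewrite normr0.
under eq_fun do rewrite big_ord_recr/=.
by apply: integrable_addR => //; exact: integrable_l2_dot2.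
Qed.

Lemma cov_form_bessel (e : nat -> l2 R) m : bessel_system e ->
  \sum_(j < m) cov_form (e j) (e j) <= total_var.
Proof.
move=> be; rewrite cov_form_sum; apply: le_Rintegral => //.
- exact: integrable_dot_sum.
- exact: integrable_l2_sqr.
- by move=> w _; exact: bessel_inequality.
Qed.

Lemma bessel_delta : bessel_system (@delta R).
Proof.
move=> i j; rewrite !l2_dot_delta /= /delta_seq eqxx; split; last by right.
by rewrite eq_sym.
Qed.

Lemma cov_form_trace : \sum_(k < n) cov_form (delta k) (delta k) @[n --> \oo]
  --> total_var.
Proof.
have E n : (\sum_(k < n) cov_form (delta k) (delta k))%:E
    = (\int[P]_w (\sum_(k < n) Z w k ^+ 2)%:E)%E.
  rewrite cov_form_sum EFin_Rintegral; last exact: integrable_dot_sum.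
  by apply: eq_integral => w _; congr EFin; apply: eq_bigr => k _; rewrite l2_dot_delta.
suff h : (\sum_(k < n) cov_form (delta k) (delta k))%:E @[n --> \oo] --> total_var%:E.
  exact: fine_cvg h.
under eq_fun do rewrite E; rewrite EFin_Rintegral; last exact: integrable_l2_sqr.
have m1 n : measurable_fun setT (fun w => (\sum_(k < n) Z w k ^+ 2)%:E).
  apply/measurable_EFinP; apply: measurable_sum => k; apply: measurable_funX.
  exact: measurable_l2_coord.
have m2 : measurable_fun setT (fun w => (sqZ w)%:E).
  by apply/measurable_EFinP; exact: measurable_l2_sqr.
have cv : {ae P, forall w, setT w -> (\sum_(k < n) Z w k ^+ 2)%:E @[n --> \oo] --> (sqZ w)%:E}.
  apply: aeW => w _; apply: cvg_EFin; first by apply: nearW.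
  exact: l2_dot_cvg.
have bd : {ae P, forall w n, setT w -> (`|(\sum_(k < n) Z w k ^+ 2)%:E| <= (sqZ w)%:E)%E}.
  apply: aeW => w n _; rewrite lee_fin ger0_norm; last by apply: sumr_ge0 => k _; exact: sqr_ge0.
  by rewrite -subr_ge0 -l2_tail_sqr l2_dot_ge0.
by have [_ _] := dominated_convergence measurableT m1 m2 cv integrable_l2_sqr bd.
Qed.

Definition cov_tail K := total_var - \sum_(k < K) cov_form (delta k) (delta k).

Lemma cov_tail_cvg : cov_tail @ \oo --> 0.
Proof.
suff : cov_tail @ \oo --> total_var - total_var by rewrite subrr.
by apply: cvgB; [exact: cvg_cst|exact: cov_form_trace].
Qed.

(** The head projection is self-adjoint: it is moved from u to Z, then Cauchy-Schwarz is integrated.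
    [cov_tail K] is the expected squared norm of the tail of Z. *)
Lemma cov_form_tail K u :
  cov_form (u - l2_head K u) (u - l2_head K u) <= cov_tail K * l2_dot u u.
Proof.
have E : cov_tail K = \int[P]_w (sqZ w - \sum_(k < K) l2_dot (Z w) (delta k) ^+ 2).
  rewrite RintegralB//; [|exact: integrable_l2_sqr|exact: integrable_dot_sum].
  by rewrite /cov_tail cov_form_sum.
have iB : P.-integrable setT (EFin \o
    (fun w => sqZ w - \sum_(k < K) l2_dot (Z w) (delta k) ^+ 2)).
  have := integrableB measurableT integrable_l2_sqr (integrable_dot_sum (@delta R) K).
  by congr (_.-integrable _ _).
rewrite E mulrC -RintegralZl//.
apply: le_Rintegral => //; first exact: integrable_l2_dot2.
  have := integrableZl measurableT (l2_dot u u) iB.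
  by congr (_.-integrable _ _).
move=> w _; rewrite -expr2.
under eq_bigr do rewrite l2_dot_delta.
rewrite -l2_tail_sqr mulrC.
suff -> : l2_dot (Z w) (u - l2_head K u) = l2_dot (Z w - l2_head K (Z w)) u.
  exact: l2_dot_sqr_le.
rewrite l2_dotDr l2_dotNr l2_dotDl l2_dotNl; congr (_ - _).
by rewrite l2_dotC !l2_dot_head; apply: eq_bigr => k _; rewrite mulrC.
Qed.

Lemma l2_covE k l : l2_cov Z k l = cov_form (delta k) (delta l).
Proof.
rewrite /l2_cov unlock /cov_form /Rintegral; congr fine.
by apply: eq_integral => w _; rewrite !l2_dot_delta.
Qed.

Lemma cov_spectral lam : eigenvalue_list (l2_cov Z) lam ->
  exists e : nat -> l2 R,
  [/\ bessel_system e, forall j, 0 <= lam j,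
   forall i j, cov_form (e i) (e j) = lam j *+ (i == j) &
   \sum_(j < m) lam j @[m --> \oo] --> total_var].
Proof.
have -> : l2_cov Z = fun k l => cov_form (delta k) (delta l).
  by apply/funext => k; apply/funext => l; exact: l2_covE.
apply: (spectral_decomposition cov_form_sym cov_form_lin cov_form_ge0
  cov_tail_cvg cov_form_tail); [exact: cov_form_bessel|exact: cov_form_trace].
Qed.

End covariance_form.

Section iid_strong_law.
Context d d' (T : measurableType d) (T' : measurableType d') (R : realType).
Context (P : probability T R) (Z : nat -> {RV P >-> T'}).
Hypothesis Z_iid : iid Z.

Lemma iid_pair i j A B : i != j -> measurable A -> measurable B ->
  P (Z i @^-1` A `&` Z j @^-1` B) = (P (Z i @^-1` A) * P (Z j @^-1` B))%E.
Proof.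
move=> ij mA mB; pose C k := if k == i then A else B.
have mC k : measurable (C k) by rewrite /C; case: ifP.
have := Z_iid.1 [fset i; j]%fset C mC.
have ji : (j == i) = false by rewrite eq_sym (negbTE ij).
rewrite big_fsetU1 ?inE//= big_seq_fset1 /C eqxx ji => <-; congr (P _).
apply/seteqP; split => w /=.
  by move=> [Aw Bw] k /=; rewrite !inE => /orP[] /eqP ->; rewrite ?eqxx ?ji.
move=> h; split.
  by have := h i; rewrite /= !inE ?eqxx; apply.
by have := h j; rewrite /= !inE ?eqxx ?ji ?orbT; apply.
Qed.

Lemma iid_ident i A : measurable A -> P (Z i @^-1` A) = P (Z 0%N @^-1` A).
Proof. exact: Z_iid.2. Qed.

Lemma iid_strong_law_ge0 (f : T' -> R) : measurable_fun setT f ->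
  (forall z, 0 <= f z) -> P.-integrable setT (EFin \o (fun w => f (Z 0%N w))) ->
  {ae P, forall w, n%:R^-1 * \sum_(i < n) f (Z i w) @[n --> \oo]
    --> \int[P]_w f (Z 0%N w)}.
Proof.
move=> mf f0 fi.
have mX i : measurable_fun setT (fun w => f (Z i w)).
  by apply: measurableT_comp => //; exact: measurable_funP.
pose X i : {RV P >-> R} := HB.pack (fun w => f (Z i w))
  (isMeasurableFun.Build _ _ _ _ (fun w => f (Z i w)) (mX i)).
have mfA A : measurable A -> measurable (f @^-1` A).
  by move=> mA; rewrite -[X in measurable X]setTI; exact: mf.
apply: (@strong_law _ _ _ P X) => //.
- by move=> i w; exact: f0.
- by move=> i j ij A B mA mB; apply: (@iid_pair i j (f @^-1` A) (f @^-1` B)) => //; exact: mfA.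
- by move=> i B mB; apply: (@iid_ident i (f @^-1` B)); exact: mfA.
Qed.

Lemma iid_strong_law (f : T' -> R) : measurable_fun setT f ->
  P.-integrable setT (EFin \o (fun w => f (Z 0%N w))) ->
  {ae P, forall w, n%:R^-1 * \sum_(i < n) f (Z i w) @[n --> \oo]
    --> \int[P]_w f (Z 0%N w)}.
Proof.
move=> mf fi.
pose fp z := Num.max (f z) 0; pose fn z := Num.max (- f z) 0.
have fE z : f z = fp z - fn z.
  by rewrite /fp /fn; case: (leP (f z) 0) => h; case: (leP (- f z) 0) => h'; lra.
have mfp : measurable_fun setT fp by apply: measurable_maxr.
have mfn : measurable_fun setT fn.
  by apply: measurable_maxr => //; exact: measurable_funN.
have mZ0 : measurable_fun setT (Z 0%N : T -> T') by exact: measurable_funP.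
have fp0 z : 0 <= fp z by rewrite le_max lexx orbT.
have fn0 z : 0 <= fn z by rewrite le_max lexx orbT.
have ip : P.-integrable setT (EFin \o (fun w => fp (Z 0%N w))).
  apply: (le_integrable measurableT _ _ fi).
    by apply/measurable_EFinP; exact: measurableT_comp.
  move=> w _ /=; rewrite lee_fin ger0_norm// /fp.
  by rewrite ge_max ler_norm normr_ge0.
have in_ : P.-integrable setT (EFin \o (fun w => fn (Z 0%N w))).
  apply: (le_integrable measurableT _ _ fi).
    by apply/measurable_EFinP; exact: measurableT_comp.
  move=> w _ /=; rewrite lee_fin ger0_norm// /fn.
  by rewrite ge_max -normrN ler_norm normr_ge0.
have h1 := iid_strong_law_ge0 mfp fp0 ip.
have h2 := iid_strong_law_ge0 mfn fn0 in_.
apply: filterS2 h1 h2 => w c1 c2.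
have -> : \int[P]_w f (Z 0%N w) = \int[P]_w fp (Z 0%N w) - \int[P]_w fn (Z 0%N w).
  by rewrite -RintegralB//; apply: eq_Rintegral => x _; exact: fE.
rewrite (_ : (fun n => _) = (fun n => n%:R^-1 * \sum_(i < n) fp (Z i w)
   - n%:R^-1 * \sum_(i < n) fn (Z i w))); first exact: cvgB.
apply/funext => n; rewrite -mulrBr -sumrB; congr (_ * _).
by apply: eq_bigr => i _; exact: fE.
Qed.

End iid_strong_law.

(** * Bootstrap Laplace transforms *)

Section bootstrap_law.
Context d (T : measurableType d) (R : realType) (P : probability T R).
Variable idx : forall n : nat, 'I_n -> {RV P >-> nat}.
Hypothesis idx_boot : bootstrap_indices idx.

Lemma idx_lt n (k : 'I_n) w : (idx k w < n)%N.
Proof. by have [_ /(_ k)[]] := idx_boot n. Qed.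

Definition idx_map n w : {ffun 'I_n -> 'I_n} := [ffun k => Ordinal (idx_lt k w)].

(** The index set is spelled as a finite set to match the shape of mutual independence. *)
Lemma idx_map_preimage n (g : {ffun 'I_n -> 'I_n}) :
  [set w | idx_map n w = g] =
  \bigcap_(k in [set` [fset k in enum 'I_n]%fset]) (idx k @^-1` [set (g k : nat)]).
Proof.
apply/seteqP; split => w /=.
  by move=> <- k _; rewrite /= ffunE.
move=> h; apply/ffunP => k; apply/val_inj; rewrite /idx_map ffunE/=.
by apply: (h k); rewrite /= !inE mem_enum.
Qed.

Lemma measurable_idx_map n (g : {ffun 'I_n -> 'I_n}) :
  measurable [set w | idx_map n w = g].
Proof.
rewrite idx_map_preimage; apply: fin_bigcap_measurable => // k _.
exact: measurable_funPTI.
Qed.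

Lemma idx_map_prob n (g : {ffun 'I_n -> 'I_n}) :
  P [set w | idx_map n w = g] = ((n%:R^-1 : R) ^+ n)%:E.
Proof.
rewrite idx_map_preimage (idx_boot n).1//.
rewrite (eq_bigr (fun=> (n%:R^-1 : R)%:E)) => [|k _]; last first.
  by have [_ /(_ k)[_ h]] := idx_boot n; exact: h.
rewrite (perm_big (enum 'I_n))/=; last first.
  by apply: uniq_perm; rewrite ?enum_uniq ?fset_uniq// => k; rewrite !inE.
rewrite big_const_seq count_predT size_enum_ord.
have c m (r : R) : iter m (mule r%:E) 1%E = (r ^+ m)%:E.
  by elim: m => [|m IH]; rewrite ?expr0//= IH exprS EFinM.
exact: c.
Qed.

Lemma idx_map_indic n (H : {ffun 'I_n -> 'I_n} -> R) w :
  H (idx_map n w) = \sum_g H g * \1_[set w | idx_map n w = g] w.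
Proof.
rewrite (bigD1 (idx_map n w))//= big1 => [|g gw].
  by rewrite indicE mem_set ?mulr1 ?addr0.
rewrite indicE memNset ?mulr0//= => h; by rewrite h eqxx in gw.
Qed.

Lemma measurable_idx_fun n (H : {ffun 'I_n -> 'I_n} -> R) :
  measurable_fun setT (fun w => H (idx_map n w)).
Proof.
under eq_fun do rewrite idx_map_indic.
apply: measurable_sum => g; apply: measurable_funM => //.
by apply: measurable_indic; exact: measurable_idx_map.
Qed.

(** The random map is uniform over its n^n values, so bootstrap expectations become the finite
    averages of [iter_resample]. *)
Lemma Rintegral_idx_fun n (H : {ffun 'I_n -> 'I_n} -> R) :
  \int[P]_w H (idx_map n w) = n%:R^-1 ^+ n * \sum_g H g.
Proof.
have iI g : P.-integrable setT (EFin \o (\1_[set w | idx_map n w = g] : T -> R)).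
  apply: (@bounded_integrable _ _ _ P _ 1).
    by apply: measurable_indic; exact: measurable_idx_map.
  by move=> w; rewrite indicE; case: (_ \in _); rewrite ?normr1 ?normr0.
under eq_Rintegral do rewrite idx_map_indic.
rewrite Rintegral_sum => [|g]; last first.
  have := integrableZl measurableT (H g) (iI g).
  by congr (_.-integrable _ _).
rewrite mulr_sumr; apply: eq_bigr => g _.
rewrite RintegralZl// Rintegral_indic; last exact: measurable_idx_map.
by rewrite idx_map_prob /= mulrC.
Qed.

End bootstrap_law.

Section resample_form.
Context {R : realType} (C : l2 R -> l2 R -> R).
Hypothesis C_sym : forall u v, C u v = C v u.
Hypothesis C_lin : forall a u v w, C (a *: u + v) w = a * C u w + C v w.

(** Draws are independent and centred, so cross terms vanish: each averaging step adds the constant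
    n^-1 sum_i C (b i) (b i) to the quadratic form. *)
Lemma resample_form n (b : 'I_n -> l2 R) : (0 < n)%N -> \sum_i b i = 0 ->
  n%:R^-1 ^+ n * \sum_(g : {ffun 'I_n -> 'I_n}) C (\sum_k b (g k)) (\sum_k b (g k))
  = \sum_i C (b i) (b i).
Proof.
move=> n0 b0; have nR : n%:R != 0 :> R by rewrite pnatr_eq0 -lt0n.
have st h s : h =1 (fun s => C s s + h 0) ->
    resample b h s = C s s + (h 0 + n%:R^-1 * \sum_i C (b i) (b i)).
  move=> hE; rewrite /resample (eq_bigr (fun i => C s s + h 0 + C (b i) (b i)
      + (C s (b i) + C s (b i)))); last first.
    move=> i _; rewrite hE (bformDl C_lin) !(bformDr C_sym C_lin) (C_sym (b i) s).
    by ring.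
  have cs : \sum_i C s (b i) = 0.
    by rewrite -(bform_sumr C_sym C_lin) b0 (bform0r C_sym C_lin).
  rewrite !big_split/= cs !addr0 !sumr_const card_ord -mulrnDl.
  by rewrite mulrDr -[X in n%:R^-1 * X + _]mulr_natl mulKf// addrA.
have it K s : iter K (resample b) (fun s => C s s) s =
    C s s + K%:R * (n%:R^-1 * \sum_i C (b i) (b i)).
  elim: K s => [|K IH] s; first by rewrite mul0r addr0.
  rewrite [LHS]/= st; last by move=> x; rewrite !IH (bform0l C_lin) add0r.
  by rewrite IH (bform0l C_lin) add0r -[K.+1%:R]natr1 mulrDl mul1r.
have := it n 0; rewrite iter_resample (bform0l C_lin) add0r mulVKf// => <-.
by congr (_ * _); apply: eq_bigr => g _; rewrite add0r.
Qed.

End resample_form.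

(** * Bootstrap sums of a fixed sample *)

Section bootstrap_sample.
Context {R : realType} (z : nat -> l2 R).

Definition sample_avg n (f : l2 R -> R) : R := n%:R^-1 * \sum_(i < n) f (z i).

Definition sample_center n : l2 R := n%:R^-1 *: \sum_(i < n) z i.

Definition sample_dev n (i : 'I_n) : l2 R :=
  (Num.sqrt n%:R)^-1 *: (z i - sample_center n).

Definition boot_sum n (g : {ffun 'I_n -> 'I_n}) : l2 R := \sum_k sample_dev (g k).

Lemma sum_sample_dev n : \sum_(i < n) sample_dev i = 0.
Proof.
rewrite /sample_dev -scaler_sumr sumrB sumr_const card_ord.
case: n => [|n]; first by rewrite big_ord0 mulr0n subrr scaler0.
rewrite /sample_center -[X in _ - X]scaler_nat scalerA mulfV ?pnatr_eq0// scale1r.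
by rewrite subrr scaler0.
Qed.

Lemma bootstrap_statE D n (g : {ffun 'I_n -> 'I_n}) : (0 < n)%N ->
  bootstrap_stat (fun i => truncate D (z i)) (fun k => g k)
  = \sum_(j < D) boot_sum g j ^+ 2.
Proof.
move=> n0; have nR : n%:R != 0 :> R by rewrite pnatr_eq0 -lt0n.
rewrite /bootstrap_stat /eucl_norm sqr_sqrtr; last by apply: sumr_ge0 => j _; exact: sqr_ge0.
rewrite mulr_sumr; apply: eq_bigr => j _.
have -> : boot_sum g j = (Num.sqrt n%:R)^-1 *
   (\sum_(k < n) (truncate D (z (g k)) - sample_mean n (fun i => truncate D (z i)))) ord0 j.
  rewrite /boot_sum l2_sum_coord summxE mulr_sumr; apply: eq_bigr => k _.
  rewrite -[LHS]/((Num.sqrt n%:R)^-1 * (z (g k) j - n%:R^-1 * (\sum_(i < n) z i) j)).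
  rewrite l2_sum_coord !mxE summxE; congr (_ * (_ - _ * _)).
  by apply: eq_bigr => i _; rewrite mxE.
rewrite mxE; set y : R := (X in _ * (_ * X) ^+ 2); rewrite -/y.
rewrite [in RHS]exprMn exprVn sqr_sqrtr ?ler0n//.
by field.
Qed.

(** The squared norm of the component of u orthogonal to the first m vectors of the system; for
    [delta] it is the coordinate tail. *)
Definition residual (e : nat -> l2 R) m u : R :=
  l2_dot u u - \sum_(j < m) l2_dot u (e j) ^+ 2.

Lemma residual_ge0 e m u : bessel_system e -> 0 <= residual e m u.
Proof. by move=> be; rewrite subr_ge0 bessel_inequality. Qed.

Lemma residual_le e m m' u : (m <= m')%N -> residual e m' u <= residual e m u.
Proof.
move=> mm; rewrite lerD2l lerN2 -(subnKC mm) big_split_ord/= lerDl.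
by apply: sumr_ge0 => j _; exact: sqr_ge0.
Qed.

(** The residual is a quadratic form, so its bootstrap mean is known exactly: the sample average
    minus the residual of the sample centre, which is nonnegative. *)
Lemma boot_residual_le e m n : (0 < n)%N -> bessel_system e ->
  n%:R^-1 ^+ n * \sum_(g : {ffun 'I_n -> 'I_n}) residual e m (boot_sum g)
  <= sample_avg n (residual e m).
Proof.
move=> n0 be; have nR : n%:R != 0 :> R by rewrite pnatr_eq0 -lt0n.
pose C u v := l2_dot u v - \sum_(j < m) l2_dot u (e j) * l2_dot v (e j).
have CE u : residual e m u = C u u by [].
have C_sym u v : C u v = C v u.
  by rewrite /C l2_dotC; congr (_ - _); apply: eq_bigr => j _; rewrite mulrC.
have C_lin a u v w : C (a *: u + v) w = a * C u w + C v w.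
  rewrite /C l2_dotP mulrBr mulr_sumr addrACA; congr (_ + _).
  rewrite -opprD -big_split/=; congr (- _); apply: eq_bigr => j _.
  by rewrite l2_dotP; ring.
clearbody C.
under eq_bigr do rewrite CE.
rewrite (resample_form C_sym C_lin n0 (sum_sample_dev n)).
rewrite /sample_avg mulr_sumr.
set c := sample_center n.
have cE : \sum_(i < n) C (z i) c = n%:R * C c c.
  rewrite -(bform_suml C_lin) -(bformZl C_lin); congr (C _ _).
  by rewrite /c /sample_center scalerA mulfV// scale1r.
have -> : \sum_(i < n) C (sample_dev i) (sample_dev i) =
    \sum_(i < n) n%:R^-1 * residual e m (z i) - C c c.
  rewrite (eq_bigr (fun i : 'I_n => n%:R^-1 * residual e m (z i)
     + n%:R^-1 * (C c c - (C (z i) c + C (z i) c)))); last first.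
    move=> i _; rewrite /sample_dev (bformZl C_lin) (bformZr C_sym C_lin) mulrA -expr2.
    rewrite exprVn sqr_sqrtr ?ler0n// -mulrDr CE; congr (_ * _).
    rewrite (bformDl C_lin) !(bformDr C_sym C_lin) !(bformNl C_lin) !(bformNr C_sym C_lin).
    rewrite -/c (C_sym c (z i)).
    by move: (C (z i) (z i)) (C (z i) c) (C c c) => x y x'; ring.
  rewrite big_split/= -[X in _ + X]mulr_sumr sumrB big_split/= cE sumr_const card_ord.
  by congr (_ + _); rewrite -[C c c *+ n]mulr_natl; field.
by rewrite gerBl -CE; exact: residual_ge0.
Qed.

Lemma sample_avg_mul n f : n%:R * sample_avg n f = \sum_(i < n) f (z i).
Proof.
case: n => [|n]; first by rewrite mul0r big_ord0.
by rewrite /sample_avg mulVKf// pnatr_eq0.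
Qed.

(** Convergent averages have negligible last terms: f (z i) = (i + 1) avg_(i+1) - i avg_i. This
    supplies the negligibility condition of the limit theorem. *)
Lemma sample_avg_max (f : l2 R -> R) (l : R) : (forall u, 0 <= f u) ->
  sample_avg n f @[n --> \oo] --> l ->
  forall eps : R, 0 < eps -> \forall n \near \oo, forall i, (i < n)%N ->
    f (z i) <= eps * n%:R.
Proof.
move=> f0 fl eps eps0.
have d0 : 0 < eps / 4 by rewrite divr_gt0.
move/cvgrPdist_le: fl => /(_ _ d0)[N _ HN].
(* The sum covers the indices before N; for later ones f (z i) <= [|l|] + eps n / 2, and the second
   term ensures [|l| <= eps n / 2]. *)
pose M := \sum_(i < N) f (z i) + 2 * `|l|.
exists (Num.truncn (M / eps)).+1 => // n /= Mn i i_n.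
have {}Mn : M <= eps * n%:R.
  rewrite mulrC -ler_pdivrMr//; apply: le_trans (ltW (truncnS_gt _)) _.
  by rewrite ler_nat.
have [iN|Ni] := ltnP i N.
  apply: le_trans Mn; rewrite /M (bigD1 (Ordinal iN))//= -addrA lerDl.
  by rewrite addr_ge0 ?mulr_ge0//; apply: sumr_ge0.
have := HN i Ni; have := HN i.+1 (leqW Ni); rewrite /= !ler_norml => h1 h2.
have fE : f (z i) = i.+1%:R * sample_avg i.+1 f - i%:R * sample_avg i f.
  by rewrite !sample_avg_mul big_ord_recr/= addrAC subrr add0r.
have a1 : i.+1%:R * sample_avg i.+1 f <= i.+1%:R * (l + eps / 4).
  by apply: ler_wpM2l => //; lra.
have a2 : i%:R * (l - eps / 4) <= i%:R * sample_avg i f.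
  by apply: ler_wpM2l => //; lra.
have i1n : i.+1%:R <= n%:R :> R by rewrite ler_nat.
have M2 : 2 * `|l| <= M by rewrite lerDr; apply: sumr_ge0.
have l1 := ler_norm l.
have en : eps * i.+1%:R <= eps * n%:R by rewrite ler_pM2l.
rewrite fE; move: a1 a2 en; rewrite -[i.+1%:R]natr1; lra.
Qed.

Lemma residual_avg_cvg e (s : R) (v : nat -> R) m :
  sample_avg n (fun u => l2_dot u u) @[n --> \oo] --> s ->
  (forall j, sample_avg n (fun u => l2_dot u (e j) ^+ 2) @[n --> \oo] --> v j) ->
  sample_avg n (residual e m) @[n --> \oo] --> s - \sum_(j < m) v j.
Proof.
move=> cs cv.
have E n : sample_avg n (residual e m) = sample_avg n (fun u => l2_dot u u)
    - \sum_(j < m) sample_avg n (fun u => l2_dot u (e j) ^+ 2).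
  rewrite /sample_avg /residual sumrB mulrBr; congr (_ - _).
  by rewrite exchange_big/= mulr_sumr.
under eq_fun do rewrite E.
apply: cvgB => //; apply: cvg_big => [|j _]; first exact: add_continuous.
exact: cv.
Qed.

Variables (e : nat -> l2 R) (lam : nat -> R) (sig : R).
Hypothesis e_bessel : bessel_system e.
Hypothesis lam_ge0 : forall j, 0 <= lam j.
Hypothesis avg_sqr : sample_avg n (fun u => l2_dot u u) @[n --> \oo] --> sig.
Hypothesis avg_mean : forall j,
  sample_avg n (fun u => l2_dot u (e j)) @[n --> \oo] --> (0 : R).
Hypothesis avg_cov : forall i j,
  sample_avg n (fun u => l2_dot u (e i) * l2_dot u (e j)) @[n --> \oo]
  --> lam j *+ (i == j).

Lemma dot_sample_dev n (i : 'I_n) j : l2_dot (sample_dev i) (e j) =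
  (Num.sqrt n%:R)^-1 * (l2_dot (z i) (e j) - sample_avg n (fun u => l2_dot u (e j))).
Proof.
rewrite l2_dotZl l2_dotDl l2_dotNl; congr (_ * (_ - _)).
by rewrite l2_dotZl l2_dot_suml.
Qed.

Lemma boot_laplace (m : nat) (t : R) : 0 < t ->
  n%:R^-1 ^+ n * \sum_(g : {ffun 'I_n -> 'I_n})
    expR (- (t * \sum_(j < m) l2_dot (boot_sum g) (e j) ^+ 2)) @[n --> \oo]
  --> expR (- \sum_(j < m) ln (1 + 2 * t * lam j) / 2).
Proof.
move=> t0.
pose b n (i : 'I_n) (j : 'I_m) := l2_dot (sample_dev i) (e j).
have := @resample_laplace_cvg _ m t (fun j : 'I_m => lam j) t0 (fun j => lam_ge0 j) b.
have sumb n (j : 'I_m) : \sum_i b n i j = 0.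
  by rewrite /b -l2_dot_suml sum_sample_dev l2_dot0l.
have covb (j l : 'I_m) : \sum_i b n i j * b n i l @[n --> \oo]
    --> lam j *+ (j == l).
  (* Empirical covariance as mean of products minus product of means; the latter tends to 0 because
     the averages do. *)
  have E n : \sum_i b n i j * b n i l =
     sample_avg n (fun u => l2_dot u (e j) * l2_dot u (e l))
     - sample_avg n (fun u => l2_dot u (e j)) * sample_avg n (fun u => l2_dot u (e l)).
    rewrite /b; under eq_bigr do rewrite !dot_sample_dev.
    case: n => [|n]; first by rewrite big_ord0 /sample_avg !big_ord0 !mulr0 subrr.
    set aj := sample_avg _ (fun u => l2_dot u (e j)); set al := sample_avg _ (fun u => l2_dot u (e l)).
    have aj' : \sum_(i < n.+1) l2_dot (z i) (e j) = n.+1%:R * aj by rewrite sample_avg_mul.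
    have al' : \sum_(i < n.+1) l2_dot (z i) (e l) = n.+1%:R * al by rewrite sample_avg_mul.
    have nR : n.+1%:R != 0 :> R by rewrite pnatr_eq0.
    rewrite (eq_bigr (fun i : 'I_n.+1 => n.+1%:R^-1 *
      (l2_dot (z i) (e j) * l2_dot (z i) (e l) + aj * al
       - (al * l2_dot (z i) (e j) + aj * l2_dot (z i) (e l))))); last first.
      move=> i _; rewrite mulrACA -expr2 exprVn sqr_sqrtr ?ler0n//; congr (_ * _).
      by ring.
    rewrite -mulr_sumr sumrB !big_split/= -!mulr_sumr aj' al' sumr_const card_ord.
    rewrite /sample_avg -mulr_natl !(mulrDr, mulrBr) !mulrN.
    by field.
  under eq_fun do rewrite E.
  have -> : lam j *+ (j == l) = lam l *+ (j == l :> nat) - 0 * 0.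
    by rewrite mulr0 subr0 val_eqE; case: eqP => [->|].
  apply: cvgB; first exact: avg_cov.
  by apply: cvgM; exact: avg_mean.
have smallb (eps : R) : 0 < eps -> \forall n \near \oo, forall i,
    \sum_j b n i j ^+ 2 <= eps.
  move=> eps0.
  have e40 : 0 < eps / 4 by rewrite divr_gt0.
  have h1 := sample_avg_max (@l2_dot_ge0 R) avg_sqr e40.
  have h2 : \sum_(j < m) sample_avg n (fun u => l2_dot u (e j)) ^+ 2 @[n --> \oo] --> (0 : R).
    suff : \sum_(j < m) sample_avg n (fun u => l2_dot u (e j)) ^+ 2 @[n --> \oo]
        --> \sum_(j < m) (0 * 0 : R).
      by rewrite big1// => j _; rewrite mul0r.
    apply: cvg_big => [|j _]; first exact: add_continuous.
    by under eq_fun do rewrite expr2; apply: cvgM; exact: avg_mean.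
  move/cvgrPdist_le: h2 => /(_ _ e40) h2.
  near=> n => i.
  have n0 : (0 < n)%N by near: n; exists 1%N.
  have H1 : forall i, (i < n)%N -> l2_dot (z i) (z i) <= eps / 4 * n%:R by near: n.
  have H2 : `|0 - \sum_(j < m) sample_avg n (fun u => l2_dot u (e j)) ^+ 2| <= eps / 4 by near: n.
  have nR : 0 < n%:R :> R by rewrite ltr0n.
  have n1 : n%:R^-1 <= 1 :> R by rewrite invf_le1// ler1n.
  have ni0 : 0 <= n%:R^-1 :> R by rewrite invr_ge0 ltW.
  pose A := \sum_(j < m) sample_avg n (fun u => l2_dot u (e j)) ^+ 2.
  have A0 : 0 <= A by apply: sumr_ge0 => j _; exact: sqr_ge0.
  apply: (@le_trans _ _ (\sum_(j < m) n%:R^-1 * (2 * l2_dot (z i) (e j) ^+ 2 +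
    2 * sample_avg n (fun u => l2_dot u (e j)) ^+ 2))).
    apply: ler_sum => j _; rewrite /b dot_sample_dev exprMn exprVn sqr_sqrtr ?(ltW nR)//.
    apply: ler_wpM2l => //.
    have := sqr_ge0 (l2_dot (z i) (e j) + sample_avg n (fun u => l2_dot u (e j))).
    by rewrite sqrrD sqrrB; lra.
  rewrite -mulr_sumr big_split/= -!mulr_sumr -/A mulrDr.
  have b1 : n%:R^-1 * (2 * \sum_(j < m) l2_dot (z i) (e j) ^+ 2) <= eps / 2.
    rewrite mulrC ler_pdivrMr//.
    have := le_trans (bessel_inequality m (z i) e_bessel) (H1 i (ltn_ord i)); lra.
  have b2 : n%:R^-1 * (2 * A) <= eps / 2.
    apply: (@le_trans _ _ (1 * (2 * A))); first by apply: ler_wpM2r => //; lra.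
    by move: H2; rewrite sub0r normrN ger0_norm// -/A; lra.
  by rewrite [leRHS](splitr eps) lerD.
move=> /(_ sumb covb smallb).
have E n (g : {ffun 'I_n -> 'I_n}) : \sum_(j < m) (\sum_k b n (g k) j) ^+ 2
    = \sum_(j < m) l2_dot (boot_sum g) (e j) ^+ 2.
  by apply: eq_bigr => j _; rewrite /b /boot_sum l2_dot_suml.
by under [X in X @ _ --> _ -> _]eq_fun => n do under eq_bigr => g _ do rewrite E.
Unshelve. all: by end_near. Qed.

Lemma expRN_dist (x y : R) : 0 <= x -> 0 <= y -> `|expR (- x) - expR (- y)| <= `|x - y|.
Proof.
wlog xy : x y / x <= y => [h x0 y0|x0 y0].
  by have [|/ltW] := leP x y => xy; [exact: h|rewrite distrC (distrC x); exact: h].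
have e1 : expR (- y) <= expR (- x) by rewrite ler_expR lerN2.
rewrite ger0_norm ?subr_ge0// distrC ger0_norm ?subr_ge0//.
have -> : expR (- y) = expR (- x) * expR (- (y - x)) by rewrite -expRD; congr expR; ring.
have := expR_ge1Dx (- (y - x)); have ex : expR (- x) <= 1 by rewrite -expR0 ler_expR oppr_le0.
have := expR_gt0 (- x); have : 0 <= y - x by rewrite subr_ge0.
by move: ex; move: (expR (- x)) (expR (- (y - x))) (y - x) => p q r; nra.
Qed.

Variables (dim : nat -> nat) (trace : nat -> R).
Hypothesis dim_infty : dim @ \oo --> \oo.
Hypothesis avg_coord : forall k,
  sample_avg n (fun u => l2_dot u (delta k) ^+ 2) @[n --> \oo] --> trace k.
Hypothesis trace_cvg : \sum_(k < n) trace k @[n --> \oo] --> sig.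
Hypothesis lam_cvg : \sum_(j < m) lam j @[m --> \oo] --> sig.

Theorem bootstrap_laplace_cvg (t L : R) : 0 < t ->
  expR (- \sum_(j < m) ln (1 + 2 * t * lam j) / 2) @[m --> \oo] --> L ->
  n%:R^-1 ^+ n * \sum_(g : {ffun 'I_n -> 'I_n})
    expR (- (t * bootstrap_stat (fun i => truncate (dim n) (z i)) (fun k => g k)))
  @[n --> \oo] --> L.
Proof.
move=> t0 cL; apply/cvgrPdist_le => eps eps0.
(* Of the six parts, one truncates the limit, one is the error of [boot_laplace], and four bound the
   two residual averages: each is a tail of the trace plus a sampling error. *)
pose d := eps / 6; have d0 : 0 < d by rewrite divr_gt0.
have dt0 : 0 < d / t by rewrite divr_gt0.
move/cvgrPdist_le: cL => /(_ _ d0)[m1 _ Hm1].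
move/cvgrPdist_le: (lam_cvg) => /(_ _ dt0)[m2 _ Hm2].
move/cvgrPdist_le: (trace_cvg) => /(_ _ dt0)[D _ /(_ D (leqnn D)) HD].
pose m := maxn m1 m2.
have {}Hm1 := Hm1 m (leq_maxl _ _); have {}Hm2 := Hm2 m (leq_maxr _ _).
have hl := @boot_laplace m t t0.
move/cvgrPdist_le: hl => /(_ _ d0) hl.
have hA := residual_avg_cvg (m := D) avg_sqr avg_coord.
move/cvgrPdist_le: hA => /(_ _ dt0) hA.
have hB := residual_avg_cvg (m := m) avg_sqr (fun j => @avg_cov j j).
move/cvgrPdist_le: hB => /(_ _ dt0) hB.
have hD : \forall n \near \oo, (D <= dim n)%N by exact: (dim_infty (nbhs_infty_ge D)).
near=> n.
have n0 : (0 < n)%N by near: n; exists 1%N.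
have Dn : (D <= dim n)%N by near: n.
have Hl : `|expR (- \sum_(j < m) ln (1 + 2 * t * lam j) / 2) -
  n%:R^-1 ^+ n * \sum_(g : {ffun 'I_n -> 'I_n})
    expR (- (t * \sum_(j < m) l2_dot (boot_sum g) (e j) ^+ 2))| <= d by near: n.
have HA : `|sig - \sum_(j < D) trace j - sample_avg n (residual (@delta R) D)| <= d / t by near: n.
have HB : `|sig - \sum_(j < m) lam j *+ (j == j) - sample_avg n (residual e m)| <= d / t by near: n.
pose Q g := \sum_(j < m) l2_dot (@boot_sum n g) (e j) ^+ 2.
pose W (g : {ffun 'I_n -> 'I_n}) := \sum_(j < dim n) boot_sum g j ^+ 2.
have WE (g : {ffun 'I_n -> 'I_n}) : bootstrap_stat (fun i => truncate (dim n) (z i)) (fun k : 'I_n => g k) = W g.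
  exact: bootstrap_statE.
under eq_bigr do rewrite WE.
have Q0 g : 0 <= Q g by apply: sumr_ge0 => j _; exact: sqr_ge0.
have W0 g : 0 <= W g by apply: sumr_ge0 => j _; exact: sqr_ge0.
pose p : R := n%:R^-1 ^+ n; have p0 : 0 <= p by rewrite exprn_ge0// invr_ge0.
(* Both W and Q are the squared norm minus a residual. Monotonicity replaces the residual at [dim n]
   by the one at the fixed D. *)
have WQ g : `|W g - Q g| <= residual (@delta R) D (boot_sum g) + residual e m (boot_sum g).
  have rA : l2_dot (boot_sum g) (boot_sum g) - W g = residual (@delta R) (dim n) (boot_sum g).
    by congr (_ - _); apply: eq_bigr => j _; rewrite l2_dot_delta.
  have := residual_le (@delta R) (boot_sum g) Dn.
  have := residual_ge0 (dim n) (boot_sum g) (@bessel_delta R).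
  have := residual_ge0 m (boot_sum g) e_bessel.
  by rewrite -rA /residual -/(Q g) ler_norml; lra.
have key : `|p * \sum_g expR (- (t * Q g)) - p * \sum_g expR (- (t * W g))|
   <= t * (sample_avg n (residual (@delta R) D) + sample_avg n (residual e m)).
  rewrite -mulrBr -sumrB normrM (ger0_norm p0).
  have := boot_residual_le D n0 (@bessel_delta R).
  have := boot_residual_le m n0 e_bessel.
  rewrite -/p => hb ha.
  apply: (@le_trans _ _ (t * (p * \sum_g residual (@delta R) D (boot_sum g)
     + p * \sum_g residual e m (boot_sum g)))); last by rewrite ler_pM2l//; exact: (lerD ha hb).
  rewrite -mulrDr mulrCA; apply: ler_wpM2l => //.
  rewrite -big_split/= mulr_sumr; apply: le_trans (ler_norm_sum _ _ _) _.
  apply: ler_sum => g _.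
  apply: le_trans (expRN_dist (mulr_ge0 (ltW t0) (Q0 g)) (mulr_ge0 (ltW t0) (W0 g))) _.
  by rewrite -mulrBr normrM gtr0_norm// ler_pM2l// distrC WQ.
have E1 : \sum_(j < m) lam j *+ (j == j) = \sum_(j < m) lam j.
  by apply: eq_bigr => j _; rewrite eqxx.
rewrite E1 in HB.
have tb : t * (sample_avg n (residual (@delta R) D) + sample_avg n (residual e m)) <= 4 * d.
  have -> : 4 * d = t * (4 * (d / t)) by field; rewrite gt_eqF.
  rewrite ler_pM2l//; move: HA HB HD Hm2; rewrite /= !ler_norml; lra.
have e6 : eps = d + d + 4 * d by rewrite /d; field.
move: Hm1 Hl key; rewrite -/p -/Q /= !ler_norml.
by rewrite e6; lra.
Unshelve. all: by end_near. Qed.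

End bootstrap_sample.

(** * Uniform convergence of the bootstrap distribution *)

Lemma ereal_sup_cvg0 {R : realType} (a : nat -> R -> \bar R) :
  (forall n x, (0 <= a n x)%E) ->
  (forall e : R, 0 < e -> \forall n \near \oo, forall x, (a n x <= e%:E)%E) ->
  ereal_sup (range (a n)) @[n --> \oo] --> 0%E.
Proof.
move=> a0 ae.
have s0 n : (0 <= ereal_sup (range (a n)))%E.
  by apply: le_trans (a0 n 0) _; apply: ereal_sup_ubound; exists 0.
have se (e : R) : 0 < e -> \forall n \near \oo, (ereal_sup (range (a n)) <= e%:E)%E.
  move=> /ae; apply: filterS => n h; apply: ge_ereal_sup => _ [x _ <-]; exact: h.
apply/fine_cvgP; split.
  have := se 1 ltr01; apply: filterS => n h.
  by rewrite ge0_fin_numE// (le_lt_trans h)// ltry.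
apply/cvgrPdist_le => e e0; have := se e e0; apply: filterS => n h.
rewrite /= sub0r normrN ger0_norm ?fine_ge0//.
by rewrite -lee_fin fineK// ge0_fin_numE// (le_lt_trans h)// ltry.
Qed.

Section bootstrap_consistency.
Context {R : realType} (z e : nat -> l2 R) (lam : nat -> R) (sig : R).
Hypothesis e_bessel : bessel_system e.
Hypothesis lam_ge0 : forall j, 0 <= lam j.
Hypothesis avg_sqr : sample_avg z n (fun u => l2_dot u u) @[n --> \oo] --> sig.
Hypothesis avg_mean : forall j,
  sample_avg z n (fun u => l2_dot u (e j)) @[n --> \oo] --> (0 : R).
Hypothesis avg_cov : forall i j,
  sample_avg z n (fun u => l2_dot u (e i) * l2_dot u (e j)) @[n --> \oo]
  --> lam j *+ (i == j).
Variables (dim : nat -> nat) (trace : nat -> R).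
Hypothesis dim_infty : dim @ \oo --> \oo.
Hypothesis avg_coord : forall k,
  sample_avg z n (fun u => l2_dot u (delta k) ^+ 2) @[n --> \oo] --> trace k.
Hypothesis trace_cvg : \sum_(k < n) trace k @[n --> \oo] --> sig.
Hypothesis lam_cvg : \sum_(j < m) lam j @[m --> \oo] --> sig.
(** For sig = 0 the limit law jumps at 0, where weak convergence would not give uniform convergence;
    W must be exactly 0. *)
Hypothesis z_degenerate : sig = 0 -> forall i, z i = 0.
Context d' (T' : measurableType d') (P' : probability T' R).
Variable N : nat -> {RV P' >-> R}.
Hypothesis N_indep : mutually_independent N.
Hypothesis N_normal : forall i, standard_normal (N i).
Context ds (Ts : measurableType ds) (Ps : probability Ts R).
Variable idx : forall n : nat, 'I_n -> {RV Ps >-> nat}.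
Hypothesis idx_boot : bootstrap_indices idx.

Let W n ws := bootstrap_stat (fun i => truncate (dim n) (z i))
  (fun k : 'I_n => idx k ws).
Let Wg n (g : {ffun 'I_n -> 'I_n}) : R :=
  bootstrap_stat (fun i => truncate (dim n) (z i)) (fun k : 'I_n => g k).

Let WE n ws : W n ws = Wg (idx_map idx_boot n ws).
Proof.
rewrite /W /Wg; congr (bootstrap_stat _ _); apply/funext => k.
by rewrite /idx_map ffunE.
Qed.

Let W_ge0 n ws : 0 <= W n ws.
Proof. by rewrite /W /bootstrap_stat; apply: mulr_ge0 => //; exact: sqr_ge0. Qed.

Let U n ws : R := expR (- W n ws).

Let mU n : measurable_fun setT (U n).
Proof.
rewrite /U; under eq_fun do rewrite WE.
exact: (measurable_idx_fun idx_boot (fun g => expR (- Wg g))).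
Qed.

Let U01 n ws : 0 <= U n ws <= 1.
Proof. by rewrite expR_ge0/= -expR0 ler_expR oppr_le0. Qed.

Local Notation V := (exp_chi2 lam N).

Let mV : measurable_fun setT V. Proof. exact: measurable_exp_chi2. Qed.

Let V01 w : 0 <= V w <= 1. Proof. exact: exp_chi2_itv. Qed.

(** The k-th moment of exp(-W) is the Laplace transform at t = k; the zeroth one is trivial and
    falls outside t > 0. *)
Lemma boot_moment_cvg k : \int[Ps]_ws (U n ws ^+ k) @[n --> \oo] --> \int[P']_w (V w ^+ k).
Proof.
case: k => [|k].
  under eq_fun do under eq_Rintegral do rewrite expr0.
  under eq_Rintegral do rewrite expr0.
  by rewrite Rintegral_setT_cst; under eq_fun do rewrite Rintegral_setT_cst; exact: cvg_cst.
have E n : \int[Ps]_ws (U n ws ^+ k.+1) = n%:R^-1 ^+ n *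
    \sum_(g : {ffun 'I_n -> 'I_n}) expR (- (k.+1%:R * Wg g)).
  rewrite -(Rintegral_idx_fun idx_boot (fun g => expR (- (k.+1%:R * Wg g)))).
  by apply: eq_Rintegral => ws _; rewrite /U WE -expRM_natl mulrN.
under eq_fun do rewrite E.
apply: (bootstrap_laplace_cvg e_bessel lam_ge0 avg_sqr avg_mean avg_cov dim_infty
  avg_coord trace_cvg lam_cvg) => //.
have := exp_chi2_moment N_indep N_normal lam_ge0 (k := k.+1).
rewrite -EFin_Rintegral; first exact: fine_cvg.
apply: (@bounded_integrable _ _ _ P' _ 1); first exact: measurable_funX.
by move=> w; have /andP[v0 v1] := V01 w; rewrite ger0_norm ?exprn_ge0// exprn_ile1.
Qed.

Let F n x := fine (Ps [set ws | W n ws <= x]).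
Let G x := fine (chi2_cdf lam N x).

Let FE n x : F n x = fine (Ps [set ws | expR (- x) <= U n ws]).
Proof.
congr (fine (Ps _)); apply/seteqP; split => ws /=;
by rewrite /U ler_expR lerN2.
Qed.

Let GE x : G x = fine (P' [set w | expR (- x) <= V w]).
Proof.
congr (fine (P' _)); apply/seteqP; split => w /=;
by move=> /(weighted_chi2_exp N lam_ge0).
Qed.

Let mW n (x : R) : measurable [set ws | W n ws <= x].
Proof.
have -> : [set ws | W n ws <= x] = [set ws | expR (- x) <= U n ws].
  by apply/seteqP; split => ws /=; rewrite /U ler_expR lerN2.
by rewrite -[X in measurable X]setTI; exact: measurable_fun_le.
Qed.

Let mG (x : R) : measurable [set w | (weighted_chi2 lam N w <= x%:E)%E].
Proof. exact: measurable_chi2_le. Qed.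

Lemma boot_cdf_uniform j0 : 0 < lam j0 -> forall eps, 0 < eps ->
  \forall n \near \oo, forall x, `|F n x - G x| <= eps.
Proof.
move=> lj0; apply: uniform_cdf_cvg.
- move=> n x y xy; apply: fine_le; rewrite ?fin_num_measure//.
  by apply: le_measure; rewrite ?inE// => ws /= /le_trans; apply.
- move=> x y xy; apply: fine_le; rewrite ?fin_num_measure//.
  apply: le_measure; rewrite ?inE// => w /= /le_trans; apply.
  by rewrite lee_fin.
- move=> n x; rewrite fine_ge0//= -[leRHS]/(fine 1%E).
  by apply: fine_le; rewrite ?fin_num_measure// probability_le1.
- move=> x; rewrite fine_ge0//= -[leRHS]/(fine 1%E).
  by apply: fine_le; rewrite ?fin_num_measure// probability_le1.
- move=> n x x0; rewrite /F (_ : [set _ | _] = set0) ?measure0//.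
  by apply/seteqP; split => ws //=; rewrite leNgt (lt_le_trans x0).
- by move=> x x0; rewrite /G chi2_cdf_neg.
- move=> eps eps0; have [h h0 hb] := window_bound_small lj0 eps0.
  exists h => // y; rewrite /G -lee_fin EFinD !fineK ?fin_num_measure//.
  apply: le_trans (chi2_cdf_window N_indep N_normal lam_ge0 y lj0 (ltW h0)) _.
  by rewrite leeD2l// lee_fin.
- move=> eps eps0.
  have sig0 : 0 <= sig.
    apply: (cvgr_to_ge lam_cvg); apply: nearW => m; exact: sumr_ge0.
  have lam_le (m : nat) : \sum_(j < m) lam j <= sig.
    have nd : nondecreasing_seq (fun m => \sum_(j < m) lam j).
      by apply/nondecreasing_seqP => k; rewrite big_ord_recr/= lerDl.
    have := nondecreasing_cvgn_le nd; rewrite (cvg_lim _ lam_cvg)//; apply.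
    exact: lam_cvg.
  (* Chosen so that exp(-t sig) >= 1 - eps / 2; then x is taken with t x = 2 / eps, whence exp(-t x)
     <= eps / 2. *)
  pose t := eps / 2 / (sig + 1); have s1 : 0 < sig + 1 by rewrite ltr_wpDl.
  have t0 : 0 < t by rewrite !divr_gt0.
  pose x := 2 / eps / t; exists x.
  have := chi2_cdf_ge N_indep N_normal lam_ge0 x lam_le (ltW t0).
  rewrite -[chi2_cdf _ _ _]fineK ?fin_num_measure// lee_fin -/(G x); apply: le_trans.
  have h1 : 1 - eps / 2 <= expR (- (t * sig)).
    apply: le_trans (expR_ge1Dx _); rewrite lerD2l lerN2.
    have -> : eps / 2 = t * (sig + 1) by rewrite /t divfK// gt_eqF.
    by rewrite ler_pM2l// lerDl.
  have h2 : expR (- (t * x)) <= eps / 2.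
    have -> : t * x = 2 / eps by rewrite /x mulrC divfK// gt_eqF.
    rewrite expRN -[leRHS]invf_div lef_pV2 ?posrE ?expR_gt0 ?divr_gt0//.
    by apply: le_trans (expR_ge1Dx _); rewrite lerDr.
  by lra.
- move=> x h eps x0 h0 eps0.
  pose eta := h / 2; have eta0 : 0 < eta by rewrite divr_gt0.
  (* Three times exp(-a eta) is then at most eps / 2, and the other half is left to the integrals of
     the test polynomial. *)
  pose a := (Num.truncn (6 / eps / eta)).+1.
  have ha : expR (- (a%:R * eta)) <= eps / 6.
    rewrite expRN -[leRHS]invf_div lef_pV2 ?posrE ?expR_gt0 ?divr_gt0//.
    apply: le_trans (expR_ge1Dx _); apply: (@le_trans _ _ (a%:R * eta)); last by rewrite lerDr.
    by rewrite -ler_pdivrMr//; exact/ltW/truncnS_gt.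
  have e20 : 0 < eps / 2 by rewrite divr_gt0.
  have := moment_poly_cvg mU mV U01 V01 boot_moment_cvg (p := test_poly a (test_exp a (x + eta))).
  move=> /cvgrPdist_le /(_ _ e20); apply: filterS => n hn.
  have h1 := cdf_compare Ps P' a (mU n) mV (U01 n) V01 x0 (ltW eta0).
  have h2 := cdf_compare P' Ps a mV (mU n) V01 (U01 n) x0 (ltW eta0).
  have e2h : 2 * eta = h by rewrite /eta; field.
  rewrite e2h -FE -GE in h1; rewrite e2h -GE -FE in h2.
  by move: hn; rewrite ler_norml; lra.
Qed.

Theorem bootstrap_consistency : ereal_sup (range (fun x : R =>
    `|Ps [set ws | (W n ws <= x)%R] - chi2_cdf lam N x|%E)) @[n --> \oo] --> 0%E.
Proof.
apply: (@ereal_sup_cvg0 _ (fun n x => `|Ps [set ws | (W n ws <= x)%R] - chi2_cdf lam N x|%E)).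
  by move=> n x; exact: abse_ge0.
move=> eps eps0.
have [[j0 lj0]|nlam] := pselect (exists j0, 0 < lam j0).
  have := boot_cdf_uniform lj0 eps0; apply: filterS => n h x.
  rewrite -[Ps _]fineK ?fin_num_measure// -[chi2_cdf _ _ _]fineK ?fin_num_measure//.
  by rewrite -EFinB lee_fin; exact: h.
have lam0 j : lam j = 0.
  apply/eqP; rewrite eq_le lam_ge0 andbT leNgt; apply/negP => lj; apply: nlam.
  by exists j.
have sig0 : sig = 0.
  apply/esym; apply: (@norm_cvg_unique _ _ _ _ _ _ _ lam_cvg).
  rewrite /= (_ : (fun m => _) = cst 0); first exact: cvg_cst.
  by apply/funext => m; rewrite big1.
exists 1%N => // n n0 x.
have W0 ws : W n ws = 0.
  rewrite WE /Wg bootstrap_statE// big1// => j _.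
  rewrite /boot_sum big1 ?expr0n// => k _; rewrite /sample_dev /sample_center.
  rewrite z_degenerate// big1 => [|i _]; last exact: z_degenerate.
  by rewrite scaler0 subrr scaler0.
have V0 w : (weighted_chi2 lam N w <= x%:E)%E <-> 0 <= x.
  have S0 m : square_sum lam N predT m w = 0.
    by rewrite /square_sum big1// => j _; rewrite lam0 mul0r.
  rewrite (weighted_chi2_le N lam_ge0); split => [/(_ 0%N)|x0 m]; by rewrite S0.
suff -> : Ps [set ws | W n ws <= x] = chi2_cdf lam N x.
  by rewrite subee ?fin_num_measure// abse0 lee_fin ltW.
rewrite /chi2_cdf; have [x0|x0] := leP 0 x.
  rewrite (_ : [set ws | W n ws <= x] = setT); last first.
    by apply/seteqP; split => ws //= _; rewrite W0.
  rewrite (_ : [set w | _] = setT); first by rewrite !probability_setT.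
  by apply/seteqP; split => w //= _; apply/V0.
rewrite (_ : [set ws | W n ws <= x] = set0); last first.
  by apply/seteqP; split => ws //=; rewrite W0 leNgt x0.
rewrite (_ : [set w | _] = set0); first by rewrite !measure0.
by apply/seteqP; split => w //= /V0; rewrite leNgt x0.
Qed.

End bootstrap_consistency.

Theorem theorem5 (R : realType)
  (dim : nat -> nat) (dim_infty : dim @ \oo --> \oo)
  (d : measure_display) (Omega : measurableType d) (P : probability Omega R)
  (Z : nat -> {RV P >-> l2 R})
  (Z_iid : iid Z)
  (Z_mean : l2_mean (Z 0%N) 0)
  (Z_sq : ('E_P[fun w => (`|Z 0%N w| ^+ 2)%R] < +oo)%E)
  (lam : nat -> R) (lam_eig : eigenvalue_list (l2_cov (Z 0%N)) lam)
  (d' : measure_display) (Omega' : measurableType d')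
  (P' : probability Omega' R)
  (N : nat -> {RV P' >-> R})
  (N_iid : iid N) (N_normal : forall i, standard_normal (N i))
  (ds : measure_display) (Omegas : measurableType ds)
  (Ps : probability Omegas R)
  (idx : forall n : nat, 'I_n -> {RV Ps >-> nat})
  (idx_boot : bootstrap_indices idx) :
  let F_infty (x : R) := P' [set w' | (weighted_chi2 lam N w' <= x%:E)%E] in
  let X (n : nat) (w : Omega) (i : nat) : 'rV[R]_(dim n) :=
    truncate (dim n) (Z i w) in
  let W (n : nat) (w : Omega) (ws : Omegas) : R :=
    bootstrap_stat (X n w) (fun k : 'I_n => idx n k ws) in
  {ae P, forall w : Omega,
    ereal_sup (range (fun x : R =>
      `|Ps [set ws | (W n w ws <= x)%R] - F_infty x|%E)) @[n --> \oo] --> 0%E}.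
Proof.
move=> F_infty X W.
have [e [e_bessel lam_ge0 cov_e lam_cvg]] := cov_spectral Z_sq lam_eig.
have mdot u : measurable_fun setT (fun x : l2 R => l2_dot x u).
  exact: (@measurable_l2_dot _ _ _ id).
(* The system e was chosen before the sample, so the strong laws below are countably many and share
   one null set. *)
have iZ2 := integrable_l2_dot2 Z_sq.
have ae1 : {ae P, forall w, sample_avg (Z ^~ w) n (fun u => l2_dot u u) @[n --> \oo]
    --> total_var (Z 0%N)}.
  apply: (iid_strong_law Z_iid (f := fun u => l2_dot u u)).
    exact: (@measurable_l2_sqr _ _ _ id).
  exact: integrable_l2_sqr.
have ae2 : {ae P, forall w k, sample_avg (Z ^~ w) n (fun u => l2_dot u (delta k) ^+ 2)
    @[n --> \oo] --> cov_form (Z 0%N) (delta k) (delta k)}.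
  apply: ae_foralln => k.
  apply: (iid_strong_law Z_iid (f := fun u => l2_dot u (delta k) ^+ 2)).
    exact: measurable_funX.
  exact: iZ2.
have ae3 : {ae P, forall w i j, sample_avg (Z ^~ w) n
    (fun u => l2_dot u (e i) * l2_dot u (e j)) @[n --> \oo] --> lam j *+ (i == j)}.
  apply: ae_foralln => i; apply: ae_foralln => j; rewrite -cov_e.
  apply: (iid_strong_law Z_iid (f := fun u => l2_dot u (e i) * l2_dot u (e j))).
    exact: measurable_funM.
  exact: iZ2.
have ae4 : {ae P, forall w j, sample_avg (Z ^~ w) n (fun u => l2_dot u (e j))
    @[n --> \oo] --> (0 : R)}.
  apply: ae_foralln => j.
  (* The weak mean is tested against e j. *)
  have <- : \int[P]_w l2_dot (Z 0%N w) (e j) = 0.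
    have := Z_mean (e j); rewrite unlock l2_dot0r /Rintegral => h.
    by under eq_integral do rewrite l2_dotC; rewrite h.
  apply: (iid_strong_law Z_iid (f := fun u => l2_dot u (e j))) => //.
  (* First moments are dominated through |x| <= 1 + x^2. *)
  have i1 : P.-integrable setT (EFin \o
      (fun w => 1 + l2_dot (Z 0%N w) (e j) * l2_dot (Z 0%N w) (e j))).
    apply: integrable_addR; last exact: iZ2.
    by apply: (@bounded_integrable _ _ _ P _ 1) => // w; rewrite normr1.
  apply: (le_integrable measurableT _ _ i1).
    by apply/measurable_EFinP; apply: measurable_l2_dot; exact: measurable_funP.
  move=> w _ /=; rewrite lee_fin [leRHS]ger0_norm; last first.
    by rewrite addr_ge0// -expr2 sqr_ge0.
  have := sqr_ge0 (l2_dot (Z 0%N w) (e j) - 1); have := sqr_ge0 (l2_dot (Z 0%N w) (e j) + 1).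
  have := sqr_ge0 (l2_dot (Z 0%N w) (e j)).
  by rewrite sqrrB sqrrD ler_norml !expr2; lra.
(* If E|Z|^2 = 0, every observation vanishes almost surely, by identity of laws. *)
have ae5 : {ae P, forall w, total_var (Z 0%N) = 0 -> forall i, Z i w = 0}.
  have [s0|s0] := eqVneq (total_var (Z 0%N)) 0; last by apply: aeW => w /eqP; rewrite (negbTE s0).
  suff : {ae P, forall w i, Z i w = 0} by apply: filterS.
  apply: ae_foralln => i.
  have msq : measurable_fun setT (fun u : l2 R => (l2_dot u u)%:E).
    by apply/measurable_EFinP; exact: (@measurable_l2_sqr _ _ _ id).
  have i0 : (\int[P]_w (l2_dot (Z i w) (Z i w))%:E = 0)%E.
    transitivity (\int[P]_w (l2_dot (Z 0%N w) (Z 0%N w))%:E)%E.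
      rewrite -!(@ge0_integral_distribution _ _ _ _ _ P _ (fun u => (l2_dot u u)%:E))//.
      - by apply: eq_measure_integral => A mA _; exact: Z_iid.2.
      - by move=> u; rewrite lee_fin l2_dot_ge0.
      - by move=> u; rewrite lee_fin l2_dot_ge0.
    by rewrite -EFin_Rintegral ?[Rintegral _ _ _]s0//; exact: integrable_l2_sqr.
  have mi : measurable_fun setT (fun w => (l2_dot (Z i w) (Z i w))%:E).
    by apply/measurable_EFinP; apply: measurable_l2_sqr; exact: measurable_funP.
  have : ae_eq P setT (fun w => (l2_dot (Z i w) (Z i w))%:E) (cst 0%E).
    apply/(ae_eq_integral_abs P measurableT mi).
    by rewrite -[RHS]i0; apply: eq_integral => w _; rewrite gee0_abs// lee_fin l2_dot_ge0.
  by apply: filterS => w /(_ I) [] /l2_dot_eq0.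
apply: filterS2 ae1 (filterI ae2 (filterI ae3 (filterI ae4 ae5))) => w a1 [a2 [a3 [a4 a5]]].
exact: (bootstrap_consistency e_bessel lam_ge0 a1 a4 a3 dim_infty a2
  (cov_form_trace Z_sq) lam_cvg a5 N_iid.1 N_normal idx_boot).
Qed.
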